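(* Let $0\le\alpha<1$, $n\in\mathbb{N}$, and $\zeta\in\mathbb{C}$ with $|\zeta|\le\frac{1}{2n-1}$. Let $f=h+\overline{g}$ be harmonic in $\mathbb{D}=\{|z|<1\}$ with $h(0)=g(0)=0$, $h'(0)=1$, such that $\operatorname{Re}\big(1+\frac{zh''(z)}{h'(z)}\big)>\alpha$ and $g'(z)=\zeta z^nh'(z)$ for all $z\in\mathbb{D}$. Then for $0<r<1$ the area $\mathcal{A}(f(\mathbb{D}_r))$ of $f(\mathbb{D}_r)$, where $\mathbb{D}_r=\{|z|<r\}$, satisfies $$2\pi\int_0^r\frac{\rho(1-|\zeta|^2\rho^{2n})}{(1+\rho)^{4(1-\alpha)}}\,d\rho\le\mathcal{A}(f(\mathbb{D}_r))\le2\pi\int_0^r\frac{\rho(1-|\zeta|^2\rho^{2n})}{(1-\rho)^{4(1-\alpha)}}\,d\rho.$$ *)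

(* Defs.v *)
From HB Require Import structures.
From mathcomp Require Import all_boot all_order all_algebra.
From mathcomp Require Import all_classical all_reals all_analysis.
From mathcomp Require Import Rstruct Rstruct_topology.
From Stdlib Require Import Reals.

Definition plane_area (A : set (R * R)) : \bar R :=
  ((@lebesgue_measure R) \x (@lebesgue_measure R))%E A.

Definition plane_area_between (lo : R) (A : set (R * R)) (hi : R) : Prop :=
  (lo%:E <= plane_area A)%E /\ (plane_area A <= hi%:E)%E.

From Coquelicot Require Import Coquelicot.

Definition C_has_deriv (f : C -> C) (z l : C) : Prop :=
  @is_derive C_AbsRing C_NormedModule f z l.

Definition disk (r : R) : C -> Prop := fun z => (Cmod z < r)%R.

(* Image of the disk of radius r under f, as a subset of the plane R x R
   (Coquelicot's C is definitionally R * R). *)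
Definition image_disk (f : C -> C) (r : R) : set (R * R) :=
  fun p => exists z : C, disk r z /\ p = f z.

(* Main.v *)
(* Since h is holomorphic with continuous derivative, Cauchy's formula makes p = 1 + z h''/h'
   holomorphic. Schwarz's lemma applied to (p - 1)/(p + 1 - 2 alpha) bounds Re p from both
   sides, and integrating Re (p - 1) = d log|h'| / d log r along a radius gives
   (1 + r)^(-4(1 - alpha)) <= |h'|^2 <= (1 - r)^(-4(1 - alpha)).
   As Re p > 0 has mean 1 on circles, the normal z h'(z) of the curve h(|z| = r) makes exactly
   one monotone turn, so h(|z| <= r) lies on one side of each of its tangents. Hence h is
   injective and, as |g'| < |h'|, so is f: |g z - g w| < |h z - h w| for z <> w.
   The area of f(|z| < r) is then the integral of the Jacobian
   |h'|^2 (1 - |zeta|^2 |z|^(2n)). In the chart w |-> f(e^w) on [ln d, ln r] x [0, 2 pi] this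
   is compared with the claimed radial integrals by repeated bisection of the rectangle: an
   inequality between area and integral that fails on a rectangle fails on one of its quarters,
   hence on arbitrarily small ones, where it contradicts differentiability. *)

Require Import Defs.
From mathcomp Require all_boot all_order all_algebra all_classical all_reals all_analysis.
From mathcomp Require Rstruct measurable_realfun lra ring.
From Stdlib Require Import Reals Lra Psatz ClassicalEpsilon.
From Coquelicot Require Import Coquelicot.

(** The obstacle is that [plane_area] is applied to images whose measurability is never established.
    Upper bounds therefore come from measurable covers and lower bounds from measurable subsets,
    both transferred by monotonicity of the product measure on arbitrary sets; exact areas are
    computed for parallelograms only. Injectivity enters through the lower bound, where images of
    disjoint pieces must be disjoint; a cover may overlap. Univalence rests on a uniform gap: the
    bound on [zeta] forces [n >= 1] and [|zeta| <= 1], so [|g'| <= |z| |h'|], and on [|z| <= t] the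
    dilatation is at most [t < 1]. This leaves room for a Lipschitz constant strictly between [t]
    and 1. The chart by the exponential is chosen because it is conformal and turns circles into
    vertical segments: the comparison density depends on [Re w] alone, so its integral over a
    rectangle is a height times an increment of one primitive. That product is additive under
    cutting in both directions, which is all that bisection asks for, and no double integral
    appears. *)

Module PlaneArea.

Import all_boot all_order all_algebra.
Import all_classical all_reals all_analysis.
Import Rstruct.
Import measurable_realfun lra ring.
Import Order.TTheory GRing.Theory Num.Theory.
Local Open Scope classical_set_scope.
Local Open Scope ring_scope.

(** * Lebesgue measure of the plane under affine maps *)

Section affine_maps.
Context {R : realType}.
Local Notation mu := (@lebesgue_measure R).
Local Notation RT := (measurableTypeR R).
Local Notation mu2 := ((@lebesgue_measure R) \x (@lebesgue_measure R))%E.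

Lemma measurable_affine (a b : R) :
  measurable_fun setT ((fun y => a * y + b) : R -> R).
Proof. by apply: measurable_funD => //; apply: measurable_funM. Qed.

(** [|a|] times the pushforward of [mu] under the affine map has the right value on half-open
    intervals, hence is [mu] by uniqueness of Lebesgue measure. *)
Lemma lebesgue_measure_affine (a b : R) (B : set RT) : a != 0 -> measurable B ->
  mu ((fun y => a * y + b) @^-1` B) = (`|a|^-1%:E * mu B)%E.
Proof.
move=> a0 mB.
pose T := (fun y => a * y + b) : RT -> RT.
have mT : measurable_fun setT T by exact: measurable_affine.
have na0 : 0 <= `|a| by [].
pose p : {measure set RT -> \bar R} :=
  measure_function_pushforward__canonical__measure_function_Measure mu mT.
pose m : {measure set RT -> \bar R} := mscale (NngNum na0) p.
have H : mu B = m B.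
  apply: (@lebesgue_measure_unique _ m) => // _ [[x y]] _ <-.
  rewrite /m/= /mscale/= /p /pushforward /=.
  case: (ltgtP a 0) a0 => // ha _.
  (* A negative slope reverses the interval: the preimage is closed on the left and open on the
     right. *)
  - have -> : (T @^-1` `]x, y]) = [set` Interval (BLeft ((y - b) / a)) (BLeft ((x - b) / a))].
      apply/seteqP; split => t /=; rewrite /T !in_itv/= => /andP[h1 h2]; apply/andP; split.
      + by rewrite ler_ndivrMr//; lra.
      + by rewrite ltr_ndivlMr//; lra.
      + by move: h2; rewrite ltr_ndivlMr//; lra.
      + by move: h1; rewrite ler_ndivrMr//; lra.
    rewrite !lebesgue_measure_itv/= !lte_fin ltr_ndivlMr// divfK ?lt_eqF//.
    rewrite ltrBlDr subrK; case: ifPn => xy; last by rewrite mule0.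
    rewrite -!EFinB -EFinM; congr (_%:E); rewrite ltr0_norm//.
    by rewrite -mulrBl mulNr mulrC divfK ?lt_eqF//; lra.
  - have -> : (T @^-1` `]x, y]) = `](x - b) / a, (y - b) / a]%classic.
      apply/seteqP; split => t /=; rewrite /T !in_itv/= => /andP[h1 h2]; apply/andP; split.
      + by rewrite ltr_pdivrMr//; lra.
      + by rewrite ler_pdivlMr//; lra.
      + by move: h1; rewrite ltr_pdivrMr//; lra.
      + by move: h2; rewrite ler_pdivlMr//; lra.
    rewrite !lebesgue_measure_itv/= !lte_fin ltr_pdivrMr// divfK ?gt_eqF//.
    rewrite ltrBlDr subrK; case: ifPn => xy; last by rewrite mule0.
    rewrite -!EFinB -EFinM; congr (_%:E); rewrite gtr0_norm//.
    by rewrite -mulrBl mulrC divfK ?gt_eqF//; lra.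
rewrite H /m /mscale /= muleA -EFinM mulVf ?mul1e//.
by rewrite normr_eq0.
Qed.

(** The area is defined by integrating over vertical slices; a map that acts on the first coordinate
    is easier to follow on horizontal ones. *)
Lemma product_measure12 (A : set (RT * RT)) : measurable A ->
  mu2 A = (mu \x^ mu)%E A.
Proof.
by move=> mA; apply: product_measure_unique => // B C mB mC; exact: product_measure2E.
Qed.

Lemma measurable_affine2 (a b c : R) :
  measurable_fun setT ((fun p => a * p.1 + b * p.2 + c) : R * R -> R).
Proof.
apply: measurable_funD => //; apply: measurable_funD.
  by apply: measurable_funM => //.
by apply: measurable_funM => //.
Qed.

Definition affine (a b e c d k : R) : RT * RT -> RT * RT :=
  fun p => (a * p.1 + b * p.2 + e, c * p.1 + d * p.2 + k).

Lemma measurable_affine_preimage a b e c d k (A : set (RT * RT)) : measurable A ->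
  measurable (affine a b e c d k @^-1` A).
Proof.
move=> mA; rewrite -[X in measurable X]setTI.
have : measurable_fun setT (affine a b e c d k).
  apply/measurable_fun_pairP; split; exact: measurable_affine2.
by apply.
Qed.

(** On the slice at [x] the map is [y => d * y + (c * x + k)], and its factor [|d|^-1] does not
    depend on [x]. *)
Lemma area_affine_y (c d k : R) (A : set (RT * RT)) : d != 0 -> measurable A ->
  mu2 (affine 1 0 0 c d k @^-1` A) = (`|d|^-1%:E * mu2 A)%E.
Proof.
move=> d0 mA; rewrite /product_measure1 -ge0_integralZl//=; last exact: measurable_fun_xsection.
apply: eq_integral => x _ /=.
rewrite -(lebesgue_measure_affine d (c * x + k))//; last exact: measurable_xsection.
congr (mu _); rewrite !xsectionE -comp_preimage; congr (_ @^-1` A).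
by apply/funext => y; rewrite /affine /=; congr pair; lra.
Qed.

Lemma area_affine_x (a b e : R) (A : set (RT * RT)) : a != 0 -> measurable A ->
  mu2 (affine a b e 0 1 0 @^-1` A) = (`|a|^-1%:E * mu2 A)%E.
Proof.
move=> a0 mA; rewrite !product_measure12//; last exact: measurable_affine_preimage.
rewrite /product_measure2 -ge0_integralZl//=; last exact: measurable_fun_ysection.
apply: eq_integral => y _ /=.
rewrite -(lebesgue_measure_affine a (b * y + e))//; last exact: measurable_ysection.
congr (mu _); rewrite !ysectionE -comp_preimage; congr (_ @^-1` A).
by apply/funext => x; rewrite /affine /=; congr pair; lra.
Qed.

(** For [a != 0] the matrix is a product of two triangular ones that each change a single
    coordinate, with factors [a] and [d - c * b / a]; their product is the determinant. *)
Lemma area_affine (a b e c d k : R) (A : set (RT * RT)) :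
  a * d - b * c != 0 -> measurable A ->
  mu2 (affine a b e c d k @^-1` A) = (`|a * d - b * c|^-1%:E * mu2 A)%E.
Proof.
move: a b e c d k A.
have main a b e c d k (A : set (RT * RT)) : a != 0 -> a * d - b * c != 0 -> measurable A ->
    mu2 (affine a b e c d k @^-1` A) = (`|a * d - b * c|^-1%:E * mu2 A)%E.
  move=> a0 D0 mA.
  pose d' := d - c * b / a.
  have Ed : a * d - b * c = a * d' by rewrite /d' mulrBr mulrCA divff// mulr1 (mulrC c).
  have d'0 : d' != 0 by move: D0; rewrite Ed mulf_eq0 negb_or => /andP[].
  have -> : affine a b e c d k @^-1` A =
      affine a b e 0 1 0 @^-1` (affine 1 0 0 (c / a) d' (k - c * e / a) @^-1` A).
    rewrite -comp_preimage; congr (_ @^-1` A); apply/funext => -[x y].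
    rewrite /affine /=; congr pair; first by lra.
    by rewrite /d'; field.
  rewrite area_affine_x// ?area_affine_y//; last exact: measurable_affine_preimage.
  by rewrite muleA -EFinM -invfM -normrM mulrC Ed mulrC.
move=> a b e c d k A D0 mA.
have [a0|] := eqVneq a 0; last by move=> a0; exact: main.
(* When [a = 0] the determinant forces [c != 0], so adding the second row to the first gives a
   nonzero corner with the same determinant. *)
have -> : affine a b e c d k @^-1` A =
    affine (a + c) (b + d) (e + k) c d k @^-1` (affine 1 (-1) 0 0 1 0 @^-1` A).
  rewrite -comp_preimage; congr (_ @^-1` A); apply/funext => -[x y].
  by rewrite /affine /=; congr pair; rewrite ?mul0r !mul1r; lra.
have DE : (a + c) * d - (b + d) * c = a * d - b * c.
  by rewrite !mulrDl (mulrC c d); lra.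
rewrite main ?DE//; last 2 first.
- by apply: contra_neq D0; rewrite a0 add0r => ->; rewrite mulr0 mul0r subrr.
- exact: measurable_affine_preimage.
by rewrite main ?oner_eq0// ?mulr1 ?mulr0 ?subr0 ?oner_eq0// normr1 invr1 mul1e.
Qed.

(** Holds for arbitrary sets: on sections [mu] is an outer measure, and the integral of a
    nonnegative function is a supremum over simple functions below it; both are monotone without
    measurability. *)
Lemma le_mu2 (A B : set (RT * RT)) : A `<=` B -> (mu2 A <= mu2 B)%E.
Proof.
move=> AB; rewrite /product_measure1.
rewrite !ge0_integralTE//.
apply: le_ereal_sup => _ /= [f fA <-]; exists f => // x.
apply: (le_trans (fA x)); apply: le_mu_ext; exact: le_xsection.
Qed.

Lemma mu2_itv (x1 x2 y1 y2 : R) : x1 <= x2 -> y1 <= y2 ->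
  mu2 (`[x1, x2]%classic `*` `[y1, y2]%classic) = ((x2 - x1) * (y2 - y1))%:E.
Proof.
move=> hx hy; rewrite product_measure1E//= !lebesgue_measure_itv/= !lte_fin.
move: hx hy; rewrite !le_eqVlt => /predU1P[->|hx] /predU1P[->|hy];
  rewrite ?ltxx ?hx ?hy ?subrr ?mule0 ?mul0e ?mulr0 ?mul0r//.
Qed.

End affine_maps.

(** * Area bounds by covering and packing *)

Local Notation RT := (measurableTypeR R).

(* Covering by, respectively packing with, measurable sets: this spares proving that
   images are measurable. *)
Definition area_le (A : R * R -> Prop) (m : R) : Prop :=
  exists U : set (RT * RT), measurable U /\ A `<=` U /\ (plane_area U <= m%:E)%E.

Definition area_ge (A : R * R -> Prop) (m : R) : Prop :=
  exists U : set (RT * RT), measurable U /\ U `<=` A /\ (m%:E <= plane_area U)%E.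

Lemma area_le_mono (A B : R * R -> Prop) (m m' : R) :
  (forall p, A p -> B p) -> (m <= m')%coqR -> area_le B m -> area_le A m'.
Proof.
move=> AB /RleP mm [U [mU [BU Um]]]; exists U; split=> //; split.
  by move=> p /AB /BU.
by rewrite (le_trans Um)// lee_fin.
Qed.

Lemma area_ge_mono (A B : R * R -> Prop) (m m' : R) :
  (forall p, B p -> A p) -> (m' <= m)%coqR -> area_ge B m -> area_ge A m'.
Proof.
move=> AB /RleP mm [U [mU [BU Um]]]; exists U; split=> //; split.
  by move=> p /BU /AB.
by rewrite (le_trans _ Um)// lee_fin.
Qed.

Lemma area_le_union (A B C : R * R -> Prop) (a b : R) :
  (forall p, C p -> A p \/ B p) ->
  area_le A a -> area_le B b -> area_le C (a + b)%coqR.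
Proof.
move=> CAB [U [mU [AU Ua]]] [V [mV [BV Vb]]]; exists (U `|` V).
split; first exact: measurableU.
split; first by move=> p /CAB[/AU|/BV]; [left|right].
apply: le_trans (measureU2 _ mU mV) _.
by rewrite RplusE EFinD leeD.
Qed.

Lemma area_ge_union (A B C : R * R -> Prop) (a b : R) :
  (forall p, A p \/ B p -> C p) -> (forall p, A p -> B p -> False) ->
  area_ge A a -> area_ge B b -> area_ge C (a + b)%coqR.
Proof.
move=> CAB AB [U [mU [AU Ua]]] [V [mV [BV Vb]]]; exists (U `|` V).
split; first exact: measurableU.
split; first by move=> p [/AU|/BV] ?; apply: CAB; [left|right].
rewrite /plane_area measureU//.
  by rewrite RplusE EFinD leeD.
by apply/seteqP; split => // p [/AU /AB h /BV /h].
Qed.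

Lemma area_le_plane (A : R * R -> Prop) (m : R) :
  area_le A m -> (plane_area A <= m%:E)%E.
Proof. by move=> [U [_ [AU]]]; apply: le_trans; exact: le_mu2. Qed.

Lemma area_ge_plane (A : R * R -> Prop) (m : R) :
  area_ge A m -> (m%:E <= plane_area A)%E.
Proof. by move=> [U [_ [AU h]]]; apply: (le_trans h); exact: le_mu2. Qed.

Lemma plane_area_between_eps (A : R * R -> Prop) (lo hi : R) :
  (forall eps, (0 < eps)%coqR -> area_ge A (lo - eps)%coqR) ->
  (forall eps, (0 < eps)%coqR -> area_le A (hi + eps)%coqR) ->
  plane_area_between lo A hi.
Proof.
move=> Hlo Hhi; split.
  apply/lee_addgt0Pr => e /RltP e0.
  have := area_ge_plane _ _ (Hlo e e0).
  by rewrite RminusE EFinB leeBlDr.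
apply/lee_addgt0Pr => e /RltP e0.
by have := area_le_plane _ _ (Hhi e e0); rewrite RplusE EFinD.
Qed.

(** The preimage of a box is measurable, so it serves as its own cover and its own packing. [A]
    enters through an equivalence so that any presentation of the parallelogram fits. *)
Lemma affine_box (a b e c d k x1 x2 y1 y2 : R) :
  (a * d - b * c <> 0)%coqR -> (x1 <= x2)%coqR -> (y1 <= y2)%coqR ->
  forall A : R * R -> Prop,
  (forall p, A p <-> (x1 <= a * p.1 + b * p.2 + e <= x2)%coqR /\
     (y1 <= c * p.1 + d * p.2 + k <= y2)%coqR) ->
  area_le A ((x2 - x1) * (y2 - y1) / Rabs (a * d - b * c))%coqR /\
  area_ge A ((x2 - x1) * (y2 - y1) / Rabs (a * d - b * c))%coqR.
Proof.
move=> /eqP D0 /RleP hx /RleP hy A HA.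
rewrite !(RminusE, RplusE, RmultE, RdivE, RabsE) in D0 *.
pose U : set (RT * RT) := affine a b e c d k @^-1` (`[x1, x2]%classic `*` `[y1, y2]%classic).
have mB : measurable (`[x1, x2]%classic `*` `[y1, y2]%classic : set (RT * RT)).
  by apply: measurableX.
have mU : measurable U by exact: measurable_affine_preimage.
have AU p : A p <-> U p.
  rewrite HA /U /affine /= !in_itv /=; split.
    by move=> [[/RleP h1 /RleP h2] [/RleP h3 /RleP h4]]; split; apply/andP.
  by move=> [/andP[h1 h2] /andP[h3 h4]]; split; split; apply/RleP.
have E : plane_area U = ((x2 - x1) * (y2 - y1) / `|a * d - b * c|)%:E.
  by rewrite /plane_area area_affine// mu2_itv// -EFinM mulrC.
by split; exists U; rewrite E; split => //; split => // p /AU.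
Qed.
End PlaneArea.

Open Scope R_scope.
Import PlaneArea.

(** * Modulus, real and imaginary parts *)

Lemma Cmod_sqr (z : C) : Cmod z * Cmod z = Re z * Re z + Im z * Im z.
Proof. pose proof (Cmod2_alt z) as H; simpl in H; lra. Qed.

Lemma im_le_Cmod (z : C) : Rabs (Im z) <= Cmod z.
Proof. eapply Rle_trans; [apply Rmax_r | apply Rmax_Cmod]. Qed.

Lemma Cmod_le_sum (z : C) : Cmod z <= Rabs (Re z) + Rabs (Im z).
Proof.
  apply Rsqr_incr_0_var; unfold Rsqr.
  - rewrite Cmod_sqr.
    rewrite <- (Rabs_pos_eq (Re z * Re z)), <- (Rabs_pos_eq (Im z * Im z)) by nra.
    rewrite !Rabs_mult.
    pose proof (Rabs_pos (Re z)); pose proof (Rabs_pos (Im z)); nra.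
  - pose proof (Rabs_pos (Re z)); pose proof (Rabs_pos (Im z)); lra.
Qed.

Lemma Ceq (z w : C) : Re z = Re w -> Im z = Im w -> z = w.
Proof. destruct z, w; simpl; intros; subst; reflexivity. Qed.

Lemma re_plus (a b : C) : Re (a + b)%C = Re a + Re b. Proof. reflexivity. Qed.
Lemma im_plus (a b : C) : Im (a + b)%C = Im a + Im b. Proof. reflexivity. Qed.
Lemma re_minus (a b : C) : Re (a - b)%C = Re a - Re b. Proof. reflexivity. Qed.
Lemma im_minus (a b : C) : Im (a - b)%C = Im a - Im b. Proof. reflexivity. Qed.
Lemma re_opp (a : C) : Re (- a)%C = - Re a. Proof. reflexivity. Qed.

Lemma Cmod_triangle_minus (a b : C) : Cmod (a - b)%C <= Cmod a + Cmod b.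
Proof.
  unfold Cminus. eapply Rle_trans; [apply Cmod_triangle|].
  rewrite Cmod_opp; lra.
Qed.

Lemma Cmod_minus_sym (a b : C) : Cmod (a - b)%C = Cmod (b - a)%C.
Proof. rewrite <- Cmod_opp. f_equal. ring. Qed.

Lemma Cmod_triangle_rev (a b : C) : Cmod a - Cmod b <= Cmod (a - b)%C.
Proof.
  replace a with ((a - b) + b)%C at 1 by ring.
  pose proof (Cmod_triangle (a - b)%C b); lra.
Qed.

(** * Derivatives and continuity in epsilon-delta form *)

Definition cder (f : C -> C) (z l : C) : Prop :=
  forall eps, 0 < eps -> exists del, 0 < del /\ forall w, Cmod (w - z)%C < del ->
    Cmod (f w - f z - l * (w - z))%C <= eps * Cmod (w - z)%C.

Definition ccont (f : C -> C) (z : C) : Prop :=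
  forall eps, 0 < eps -> exists del, 0 < del /\ forall w, Cmod (w - z)%C < del ->
    Cmod (f w - f z)%C < eps.

(** Componentwise, so that theorems on real derivatives and integrals apply directly; [pder_eps]
    recovers the estimate with [Cmod]. *)
Definition pder (g : R -> C) (t : R) (v : C) : Prop :=
  is_derive (fun s => Re (g s)) t (Re v) /\ is_derive (fun s => Im (g s)) t (Im v).

Lemma cder_of_has_deriv (f : C -> C) (z l : C) : @is_derive C_AbsRing C_NormedModule f z l -> cder f z l.
Proof.
  intros [_ H] eps Heps.
  specialize (H z (fun P HP => HP) (mkposreal eps Heps)).
  destruct H as [d Hd].
  exists d; split; [apply cond_pos|]. intros w Hw.
  specialize (Hd w Hw).
  rewrite Rmult_comm in Hd; rewrite Rmult_comm.
  rewrite (Cmult_comm l). exact Hd.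
Qed.

Lemma is_derive_eps (g : R -> R) (t l : R) :
  is_derive g t l <->
  forall eps, 0 < eps -> exists del, 0 < del /\ forall s, Rabs (s - t) < del ->
    Rabs (g s - g t - (s - t) * l) <= eps * Rabs (s - t).
Proof.
  split.
  - intros [_ H] eps Heps.
    destruct (H t (fun P HP => HP) (mkposreal eps Heps)) as [d Hd].
    exists d; split; [apply cond_pos|]. intros s Hs. exact (Hd s Hs).
  - intros H. split; [apply is_linear_scal_l|].
    intros x Hx eps.
    pose proof (is_filter_lim_locally_unique (V := AbsRing_NormedModule R_AbsRing) t x Hx) as E.
    subst x.
    destruct (H eps (cond_pos eps)) as [d [Hd H']].
    exists (mkposreal d Hd). intros s Hs. exact (H' s Hs).
Qed.

Lemma pder_eps (g : R -> C) (t : R) (v : C) :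
  pder g t v <->
  forall eps, 0 < eps -> exists del, 0 < del /\ forall s, Rabs (s - t) < del ->
    Cmod (g s - g t - (s - t)%R * v)%C <= eps * Rabs (s - t).
Proof.
  unfold pder; rewrite !is_derive_eps; split.
  - intros [H1 H2] eps Heps.
    destruct (H1 (eps / 2)) as [d1 [Hd1 K1]]; [lra|].
    destruct (H2 (eps / 2)) as [d2 [Hd2 K2]]; [lra|].
    exists (Rmin d1 d2); split; [apply Rmin_pos; lra|].
    intros s Hs.
    specialize (K1 s (Rlt_le_trans _ _ _ Hs (Rmin_l _ _))).
    specialize (K2 s (Rlt_le_trans _ _ _ Hs (Rmin_r _ _))).
    eapply Rle_trans; [apply Cmod_le_sum|].
    rewrite !re_minus, !im_minus, re_scal_l, im_scal_l. lra.
  - intros H; split; intros eps Heps; destruct (H eps Heps) as [d [Hd K]];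
      exists d; (split; [lra|]); intros s Hs; specialize (K s Hs);
      (eapply Rle_trans; [|exact K]).
    + rewrite <- re_scal_l, <- !re_minus. apply re_le_Cmod.
    + rewrite <- im_scal_l, <- !im_minus. apply im_le_Cmod.
Qed.

Lemma cder_ccont (f : C -> C) (z l : C) : cder f z l -> ccont f z.
Proof.
  intros H eps Heps.
  destruct (H 1 Rlt_0_1) as [d [Hd K]].
  pose proof (Cmod_ge_0 l).
  exists (Rmin d (eps / (Cmod l + 2))); split.
  { apply Rmin_pos; [lra|]. apply Rdiv_lt_0_compat; lra. }
  intros w Hw.
  specialize (K w (Rlt_le_trans _ _ _ Hw (Rmin_l _ _))).
  pose proof (Rlt_le_trans _ _ _ Hw (Rmin_r _ _)) as Hw2.
  replace (f w - f z)%C with ((f w - f z - l * (w - z)) + l * (w - z))%C by ring.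
  eapply Rle_lt_trans; [apply Cmod_triangle|]. rewrite Cmod_mult.
  pose proof (Cmod_ge_0 (w - z)%C).
  apply (Rmult_lt_compat_r (Cmod l + 2)) in Hw2; [|lra].
  unfold Rdiv in Hw2; rewrite Rmult_assoc, Rinv_l in Hw2; nra.
Qed.

Lemma cder_ext_loc (f g : C -> C) (z l : C) (r : R) : 0 < r ->
  (forall w, Cmod (w - z)%C < r -> f w = g w) -> cder f z l -> cder g z l.
Proof.
  intros Hr E H eps Heps. destruct (H eps Heps) as [d [Hd K]].
  exists (Rmin d r); split; [apply Rmin_pos; lra|]. intros w Hw.
  pose proof (Rlt_le_trans _ _ _ Hw (Rmin_l _ _)).
  pose proof (Rlt_le_trans _ _ _ Hw (Rmin_r _ _)).
  rewrite <- !E; auto. replace (z - z)%C with (RtoC 0) by ring. rewrite Cmod_0; lra.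
Qed.

Lemma cder_unique (f : C -> C) (z l l' : C) : cder f z l -> cder f z l' -> l = l'.
Proof.
  intros H H'.
  destruct (Ceq_dec l l') as [|N]; [assumption|exfalso].
  assert (P : 0 < Cmod (l' - l)%C).
  { apply Cmod_gt_0. intro E. apply N. replace l with (l' - (l' - l))%C by ring.
    rewrite E. ring. }
  set (e := Cmod (l' - l)%C) in *.
  destruct (H (e / 4)) as [d [Hd K]]; [lra|].
  destruct (H' (e / 4)) as [d' [Hd' K']]; [lra|].
  set (s := Rmin d d' / 2).
  assert (Hs : 0 < s < Rmin d d') by (pose proof (Rmin_pos d d' Hd Hd'); unfold s; lra).
  assert (Es : Cmod (z + RtoC s - z)%C = s).
  { replace (z + RtoC s - z)%C with (RtoC s) by ring. rewrite Cmod_R, Rabs_pos_eq; lra. }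
  specialize (K (z + RtoC s)%C). specialize (K' (z + RtoC s)%C).
  rewrite Es in K, K'.
  specialize (K (Rlt_le_trans _ _ _ (proj2 Hs) (Rmin_l _ _))).
  specialize (K' (Rlt_le_trans _ _ _ (proj2 Hs) (Rmin_r _ _))).
  assert (E : Cmod ((l' - l) * RtoC s)%C <= e / 4 * s + e / 4 * s).
  { replace ((l' - l) * RtoC s)%C with
      ((f (z + RtoC s) - f z - l * (z + RtoC s - z))
       - (f (z + RtoC s) - f z - l' * (z + RtoC s - z)))%C by ring.
    eapply Rle_trans; [apply Cmod_triangle_minus|]. lra. }
  rewrite Cmod_mult, Cmod_R, Rabs_pos_eq in E by lra. fold e in E. nra.
Qed.

Lemma cder_eq (f : C -> C) (z l l' : C) : cder f z l -> l = l' -> cder f z l'.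
Proof. intros H E; rewrite <- E; exact H. Qed.

Lemma pder_eq (f : R -> C) (t : R) (l l' : C) : pder f t l -> l = l' -> pder f t l'.
Proof. intros H E; rewrite <- E; exact H. Qed.

Lemma cder_const (c z : C) : cder (fun _ => c) z 0.
Proof.
  intros eps Heps; exists 1; split; [lra|]; intros w _.
  replace (c - c - 0 * (w - z))%C with (RtoC 0) by ring. rewrite Cmod_0.
  pose proof (Cmod_ge_0 (w - z)%C); nra.
Qed.

Lemma cder_id (z : C) : cder (fun w => w) z 1.
Proof.
  intros eps Heps; exists 1; split; [lra|]; intros w _.
  replace (w - z - 1 * (w - z))%C with (RtoC 0) by ring. rewrite Cmod_0.
  pose proof (Cmod_ge_0 (w - z)%C); nra.
Qed.

Lemma cder_plus (f g : C -> C) (z a b : C) :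
  cder f z a -> cder g z b -> cder (fun w => f w + g w)%C z (a + b)%C.
Proof.
  intros H1 H2 eps Heps.
  destruct (H1 (eps / 2)) as [d1 [Hd1 K1]]; [lra|].
  destruct (H2 (eps / 2)) as [d2 [Hd2 K2]]; [lra|].
  exists (Rmin d1 d2); split; [apply Rmin_pos; lra|]. intros w Hw.
  specialize (K1 w (Rlt_le_trans _ _ _ Hw (Rmin_l _ _))).
  specialize (K2 w (Rlt_le_trans _ _ _ Hw (Rmin_r _ _))).
  replace (f w + g w - (f z + g z) - (a + b) * (w - z))%C with
    ((f w - f z - a * (w - z)) + (g w - g z - b * (w - z)))%C by ring.
  eapply Rle_trans; [apply Cmod_triangle|]. lra.
Qed.

Lemma ccont_bounded (f : C -> C) (z : C) : ccont f z ->
  exists M del, 0 < M /\ 0 < del /\ forall w, Cmod (w - z)%C < del -> Cmod (f w) <= M.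
Proof.
  intros H. destruct (H 1 Rlt_0_1) as [d [Hd K]].
  exists (Cmod (f z) + 1), d. pose proof (Cmod_ge_0 (f z)).
  split; [lra|split; [lra|]]. intros w Hw. specialize (K w Hw).
  pose proof (Cmod_triangle_rev (f w) (f z)); lra.
Qed.

Lemma cder_mult (f g : C -> C) (z a b : C) :
  cder f z a -> cder g z b -> cder (fun w => f w * g w)%C z (a * g z + f z * b)%C.
Proof.
  intros H1 H2 eps Heps.
  destruct (ccont_bounded g z (cder_ccont _ _ _ H2)) as [M [d0 [HM [Hd0 K0]]]].
  pose proof (Cmod_ge_0 a) as Pa. pose proof (Cmod_ge_0 (f z)) as Pf.
  set (D := M + Cmod a + Cmod (f z) + 1).
  assert (HD : 0 < D) by (unfold D; lra).
  assert (He : 0 < eps / (3 * D)) by (apply Rdiv_lt_0_compat; lra).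
  destruct (H1 _ He) as [d1 [Hd1 K1]].
  destruct (H2 _ He) as [d2 [Hd2 K2]].
  destruct (cder_ccont _ _ _ H2 _ He) as [d3 [Hd3 K3]].
  exists (Rmin (Rmin d0 d1) (Rmin d2 d3)); split; [repeat apply Rmin_pos; lra|].
  intros w Hw.
  pose proof (Rlt_le_trans _ _ _ Hw (Rmin_l _ _)) as Ha.
  pose proof (Rlt_le_trans _ _ _ Hw (Rmin_r _ _)) as Hb.
  specialize (K0 w (Rlt_le_trans _ _ _ Ha (Rmin_l _ _))).
  specialize (K1 w (Rlt_le_trans _ _ _ Ha (Rmin_r _ _))).
  specialize (K2 w (Rlt_le_trans _ _ _ Hb (Rmin_l _ _))).
  specialize (K3 w (Rlt_le_trans _ _ _ Hb (Rmin_r _ _))).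
  replace (f w * g w - f z * g z - (a * g z + f z * b) * (w - z))%C with
    ((f w - f z - a * (w - z)) * g w + f z * (g w - g z - b * (w - z))
     + a * (g w - g z) * (w - z))%C by ring.
  eapply Rle_trans; [apply Cmod_triangle|].
  eapply Rle_trans; [apply Rplus_le_compat_r, Cmod_triangle|].
  rewrite !Cmod_mult.
  pose proof (Cmod_ge_0 (w - z)%C) as Pw.
  set (e := eps / (3 * D)) in *.
  assert (Ee : e * D = eps / 3) by (unfold e; field; lra).
  assert (A1 : Cmod (f w - f z - a * (w - z))%C * Cmod (g w) <= eps / 3 * Cmod (w - z)%C).
  { apply Rle_trans with ((e * Cmod (w - z)%C) * D).
    - apply Rmult_le_compat; try apply Cmod_ge_0; auto. unfold D; lra.
    - rewrite <- Ee; lra. }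
  assert (A2 : Cmod (f z) * Cmod (g w - g z - b * (w - z))%C <= eps / 3 * Cmod (w - z)%C).
  { apply Rle_trans with (D * (e * Cmod (w - z)%C)).
    - apply Rmult_le_compat; try apply Cmod_ge_0; auto. unfold D; lra.
    - rewrite <- Ee; lra. }
  assert (A3 : Cmod a * Cmod (g w - g z)%C * Cmod (w - z)%C <= eps / 3 * Cmod (w - z)%C).
  { apply Rmult_le_compat_r; auto. rewrite <- Ee, Rmult_comm.
    apply Rmult_le_compat; try apply Cmod_ge_0; auto. lra. unfold D; lra. }
  lra.
Qed.

Lemma cder_comp (f g : C -> C) (z a b : C) :
  cder g z b -> cder f (g z) a -> cder (fun w => f (g w)) z (a * b)%C.
Proof.
  intros H2 H1 eps Heps.
  pose proof (Cmod_ge_0 a) as Pa. pose proof (Cmod_ge_0 b) as Pb.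
  assert (He1 : 0 < eps / (2 * (Cmod b + 1))) by (apply Rdiv_lt_0_compat; lra).
  destruct (H1 _ He1) as [d1 [Hd1 K1]].
  assert (He2 : 0 < Rmin 1 (eps / (2 * (Cmod a + 1)))).
  { apply Rmin_pos; [lra|]. apply Rdiv_lt_0_compat; lra. }
  destruct (H2 _ He2) as [d2 [Hd2 K2]].
  destruct (cder_ccont _ _ _ H2 _ Hd1) as [d3 [Hd3 K3]].
  exists (Rmin d2 d3); split; [apply Rmin_pos; lra|]. intros w Hw.
  specialize (K2 w (Rlt_le_trans _ _ _ Hw (Rmin_l _ _))).
  specialize (K1 (g w) (K3 w (Rlt_le_trans _ _ _ Hw (Rmin_r _ _)))).
  pose proof (Cmod_ge_0 (w - z)%C) as Pw.
  assert (Bg : Cmod (g w - g z)%C <= (Cmod b + 1) * Cmod (w - z)%C).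
  { replace (g w - g z)%C with ((g w - g z - b * (w - z)) + b * (w - z))%C by ring.
    eapply Rle_trans; [apply Cmod_triangle|]. rewrite Cmod_mult.
    pose proof (Rmin_l 1 (eps / (2 * (Cmod a + 1)))). nra. }
  replace (f (g w) - f (g z) - a * b * (w - z))%C with
    ((f (g w) - f (g z) - a * (g w - g z)) + a * (g w - g z - b * (w - z)))%C by ring.
  eapply Rle_trans; [apply Cmod_triangle|]. rewrite Cmod_mult.
  assert (A1 : Cmod (f (g w) - f (g z) - a * (g w - g z))%C <= eps / 2 * Cmod (w - z)%C).
  { eapply Rle_trans; [exact K1|].
    apply Rle_trans with (eps / (2 * (Cmod b + 1)) * ((Cmod b + 1) * Cmod (w - z)%C)).
    - apply Rmult_le_compat_l; lra.
    - right; field; lra. }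
  assert (A2 : Cmod a * Cmod (g w - g z - b * (w - z))%C <= eps / 2 * Cmod (w - z)%C).
  { apply Rle_trans with ((Cmod a + 1) * (eps / (2 * (Cmod a + 1)) * Cmod (w - z)%C)).
    - apply Rmult_le_compat; try apply Cmod_ge_0; try lra.
      eapply Rle_trans; [exact K2|]. apply Rmult_le_compat_r; auto. apply Rmin_r.
    - right; field; lra. }
  lra.
Qed.

Lemma cder_inv (z : C) : z <> 0 -> cder (fun w => / w)%C z (- / (z * z))%C.
Proof.
  intros Hz eps Heps.
  pose proof (proj1 (Cmod_gt_0 z) Hz) as Pz. set (m := Cmod z) in *.
  (* The remainder equals [(w - z)^2 / (w * z^2)], and the first bound gives [Cmod w > m / 2]; hence
     the factor [eps * m^3 / 2]. *)
  exists (Rmin (m / 2) (eps * m * m * m / 2)); split.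
  { apply Rmin_pos; [lra|]. repeat apply Rmult_lt_0_compat; lra. }
  intros w Hw.
  pose proof (Rlt_le_trans _ _ _ Hw (Rmin_l _ _)) as Ha.
  pose proof (Rlt_le_trans _ _ _ Hw (Rmin_r _ _)) as Hb.
  assert (Pw : m / 2 < Cmod w).
  { pose proof (Cmod_triangle_rev z w) as T. rewrite (Cmod_minus_sym z w) in T.
    fold m in T; lra. }
  assert (Hw0 : w <> 0).
  { intro E; rewrite E, Cmod_0 in Pw; lra. }
  replace (/ w - / z - - / (z * z) * (w - z))%C with
    ((w - z) * (w - z) / (w * z * z))%C by (field; auto).
  rewrite Cmod_div.
  2: { repeat apply Cmult_neq_0; auto. }
  rewrite !Cmod_mult. fold m.
  pose proof (Cmod_ge_0 (w - z)%C) as P.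
  apply Rmult_le_reg_r with (Cmod w * m * m).
  { repeat apply Rmult_lt_0_compat; lra. }
  unfold Rdiv; rewrite Rmult_assoc, Rinv_l, Rmult_1_r.
  2: { apply Rgt_not_eq. repeat apply Rmult_lt_0_compat; lra. }
  replace (eps * Cmod (w - z)%C * (Cmod w * m * m)) with (Cmod (w - z)%C * (eps * m * m * Cmod w)) by ring.
  apply Rmult_le_compat_l; auto.
  apply Rle_trans with (eps * m * m * m / 2); [lra|].
  replace (eps * m * m * m / 2) with (eps * m * m * (m / 2)) by field.
  apply Rmult_le_compat_l; [|lra]. repeat apply Rmult_le_pos; lra.
Qed.

Lemma cder_pow (f : C -> C) (z a : C) (n : nat) :
  cder f z a -> cder (fun w => f w ^ n)%C z (INR n * f z ^ (pred n) * a)%C.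
Proof.
  intros H. induction n as [|n IH].
  - replace (INR 0 * f z ^ pred 0 * a)%C with (RtoC 0) by (simpl; ring).
    exact (cder_const 1 z).
  - replace (INR (S n) * f z ^ pred (S n) * a)%C with
      (a * f z ^ n + f z * (INR n * f z ^ pred n * a))%C.
    2: { rewrite S_INR, RtoC_plus. destruct n; simpl; ring. }
    exact (cder_mult _ _ _ _ _ H IH).
Qed.

Lemma pder_const (c : C) (t : R) : pder (fun _ => c) t 0.
Proof. split; apply (is_derive_const (K := R_AbsRing) (V := R_NormedModule)). Qed.

Lemma pder_comp (f : C -> C) (g : R -> C) (t : R) (a b : C) :
  pder g t b -> cder f (g t) a -> pder (fun s => f (g s)) t (a * b)%C.
Proof.
  rewrite !pder_eps. intros H2 H1 eps Heps.
  pose proof (Cmod_ge_0 a) as Pa. pose proof (Cmod_ge_0 b) as Pb.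
  assert (He1 : 0 < eps / (2 * (Cmod b + 1))) by (apply Rdiv_lt_0_compat; lra).
  destruct (H1 _ He1) as [d1 [Hd1 K1]].
  assert (He2 : 0 < Rmin 1 (eps / (2 * (Cmod a + 1)))).
  { apply Rmin_pos; [lra|]. apply Rdiv_lt_0_compat; lra. }
  destruct (H2 _ He2) as [d2 [Hd2 K2]].
  exists (Rmin d2 (d1 / (Cmod b + 1))); split.
  { apply Rmin_pos; [lra|]. apply Rdiv_lt_0_compat; lra. }
  intros s Hs.
  specialize (K2 s (Rlt_le_trans _ _ _ Hs (Rmin_l _ _))).
  pose proof (Rlt_le_trans _ _ _ Hs (Rmin_r _ _)) as Hs2.
  pose proof (Rabs_pos (s - t)) as Pw.
  assert (Bg : Cmod (g s - g t)%C <= (Cmod b + 1) * Rabs (s - t)).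
  { replace (g s - g t)%C with ((g s - g t - (s - t)%R * b) + (s - t)%R * b)%C by ring.
    eapply Rle_trans; [apply Cmod_triangle|]. rewrite Cmod_mult, Cmod_R.
    pose proof (Rmin_l 1 (eps / (2 * (Cmod a + 1)))). nra. }
  apply (Rmult_lt_compat_r (Cmod b + 1)) in Hs2; [|lra].
  unfold Rdiv in Hs2; rewrite Rmult_assoc, Rinv_l, Rmult_1_r in Hs2 by lra.
  specialize (K1 (g s) ltac:(lra)).
  replace (f (g s) - f (g t) - (s - t)%R * (a * b))%C with
    ((f (g s) - f (g t) - a * (g s - g t)) + a * (g s - g t - (s - t)%R * b))%C by ring.
  eapply Rle_trans; [apply Cmod_triangle|]. rewrite Cmod_mult.
  assert (A1 : Cmod (f (g s) - f (g t) - a * (g s - g t))%C <= eps / 2 * Rabs (s - t)).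
  { eapply Rle_trans; [exact K1|].
    apply Rle_trans with (eps / (2 * (Cmod b + 1)) * ((Cmod b + 1) * Rabs (s - t))).
    - apply Rmult_le_compat_l; lra.
    - right; field; lra. }
  assert (A2 : Cmod a * Cmod (g s - g t - (s - t)%R * b)%C <= eps / 2 * Rabs (s - t)).
  { apply Rle_trans with ((Cmod a + 1) * (eps / (2 * (Cmod a + 1)) * Rabs (s - t))).
    - apply Rmult_le_compat; try apply Cmod_ge_0; try lra.
      eapply Rle_trans; [exact K2|]. apply Rmult_le_compat_r; auto. apply Rmin_r.
    - right; field; lra. }
  lra.
Qed.

Lemma pder_plus (f g : R -> C) (t : R) (a b : C) :
  pder f t a -> pder g t b -> pder (fun s => f s + g s)%C t (a + b)%C.
Proof.
  intros [F1 F2] [G1 G2]; split; simpl;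
    apply (is_derive_plus (K := R_AbsRing) (V := R_NormedModule)); assumption.
Qed.

Lemma pder_mult (f g : R -> C) (t : R) (a b : C) :
  pder f t a -> pder g t b -> pder (fun s => f s * g s)%C t (a * g t + f t * b)%C.
Proof.
  intros [F1 F2] [G1 G2].
  assert (M : forall u v u' v', is_derive u t u' -> is_derive v t v' ->
    is_derive (fun s => u s * v s) t (u' * v t + u t * v')).
  { intros u v u' v' U V. apply (is_derive_mult u v t u' v' U V). intros; apply Rmult_comm. }
  split.
  - apply is_derive_ext with (fun s => minus (Re (f s) * Re (g s)) (Im (f s) * Im (g s))).
    { intros s. rewrite re_mult. reflexivity. }
    replace (Re (a * g t + f t * b)%C) with
      (minus (Re a * Re (g t) + Re (f t) * Re b) (Im a * Im (g t) + Im (f t) * Im b)).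
    2: { rewrite re_plus, !re_mult. unfold minus, plus, opp; simpl. ring. }
    apply (is_derive_minus (K := R_AbsRing) (V := R_NormedModule)); apply M; assumption.
  - apply is_derive_ext with (fun s => plus (Re (f s) * Im (g s)) (Im (f s) * Re (g s))).
    { intros s. rewrite im_mult. reflexivity. }
    replace (Im (a * g t + f t * b)%C) with
      (plus (Re a * Im (g t) + Re (f t) * Im b) (Im a * Re (g t) + Im (f t) * Re b)).
    2: { rewrite im_plus, !im_mult. unfold plus; simpl. ring. }
    apply (is_derive_plus (K := R_AbsRing) (V := R_NormedModule)); apply M; assumption.
Qed.

Lemma pder_scal (c : C) (f : R -> C) (t : R) (a : C) :
  pder f t a -> pder (fun s => c * f s)%C t (c * a)%C.
Proof.
  intros H. eapply pder_eq; [exact (pder_mult _ _ _ _ _ (pder_const c t) H)|]. cbv beta; ring.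
Qed.

Lemma pder_minus (f g : R -> C) (t : R) (a b : C) :
  pder f t a -> pder g t b -> pder (fun s => f s - g s)%C t (a - b)%C.
Proof.
  intros [F1 F2] [G1 G2]; split; simpl;
    apply (is_derive_minus (K := R_AbsRing) (V := R_NormedModule)); assumption.
Qed.

Lemma cder_scal (c : C) (f : C -> C) (z a : C) :
  cder f z a -> cder (fun w => c * f w)%C z (c * a)%C.
Proof.
  intros H. eapply cder_eq; [exact (cder_mult _ _ _ _ _ (cder_const c z) H)|]. cbv beta; ring.
Qed.

Lemma cder_div (f g : C -> C) (z a b : C) :
  cder f z a -> cder g z b -> g z <> 0 ->
  cder (fun w => f w / g w)%C z ((a * g z - f z * b) / (g z * g z))%C.
Proof.
  intros F G N. eapply cder_eq.
  - apply cder_mult; [exact F|].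
    apply (cder_comp (fun w => / w)%C g); [exact G | apply cder_inv, N].
  - cbv beta; field. exact N.
Qed.

(** * Continuity of complex-valued maps *)

(** The source is an arbitrary uniform space so that the same rules serve curves, functions on the
    plane and integrands depending on a parameter and an angle. *)
Definition ct {X : UniformSpace} (f : X -> C) (x : X) : Prop :=
  continuous (fun y => Re (f y)) x /\ continuous (fun y => Im (f y)) x.

Section ct.
Context {X : UniformSpace}.

Lemma continuous_Rplus (f g : X -> R) (x : X) :
  continuous f x -> continuous g x -> continuous (fun y => f y + g y) x.
Proof. exact (continuous_plus (V := R_NormedModule) f g x). Qed.

Lemma continuous_Rminus (f g : X -> R) (x : X) :
  continuous f x -> continuous g x -> continuous (fun y => f y - g y) x.
Proof. exact (continuous_minus (V := R_NormedModule) f g x). Qed.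

Lemma continuous_Rmult (f g : X -> R) (x : X) :
  continuous f x -> continuous g x -> continuous (fun y => f y * g y) x.
Proof. exact (continuous_mult (K := R_AbsRing) f g x). Qed.

Lemma ct_const (c : C) (x : X) : ct (fun _ => c) x.
Proof. split; apply continuous_const. Qed.

Lemma ct_RtoC (f : X -> R) (x : X) : continuous f x -> ct (fun y => RtoC (f y)) x.
Proof. split; [exact H | apply continuous_const]. Qed.

Lemma ct_plus (f g : X -> C) (x : X) : ct f x -> ct g x -> ct (fun y => f y + g y)%C x.
Proof. intros [A B] [A' B']; split; apply continuous_Rplus; assumption. Qed.

Lemma ct_minus (f g : X -> C) (x : X) : ct f x -> ct g x -> ct (fun y => f y - g y)%C x.
Proof. intros [A B] [A' B']; split; apply continuous_Rminus; assumption. Qed.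

Lemma ct_mult (f g : X -> C) (x : X) : ct f x -> ct g x -> ct (fun y => f y * g y)%C x.
Proof.
  intros [A B] [A' B']; split.
  - apply continuous_Rminus; apply continuous_Rmult; assumption.
  - apply continuous_Rplus; apply continuous_Rmult; assumption.
Qed.

Lemma ct_comp (g : C -> C) (f : X -> C) (x : X) :
  ct f x -> ccont g (f x) -> ct (fun y => g (f y)) x.
Proof.
  intros [A B] H.
  assert (K : forall eps : posreal, locally x (fun y => Cmod (g (f y) - g (f x))%C < eps)).
  { intros eps. destruct (H eps (cond_pos eps)) as [d [Hd K]].
    assert (Hd2 : 0 < d / 2) by lra.
    specialize (A _ (locally_ball _ (mkposreal _ Hd2))).
    specialize (B _ (locally_ball _ (mkposreal _ Hd2))).
    unfold filtermap in A, B.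
    generalize (filter_and _ _ A B). apply filter_imp. intros y [Ha Hb].
    apply K. eapply Rle_lt_trans; [apply Cmod_le_sum|].
    change (Rabs (Re (f y) - Re (f x)) < d / 2) in Ha.
    change (Rabs (Im (f y) - Im (f x)) < d / 2) in Hb.
    rewrite re_minus, im_minus; lra. }
  split; apply filterlim_locally; intros eps; generalize (K eps); apply filter_imp;
    intros y Hy.
  - eapply Rle_lt_trans; [|exact Hy]. apply (re_le_Cmod (g (f y) - g (f x))%C).
  - eapply Rle_lt_trans; [|exact Hy]. apply (im_le_Cmod (g (f y) - g (f x))%C).
Qed.

Lemma ct_inv (f : X -> C) (x : X) : ct f x -> f x <> 0 -> ct (fun y => / f y)%C x.
Proof.
  intros A B. apply (ct_comp (fun w => / w)%C); [exact A|].
  eapply cder_ccont, cder_inv, B.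
Qed.

Lemma ct_div (f g : X -> C) (x : X) :
  ct f x -> ct g x -> g x <> 0 -> ct (fun y => f y / g y)%C x.
Proof. intros; apply ct_mult; [assumption|]. apply ct_inv; assumption. Qed.

Lemma ct_pow (f : X -> C) (x : X) (n : nat) : ct f x -> ct (fun y => f y ^ n)%C x.
Proof.
  intros A; induction n as [|n IH]; [apply ct_const|].
  exact (ct_mult _ _ _ A IH).
Qed.

End ct.

Lemma ct_comp_snd (f : R -> C) (p : R * R) : ct f (snd p) ->
  ct (X := prod_UniformSpace R_UniformSpace R_UniformSpace) (fun q => f (snd q)) p.
Proof.
  intros [A B]; split.
  - apply (continuous_comp (U := prod_UniformSpace R_UniformSpace R_UniformSpace)
      (fun q : R * R => snd q) (fun t => Re (f t)) p); [apply continuous_snd | exact A].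
  - apply (continuous_comp (U := prod_UniformSpace R_UniformSpace R_UniformSpace)
      (fun q : R * R => snd q) (fun t => Im (f t)) p); [apply continuous_snd | exact B].
Qed.

Lemma pder_ct (f : R -> C) (t : R) (v : C) : pder f t v -> ct f t.
Proof.
  intros [A B]; split.
  - apply (ex_derive_continuous (V := R_NormedModule) (fun s => Re (f s))). eexists; exact A.
  - apply (ex_derive_continuous (V := R_NormedModule) (fun s => Im (f s))). eexists; exact B.
Qed.

(** * The exponential and the unit circle *)

Definition Cexp (z : C) : C := (exp (Re z) * cos (Im z), exp (Re z) * sin (Im z)).

Lemma Cexp_add (a b : C) : Cexp (a + b)%C = (Cexp a * Cexp b)%C.
Proof.
  apply Ceq; rewrite ?re_mult, ?im_mult; unfold Cexp; cbn [Re Im fst snd];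
    rewrite re_plus, im_plus, exp_plus, ?cos_plus, ?sin_plus; ring.
Qed.

Lemma Cmod_Cexp (z : C) : Cmod (Cexp z) = exp (Re z).
Proof.
  pose proof (exp_pos (Re z)) as P.
  apply Rsqr_inj; [apply Cmod_ge_0|lra|]. unfold Rsqr. rewrite Cmod_sqr.
  unfold Cexp; simpl. pose proof (sin2_cos2 (Im z)) as H. unfold Rsqr in H.
  replace (exp (Re z) * cos (Im z) * (exp (Re z) * cos (Im z)) +
    exp (Re z) * sin (Im z) * (exp (Re z) * sin (Im z))) with
    (exp (Re z) * exp (Re z) * (sin (Im z) * sin (Im z) + cos (Im z) * cos (Im z))) by ring.
  rewrite H; ring.
Qed.

Lemma Cexp_0 : Cexp 0 = 1.
Proof. apply Ceq; unfold Cexp; simpl; rewrite exp_0, ?cos_0, ?sin_0; ring. Qed.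

Lemma Cexp_neq_0 (z : C) : Cexp z <> 0.
Proof. apply Cmod_gt_0. rewrite Cmod_Cexp. apply exp_pos. Qed.

(** Only the derivative at 0 needs estimates: the addition formula transports it to every other
    point. *)
Lemma cder_Cexp_0 : cder Cexp 0 1.
Proof.
  intros eps Heps.
  assert (He : 0 < Rmin 1 (eps / 16)) by (apply Rmin_pos; lra).
  assert (De : is_derive exp 0 1).
  { pose proof (is_derive_Reals exp 0 1) as [_ H]. apply H.
    pose proof (derivable_pt_lim_exp 0) as H0. rewrite exp_0 in H0. exact H0. }
  assert (Dc : is_derive cos 0 0).
  { pose proof (is_derive_Reals cos 0 0) as [_ H]. apply H.
    pose proof (derivable_pt_lim_cos 0) as H0. rewrite sin_0, Ropp_0 in H0. exact H0. }
  assert (Ds : is_derive sin 0 1).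
  { pose proof (is_derive_Reals sin 0 1) as [_ H]. apply H.
    pose proof (derivable_pt_lim_sin 0) as H0. rewrite cos_0 in H0. exact H0. }
  rewrite is_derive_eps in De, Dc, Ds.
  destruct (De _ He) as [d1 [Hd1 K1]].
  destruct (Dc _ He) as [d2 [Hd2 K2]].
  destruct (Ds _ He) as [d3 [Hd3 K3]].
  (* [1/4] keeps [exp x <= 2], and [eps / 16] bounds the quadratic term [(exp x - 1) * y] by
     [eps / 8] times [Cmod w]. *)
  exists (Rmin (Rmin d1 d2) (Rmin d3 (Rmin (1/4) (eps / 16)))).
  split; [repeat apply Rmin_pos; lra|].
  intros w Hw. replace (w - 0)%C with w in * by ring.
  pose proof (Rlt_le_trans _ _ _ Hw (Rmin_l _ _)) as Ha.
  pose proof (Rlt_le_trans _ _ _ Hw (Rmin_r _ _)) as Hb.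
  pose proof (Rlt_le_trans _ _ _ Hb (Rmin_r _ _)) as Hc.
  pose proof (Rlt_le_trans _ _ _ Ha (Rmin_l _ _)) as H1.
  pose proof (Rlt_le_trans _ _ _ Ha (Rmin_r _ _)) as H2.
  pose proof (Rlt_le_trans _ _ _ Hb (Rmin_l _ _)) as H3.
  pose proof (Rlt_le_trans _ _ _ Hc (Rmin_l _ _)) as H4.
  pose proof (Rlt_le_trans _ _ _ Hc (Rmin_r _ _)) as H5.
  clear Hw Ha Hb Hc.
  pose proof (re_le_Cmod w) as Pr. pose proof (im_le_Cmod w) as Pi.
  rewrite Cexp_0. unfold Cexp. set (m := Cmod w) in *.
  set (x := Re w) in *. set (y := Im w) in *.
  specialize (K1 x). specialize (K2 y). specialize (K3 y).
  rewrite !Rminus_0_r in K1, K2, K3. rewrite exp_0 in K1. rewrite cos_0 in K2. rewrite sin_0 in K3.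
  specialize (K1 ltac:(lra)). specialize (K2 ltac:(lra)). specialize (K3 ltac:(lra)).
  pose proof (Rmin_l 1 (eps / 16)) as M1. pose proof (Rmin_r 1 (eps / 16)) as M2.
  set (e := Rmin 1 (eps / 16)) in *.
  assert (L1 : Rabs (exp x - 1 - x) <= e * m).
  { replace (exp x - 1 - x) with (exp x - 1 - x * 1) by ring.
    eapply Rle_trans; [exact K1|]. apply Rmult_le_compat_l; lra. }
  assert (L2 : Rabs (cos y - 1) <= e * m).
  { replace (cos y - 1) with (cos y - 1 - y * 0) by ring.
    eapply Rle_trans; [exact K2|]. apply Rmult_le_compat_l; lra. }
  assert (L3 : Rabs (sin y - y) <= e * m).
  { replace (sin y - y) with (sin y - 0 - y * 1) by ring.
    eapply Rle_trans; [exact K3|]. apply Rmult_le_compat_l; lra. }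
  assert (Pm : 0 <= m) by apply Cmod_ge_0.
  assert (L4 : Rabs (exp x - 1) <= 2 * m).
  { replace (exp x - 1) with ((exp x - 1 - x) + x) by ring.
    eapply Rle_trans; [apply Rabs_triang|]. nra. }
  assert (L5 : 0 <= exp x <= 2).
  { pose proof (exp_pos x). apply Rabs_le_between in L4. split; lra. }
  eapply Rle_trans; [apply Cmod_le_sum|].
  rewrite !re_minus, !im_minus, re_mult, im_mult. simpl. fold x y.
  replace (exp x * cos y - 1 - (1 * x - 0 * y)) with ((exp x - 1 - x) + exp x * (cos y - 1)) by ring.
  replace (exp x * sin y - 0 - (1 * y + 0 * x)) with (exp x * (sin y - y) + (exp x - 1) * y) by ring.
  eapply Rle_trans; [apply Rplus_le_compat; apply Rabs_triang|].
  rewrite !Rabs_mult, (Rabs_pos_eq (exp x)) by lra.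
  pose proof (Rabs_pos (cos y - 1)); pose proof (Rabs_pos (sin y - y)).
  assert (exp x * Rabs (cos y - 1) <= 2 * (e * m)) by (apply Rmult_le_compat; lra).
  assert (exp x * Rabs (sin y - y) <= 2 * (e * m)) by (apply Rmult_le_compat; lra).
  assert (Rabs (exp x - 1) * Rabs y <= (2 * m) * m).
  { apply Rmult_le_compat; try apply Rabs_pos; lra. }
  assert (2 * m * m <= 2 * m * (eps / 16)) by (apply Rmult_le_compat_l; lra).
  assert (e * m <= eps / 16 * m) by (apply Rmult_le_compat_r; lra).
  lra.
Qed.

Lemma cder_Cexp (z : C) : cder Cexp z (Cexp z).
Proof.
  apply cder_ext_loc with (fun w => Cexp z * Cexp (w - z))%C 1; [lra| |].
  - intros w _. rewrite <- Cexp_add. f_equal. ring.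
  - apply cder_eq with (0 * Cexp (z - z) + Cexp z * (1 * (1 + 0)))%C; [|ring].
    apply (cder_mult (fun _ => Cexp z) (fun w => Cexp (w - z))%C); [apply cder_const|].
    apply (cder_comp Cexp (fun w => w - z)%C).
    + apply cder_plus; [apply cder_id | apply cder_const].
    + replace (z - z)%C with (RtoC 0) by ring. apply cder_Cexp_0.
Qed.

Definition circ (r th : R) : C := (r * cos th, r * sin th).

Lemma circ_Cexp (r th : R) : circ r th = (r * Cexp (0, th))%C.
Proof. apply Ceq; unfold circ, Cexp, Cmult; simpl; rewrite exp_0; ring. Qed.

Lemma Cmod_circ (r th : R) : 0 <= r -> Cmod (circ r th) = r.
Proof.
  intros. rewrite circ_Cexp, Cmod_mult, Cmod_Cexp, Cmod_R, Rabs_pos_eq by lra.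
  simpl. rewrite exp_0; ring.
Qed.

Lemma pder_circ (r th : R) : pder (circ r) th (Ci * circ r th)%C.
Proof.
  split; rewrite ?re_mult, ?im_mult; simpl.
  - replace (0 * (r * cos th) - 1 * (r * sin th)) with (r * - sin th) by ring.
    apply is_derive_scal. auto_derive; auto; ring.
  - replace (0 * (r * sin th) + 1 * (r * cos th)) with (r * cos th) by ring.
    apply is_derive_scal. auto_derive; auto; ring.
Qed.

Lemma circ_2PI (r : R) : circ r (2 * PI) = circ r 0.
Proof. unfold circ. rewrite cos_2PI, sin_2PI, cos_0, sin_0; reflexivity. Qed.

Lemma circ_0_neq (r th : R) : 0 < r -> circ r th <> 0.
Proof. intros H. apply Cmod_gt_0. rewrite Cmod_circ; lra. Qed.

Lemma ct_circ (r th : R) : ct (circ r) th.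
Proof. eapply pder_ct, pder_circ. Qed.

(** * Integrals over the circle *)

(** Integration is in the angle, not along the contour; this is why Cauchy's formula below has the
    kernel [circ / (circ - z)] and the constant [2 * PI] without [i]. *)
Definition CI (f : R -> C) : C :=
  (RInt (fun t => Re (f t)) 0 (2 * PI), RInt (fun t => Im (f t)) 0 (2 * PI)).

Lemma two_pi_pos : 0 < 2 * PI.
Proof. pose proof PI_RGT_0; lra. Qed.

Lemma ct_ex_RInt (f : R -> C) (a b : R) : (forall t, ct f t) ->
  ex_RInt (fun t => Re (f t)) a b /\ ex_RInt (fun t => Im (f t)) a b.
Proof.
  intros H; split; apply (ex_RInt_continuous (V := R_CompleteNormedModule));
    intros t _; apply H.
Qed.

Lemma CI_ext (f g : R -> C) : (forall t, f t = g t) -> CI f = CI g.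
Proof. intros H; unfold CI; f_equal; apply RInt_ext; intros; rewrite H; reflexivity. Qed.

Lemma CI_scal (c : C) (f : R -> C) : (forall t, ct f t) ->
  CI (fun t => c * f t)%C = (c * CI f)%C.
Proof.
  intros H. destruct (ct_ex_RInt f 0 (2 * PI) H) as [A B].
  assert (S : forall (k : R) g, ex_RInt g 0 (2 * PI) -> ex_RInt (fun t => k * g t) 0 (2 * PI)).
  { intros k g Hg. apply (ex_RInt_scal (V := R_NormedModule) g _ _ k Hg). }
  assert (E : forall (k : R) g, ex_RInt g 0 (2 * PI) ->
    RInt (fun t => k * g t) 0 (2 * PI) = k * RInt g 0 (2 * PI)).
  { intros k g Hg. apply (RInt_scal (V := R_CompleteNormedModule) g _ _ k Hg). }
  apply Ceq; rewrite ?re_mult, ?im_mult; unfold CI; simpl.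
  - rewrite <- !E by assumption.
    rewrite <- (RInt_minus (V := R_CompleteNormedModule)) by (apply S; assumption).
    apply RInt_ext; intros; reflexivity.
  - rewrite <- !E by assumption.
    rewrite <- (RInt_plus (V := R_CompleteNormedModule)) by (apply S; assumption).
    apply RInt_ext; intros; reflexivity.
Qed.

Lemma CI_minus (f g : R -> C) : (forall t, ct f t) -> (forall t, ct g t) ->
  CI (fun t => f t - g t)%C = (CI f - CI g)%C.
Proof.
  intros Hf Hg. destruct (ct_ex_RInt f 0 (2 * PI) Hf) as [A B].
  destruct (ct_ex_RInt g 0 (2 * PI) Hg) as [A' B'].
  apply Ceq; rewrite ?re_minus, ?im_minus; unfold CI; simpl;
    rewrite <- (RInt_minus (V := R_CompleteNormedModule)) by assumption;
    apply RInt_ext; intros; reflexivity.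
Qed.

Lemma CI_const (c : C) : CI (fun _ => c) = (RtoC (2 * PI) * c)%C.
Proof.
  apply Ceq; rewrite ?re_scal_l, ?im_scal_l; unfold CI; simpl;
    rewrite (RInt_const (V := R_CompleteNormedModule)); unfold scal; simpl;
    unfold mult; simpl; ring.
Qed.

(** Pairing with the conjugate of the integral [I] makes the bound real: [|I|^2] is the integral of
    [Re (Cconj I * f)], which is pointwise at most [|I| * M]. *)
Lemma CI_bound (f : R -> C) (M : R) : (forall t, ct f t) ->
  (forall t, Cmod (f t) <= M) -> Cmod (CI f) <= 2 * PI * M.
Proof.
  intros H HM. set (I := CI f).
  destruct (Ceq_dec I 0) as [E|N].
  { rewrite E, Cmod_0. pose proof (Cmod_ge_0 (f 0)); pose proof (HM 0); pose proof two_pi_pos; nra. }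
  apply Cmod_gt_0 in N.
  assert (A : Cmod I * Cmod I = RInt (fun t => Re (Cconj I * f t)%C) 0 (2 * PI)).
  { transitivity (Re (CI (fun t => Cconj I * f t)%C)); [|reflexivity].
    rewrite CI_scal by assumption. fold I. rewrite Cmod_sqr, re_mult, re_conj, im_conj; ring. }
  assert (B : RInt (fun t => Re (Cconj I * f t)%C) 0 (2 * PI)
              <= RInt (fun _ => Cmod I * M) 0 (2 * PI)).
  { apply RInt_le.
    - apply Rlt_le, two_pi_pos.
    - apply (ct_ex_RInt (fun t => Cconj I * f t)%C).
      intros t. apply ct_mult; [apply ct_const | apply H].
    - apply (ex_RInt_const (V := R_NormedModule)).
    - intros t _. eapply Rle_trans; [apply Rle_abs|].
      eapply Rle_trans; [apply re_le_Cmod|].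
      rewrite Cmod_mult, Cmod_conj. apply Rmult_le_compat_l; [lra|apply HM]. }
  rewrite <- A, (RInt_const (V := R_CompleteNormedModule)) in B.
  change (Cmod I * Cmod I <= (2 * PI - 0) * (Cmod I * M)) in B.
  apply Rmult_le_reg_l with (Cmod I); [exact N|].
  replace (Cmod I * (2 * PI * M)) with ((2 * PI - 0) * (Cmod I * M)) by ring. lra.
Qed.

Lemma CI_FTC (F f : R -> C) : (forall t, pder F t (f t)) -> (forall t, ct f t) ->
  CI f = (F (2 * PI)%R - F 0)%C.
Proof.
  intros D H.
  apply Ceq; apply is_RInt_unique.
  - apply (is_RInt_derive (V := R_CompleteNormedModule) (fun s => Re (F s))
      (fun s => Re (f s)) 0 (2 * PI)); intros t _; [apply D | apply H].
  - apply (is_RInt_derive (V := R_CompleteNormedModule) (fun s => Im (F s))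
      (fun s => Im (f s)) 0 (2 * PI)); intros t _; [apply D | apply H].
Qed.

Lemma pder_CI_param (F dF : R -> R -> C) (t del : R) : 0 < del ->
  (forall u th, Rabs (u - t) < del -> pder (fun s => F s th) u (dF u th)) ->
  (forall u th, Rabs (u - t) < del ->
     ct (X := prod_UniformSpace R_UniformSpace R_UniformSpace)
       (fun p => dF (fst p) (snd p)) (u, th)) ->
  (forall u th, Rabs (u - t) < del -> ct (F u) th) ->
  pder (fun s => CI (F s)) t (CI (dF t)).
Proof.
  intros Hdel D Cd Cf.
  assert (Near : forall P : R -> Prop, (forall u, Rabs (u - t) < del -> P u) -> locally t P).
  { intros P HP. exists (mkposreal del Hdel). intros u Hu. apply HP, Hu. }
  assert (G : forall (f df : R -> R -> R),
    (forall u th, Rabs (u - t) < del -> is_derive (fun s => f s th) u (df u th)) ->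
    (forall u th, Rabs (u - t) < del ->
       continuous (T := prod_UniformSpace R_UniformSpace R_UniformSpace) (U := R_UniformSpace)
       (fun p : R * R => df (fst p) (snd p)) (u, th)) ->
    (forall u (th : R), Rabs (u - t) < del -> continuous (f u) th) ->
    is_derive (fun s => RInt (f s) 0 (2 * PI)) t (RInt (df t) 0 (2 * PI))).
  { intros f df Df Ct Cu.
    replace (RInt (df t) 0 (2 * PI)) with
      (RInt (fun th => Derive (fun u => f u th) t) 0 (2 * PI)).
    2: { apply RInt_ext; intros th _. apply is_derive_unique, Df.
         rewrite Rminus_diag, Rabs_R0; exact Hdel. }
    apply (is_derive_RInt_param f 0 (2 * PI) t).
    - apply Near. intros u Hu th _. eexists; apply Df, Hu.
    - intros th _.
      apply continuity_2d_pt_ext_loc with df.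
      + exists (mkposreal del Hdel). intros u v Hu _. symmetry. exact (is_derive_unique (fun z => f z v) u _ (Df u v Hu)).
      + apply continuity_2d_pt_filterlim.
        apply (Ct t th). rewrite Rminus_diag, Rabs_R0; exact Hdel.
    - apply Near. intros u Hu.
      apply (ex_RInt_continuous (V := R_CompleteNormedModule)). intros th _. apply Cu, Hu. }
  split; simpl.
  - apply (G (fun u th => Re (F u th)) (fun u th => Re (dF u th))); intros u th Hu.
    + apply (D u th Hu). + apply (Cd u th Hu). + apply (Cf u th Hu).
  - apply (G (fun u th => Im (F u th)) (fun u th => Im (dF u th))); intros u th Hu.
    + apply (D u th Hu). + apply (Cd u th Hu). + apply (Cf u th Hu).
Qed.

Lemma pder_zero_const (F : R -> C) (a b : R) : a < b ->
  (forall t, a <= t <= b -> pder F t 0) -> F a = F b.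
Proof.
  intros Hab D. apply Ceq.
  - apply (eq_is_derive (V := R_NormedModule) (fun s => Re (F s)) a b); [|exact Hab].
    intros t Ht. apply (D t Ht).
  - apply (eq_is_derive (V := R_NormedModule) (fun s => Im (F s)) a b); [|exact Hab].
    intros t Ht. apply (D t Ht).
Qed.

(** * Cauchy's formula and regularity *)

(** Continuity of the derivative is part of the notion because Cauchy's formula is proved by
    differentiating under the integral sign; this bypasses Goursat's theorem. *)
Definition hol (f f' : C -> C) : Prop :=
  forall z, Cmod z < 1 -> cder f z (f' z) /\ ccont f' z.

Lemma circ_minus_neq (r : R) (z : C) (th : R) : Cmod z < r -> (circ r th - z)%C <> 0.
Proof.
  intros H. apply Cmod_gt_0. pose proof (Cmod_ge_0 z).
  pose proof (Cmod_triangle_rev (circ r th) z) as T. rewrite Cmod_circ in T; lra.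
Qed.

Lemma pder_RtoC (t : R) : pder (fun s => RtoC s) t 1.
Proof.
  split; simpl; [apply (is_derive_id (K := R_AbsRing))|].
  apply (is_derive_const (K := R_AbsRing) (V := R_NormedModule)).
Qed.

Lemma Rabs_near_unit (s t del : R) : 0 <= t <= 1 -> Rabs (s - t) < del -> Rabs s <= 1 + del.
Proof.
  intros Ht Hs. replace s with ((s - t) + t) by ring.
  eapply Rle_trans; [apply Rabs_triang|]. rewrite (Rabs_pos_eq t) by lra. lra.
Qed.

(** Replace [z] by [s * z]. The derivative in [s] of the integrand is the derivative in the angle of
    the periodic function [Ci * z / (circ - s * z)], so the integral does not depend on [s]; at
    [s = 0] the integrand is 1. *)
Lemma CI_cauchy_kernel (r : R) (z : C) : 0 < r < 1 -> Cmod z < r ->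
  CI (fun th => circ r th / (circ r th - z))%C = RtoC (2 * PI).
Proof.
  intros Hr Hz. pose proof (Cmod_ge_0 z) as Pz.
  set (F := fun (s th : R) => (circ r th / (circ r th - s * z))%C).
  set (dF := fun (s th : R) => (circ r th * z / ((circ r th - s * z) * (circ r th - s * z)))%C).
  (* Differentiation at the ends of [0, 1] needs a neighbourhood, so [s] may exceed 1 by [del] while
     [s * z] stays inside the circle. *)
  set (del := (r - Cmod z) / 2).
  assert (Hdel : 0 < del) by (unfold del; lra).
  assert (Small : forall s t : R, 0 <= t <= 1 -> Rabs (s - t) < del -> Cmod (s * z)%C < r).
  { intros s t Ht Hs. rewrite Cmod_mult, Cmod_R.
    pose proof (Rabs_near_unit s t del Ht Hs).
    apply Rle_lt_trans with ((1 + del) * Cmod z); [apply Rmult_le_compat_r; lra|].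
    unfold del in *; nra. }
  assert (E : CI (F 0) = CI (F 1)).
  { apply (pder_zero_const (fun s => CI (F s)) 0 1); [lra|]. intros t Ht.
    apply pder_eq with (CI (dF t)).
    - apply pder_CI_param with del; [exact Hdel| | |]; intros u th Hu;
        pose proof (circ_minus_neq r (u * z)%C th (Small u t Ht Hu)) as N.
      + unfold F, dF.
        eapply pder_eq.
        * apply pder_mult; [apply pder_const|].
          apply (pder_comp (fun w => / w)%C (fun s => circ r th - s * z)%C);
            [|apply cder_inv, N].
          apply pder_minus; [apply pder_const|].
          apply pder_mult; [apply pder_RtoC | apply pder_const].
        * cbv beta; field. exact N.
      + unfold dF.
        assert (A : ct (X := prod_UniformSpace R_UniformSpace R_UniformSpace)
          (fun p : R * R => circ r (snd p)) (u, th)) by (apply ct_comp_snd, ct_circ).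
        assert (B : ct (X := prod_UniformSpace R_UniformSpace R_UniformSpace)
          (fun p : R * R => circ r (snd p) - fst p * z)%C (u, th)).
        { apply ct_minus; [exact A|]. apply ct_mult; [|apply ct_const].
          apply ct_RtoC, continuous_fst. }
        apply ct_div.
        * apply ct_mult; [exact A | apply ct_const].
        * apply ct_mult; exact B.
        * simpl. apply Cmult_neq_0; exact N.
      + apply ct_div; [apply ct_circ | apply ct_minus; [apply ct_circ | apply ct_const] | exact N].
    - assert (N : forall th, (circ r th - t * z)%C <> 0).
      { intros th. apply circ_minus_neq, (Small t t Ht). rewrite Rminus_diag, Rabs_R0; exact Hdel. }
      rewrite (CI_FTC (fun th => Ci * z / (circ r th - t * z))%C).
      + rewrite circ_2PI. ring.
      + intros th. unfold dF. eapply pder_eq.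
        * apply pder_mult; [apply pder_const|].
          apply (pder_comp (fun w => / w)%C (fun s => circ r s - t * z)%C);
            [|apply cder_inv, N].
          apply pder_minus; [apply pder_circ | apply pder_const].
        * replace (circ r th * z / ((circ r th - t * z) * (circ r th - t * z)))%C with
            (- (Ci * Ci) * circ r th * z / ((circ r th - t * z) * (circ r th - t * z)))%C.
          { field. apply N. }
          replace (Ci * Ci)%C with (RtoC (-1)) by (apply Ceq; simpl; ring).
          field. apply N.
      + intros th. apply ct_div.
        * apply ct_mult; [apply ct_circ | apply ct_const].
        * apply ct_mult; (apply ct_minus; [apply ct_circ | apply ct_const]).
        * apply Cmult_neq_0; apply N. }
  transitivity (CI (F 1)).
  - apply CI_ext. intros th. unfold F. f_equal. f_equal. ring.
  - rewrite <- E. rewrite (CI_ext (F 0) (fun _ => RtoC 1)).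
    + rewrite CI_const. ring.
    + intros th. unfold F. field. replace (circ r th - 0 * z)%C with (circ r th) by ring.
      apply circ_0_neq; lra.
Qed.

(** The contour shrinks to [z] along segments. In the [s]-derivative the factor [circ - z] cancels
    the pole, and what remains is again an angular derivative of a periodic function. At [s = 0]
    only [f z] times the kernel is left. *)
Lemma cauchy_formula (f f' : C -> C) (r : R) (z : C) : hol f f' -> 0 < r < 1 -> Cmod z < r ->
  CI (fun th => f (circ r th) * (circ r th / (circ r th - z)))%C = (RtoC (2 * PI) * f z)%C.
Proof.
  intros Hf Hr Hz. pose proof (Cmod_ge_0 z) as Pz.
  set (P := fun s th : R => (z + s * (circ r th - z))%C).
  set (F := fun s th : R => (f (P s th) * (circ r th / (circ r th - z)))%C).
  set (dF := fun s th : R => (f' (P s th) * circ r th)%C).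
  set (del := (1 - r) / 4).
  assert (Hdel : 0 < del) by (unfold del; lra).
  assert (N : forall th, (circ r th - z)%C <> 0) by (intros; apply circ_minus_neq, Hz).
  assert (In : forall s t th : R, 0 <= t <= 1 -> Rabs (s - t) < del -> Cmod (P s th) < 1).
  { intros s t th Ht Hs. unfold P.
    replace (z + s * (circ r th - z))%C with
      (((1 - t)%R * z + t * circ r th) + (s - t)%R * (circ r th - z))%C.
    2: { rewrite !RtoC_minus. ring. }
    eapply Rle_lt_trans; [apply Cmod_triangle|].
    eapply Rle_lt_trans; [apply Rplus_le_compat_r, Cmod_triangle|].
    rewrite !Cmod_mult, !Cmod_R.
    pose proof (Cmod_triangle_minus (circ r th) z) as T. rewrite Cmod_circ in * by lra.
    rewrite (Rabs_pos_eq t), (Rabs_pos_eq (1 - t)) by lra.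
    assert (Rabs (s - t) * Cmod (circ r th - z)%C <= del * 2).
    { apply Rmult_le_compat; [apply Rabs_pos | apply Cmod_ge_0 | lra | lra]. }
    unfold del in *; nra. }
  assert (CP : forall u th, ct (X := prod_UniformSpace R_UniformSpace R_UniformSpace)
    (fun p : R * R => P (fst p) (snd p)) (u, th)).
  { intros u th. unfold P. apply ct_plus; [apply ct_const|]. apply ct_mult.
    - apply ct_RtoC, continuous_fst.
    - apply ct_minus; [apply ct_comp_snd, ct_circ | apply ct_const]. }
  assert (CP2 : forall u th, ct (P u) th).
  { intros u th. unfold P. apply ct_plus; [apply ct_const|]. apply ct_mult; [apply ct_const|].
    apply ct_minus; [apply ct_circ | apply ct_const]. }
  assert (PT : forall t th : R, pder (P t) th (t * (Ci * circ r th))%C).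
  { intros t th. unfold P. eapply pder_eq.
    - apply pder_plus; [apply pder_const|]. apply pder_mult; [apply pder_const|].
      apply pder_minus; [apply pder_circ | apply pder_const].
    - cbv beta; ring. }
  assert (E : CI (F 0) = CI (F 1)).
  { apply (pder_zero_const (fun s => CI (F s)) 0 1); [lra|]. intros t Ht.
    assert (In0 : forall th, Cmod (P t th) < 1).
    { intros th. apply (In t t th Ht). rewrite Rminus_diag, Rabs_R0; exact Hdel. }
    apply pder_eq with (CI (dF t)).
    - apply pder_CI_param with del; [exact Hdel| | |]; intros u th Hu;
        destruct (Hf _ (In u t th Ht Hu)) as [D Cn].
      + unfold F, dF. eapply pder_eq.
        * apply pder_mult; [|apply pder_const].
          apply (pder_comp f (fun s => P s th)); [|exact D].
          unfold P. apply pder_plus; [apply pder_const|].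
          apply pder_mult; [apply pder_RtoC | apply pder_const].
        * cbv beta; field. apply N.
      + unfold dF. apply ct_mult; [|apply ct_comp_snd, ct_circ].
        apply (ct_comp f'); [apply CP | exact Cn].
      + unfold F. apply ct_mult.
        * apply (ct_comp f); [apply CP2|]. eapply cder_ccont, D.
        * apply ct_div; [apply ct_circ | apply ct_minus; [apply ct_circ|apply ct_const] | apply N].
    - assert (Cd : forall th, ct (dF t) th).
      { intros th. unfold dF. apply ct_mult; [|apply ct_circ].
        apply (ct_comp f'); [apply CP2|]. apply Hf, In0. }
      (* For [t <> 0] the antiderivative is [- Ci / t * f (P t th)]; at [t = 0] the contour is a
         point and a separate antiderivative is required. *)
      destruct (Req_dec t 0) as [E0|N0].
      + rewrite (CI_FTC (fun th => f' z * (- Ci) * circ r th)%C).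
        * rewrite circ_2PI; ring.
        * intros th. eapply pder_eq.
          -- apply pder_mult; [apply pder_const | apply pder_circ].
          -- cbv beta; unfold dF, P. rewrite E0. replace (z + 0 * (circ r th - z))%C with z by ring.
             transitivity (- (Ci * Ci) * f' z * circ r th)%C; [ring|].
             replace (Ci * Ci)%C with (RtoC (-1)) by (apply Ceq; simpl; ring). ring.
        * exact Cd.
      + assert (N1 : RtoC t <> 0) by (intro K; apply N0, RtoC_inj, K).
        rewrite (CI_FTC (fun th => - Ci / t * f (P t th))%C).
        * unfold P. rewrite circ_2PI; ring.
        * intros th. eapply pder_eq.
          -- apply pder_mult; [apply pder_const|].
             apply (pder_comp f (P t)); [apply PT | apply Hf, In0].
          -- cbv beta; unfold dF. transitivity (- (Ci * Ci) * f' (P t th) * circ r th)%C; [field; exact N1|].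
             replace (Ci * Ci)%C with (RtoC (-1)) by (apply Ceq; simpl; ring). ring.
        * exact Cd. }
  transitivity (CI (F 1)).
  - apply CI_ext. intros th. unfold F, P. f_equal. f_equal. ring.
  - rewrite <- E. rewrite (CI_ext (F 0) (fun th => f z * (circ r th / (circ r th - z)))%C).
    + rewrite CI_scal.
      * rewrite CI_cauchy_kernel by assumption. ring.
      * intros th. apply ct_div;
          [apply ct_circ | apply ct_minus; [apply ct_circ|apply ct_const] | apply N].
    + intros th. unfold F, P. f_equal. f_equal. ring.
Qed.

(** Meant for [u = / (p - w)], [v = / (p - z)] and [d = w - z] with [p] on the circle, which satisfy
    [u - v = d * u * v]. The constant [A] depends only on [D] and [k], hence is uniform in [p]. *)
Lemma pow_taylor_bound (D : R) (k : nat) : 0 <= D -> exists A, 0 <= A /\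
  forall u v d : C, Cmod u <= D -> Cmod v <= D -> (u - v)%C = (d * u * v)%C ->
  Cmod (u ^ k - v ^ k - INR k * d * v ^ (S k))%C <= A * (Cmod d * Cmod d).
Proof.
  intros HD. induction k as [|k [A [HA IH]]].
  - exists 0; split; [lra|]. intros u v d _ _ _.
    replace (u ^ 0 - v ^ 0 - INR 0 * d * v ^ 1)%C with (RtoC 0) by (simpl; ring).
    rewrite Cmod_0; lra.
  - exists (D * A + (INR k + 1) * D ^ (k + 3)). split.
    { pose proof (pos_INR k). pose proof (pow_le D (k + 3) HD). nra. }
    intros u v d Hu Hv E.
    replace (u ^ S k - v ^ S k - INR (S k) * d * v ^ S (S k))%C with
      (u * (u ^ k - v ^ k - INR k * d * v ^ S k)
       + (INR k * d * v ^ S k * (u - v) + v ^ k * (u - v - d * (v * v))))%C.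
    2: { rewrite S_INR, RtoC_plus, !Cpow_S. ring. }
    replace (u - v - d * (v * v))%C with (d * v * (u - v))%C.
    2: { transitivity (d * u * v - d * (v * v))%C; [ring|]. rewrite <- E; ring. }
    rewrite E.
    assert (Pv : Cmod (v ^ k)%C <= D ^ k).
    { rewrite Cmod_pow. apply pow_incr; split; [apply Cmod_ge_0 | exact Hv]. }
    pose proof (Cmod_ge_0 d) as Pd. pose proof (Cmod_ge_0 u) as Pu.
    pose proof (Cmod_ge_0 v) as Pv0. pose proof (Cmod_ge_0 (v ^ k)%C) as Pvk.
    assert (Q : Cmod v * Cmod v * Cmod u * Cmod (v ^ k)%C <= D ^ (k + 3)).
    { rewrite pow_add. replace (D ^ 3) with (D * D * D) by ring.
      rewrite (Rmult_comm (D ^ k)).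
      repeat (apply Rmult_le_compat; repeat apply Rmult_le_pos; auto). }
    eapply Rle_trans; [apply Cmod_triangle|].
    eapply Rle_trans; [apply Rplus_le_compat_l, Cmod_triangle|].
    rewrite Cpow_S, !Cmod_mult, Cmod_R, Rabs_pos_eq by apply pos_INR.
    specialize (IH u v d Hu Hv E). rewrite Cpow_S in IH.
    pose proof (pos_INR k) as Pk.
    assert (B1 : Cmod u * Cmod (u ^ k - v ^ k - INR k * d * (v * v ^ k))%C
                 <= D * (A * (Cmod d * Cmod d))).
    { apply Rmult_le_compat; auto. apply Cmod_ge_0. }
    assert (Pdd : 0 <= Cmod d * Cmod d) by (apply Rmult_le_pos; auto).
    assert (B2 : INR k * (Cmod d * Cmod d) * (Cmod v * Cmod v * Cmod u * Cmod (v ^ k)%C)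
       <= INR k * (Cmod d * Cmod d) * D ^ (k + 3)).
    { apply Rmult_le_compat_l; auto. apply Rmult_le_pos; auto. }
    assert (B3 : (Cmod d * Cmod d) * (Cmod v * Cmod v * Cmod u * Cmod (v ^ k)%C)
       <= (Cmod d * Cmod d) * D ^ (k + 3)).
    { apply Rmult_le_compat_l; auto. }
    lra.
Qed.

(** For [c th = f (circ r th) * circ r th] and [k >= 1] this is [2 * PI / (k - 1)!] times the
    derivative of order [k - 1] of [f] at [z]. *)
Definition cauchy_kernel (c : R -> C) (r : R) (k : nat) (z : C) : C :=
  CI (fun th => c th * (/ (circ r th - z)) ^ k)%C.

Lemma ct_kernel (c : R -> C) (r : R) (k : nat) (z : C) (th : R) :
  ct c th -> Cmod z < r -> ct (fun t => c t * (/ (circ r t - z)) ^ k)%C th.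
Proof.
  intros Hc Hz. apply ct_mult; [exact Hc|]. apply ct_pow, ct_inv.
  - apply ct_minus; [apply ct_circ | apply ct_const].
  - apply circ_minus_neq, Hz.
Qed.

(** Near [z] all points keep a distance [d] from the circle, so the Taylor error of the kernel is
    quadratic in [w - z] uniformly in the angle and can be integrated. *)
Lemma cder_cauchy_kernel (c : R -> C) (r M : R) (k : nat) (z : C) :
  (forall th, ct c th) -> (forall th, Cmod (c th) <= M) -> Cmod z < r ->
  cder (cauchy_kernel c r k) z (INR k * cauchy_kernel c r (S k) z)%C.
Proof.
  intros Hc HM Hz eps Heps. pose proof (Cmod_ge_0 z) as Pz.
  assert (PM : 0 <= M) by (eapply Rle_trans; [apply Cmod_ge_0 | apply (HM 0)]).
  set (d := (r - Cmod z) / 2). assert (Hd : 0 < d) by (unfold d; lra).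
  assert (PD : 0 <= / d) by (apply Rlt_le, Rinv_0_lt_compat, Hd).
  destruct (pow_taylor_bound (/ d) k PD) as [A [HA T]].
  assert (PB : 0 <= 2 * PI * (M * A)).
  { pose proof two_pi_pos. apply Rmult_le_pos; [lra|]. apply Rmult_le_pos; lra. }
  exists (Rmin d (eps / (2 * PI * (M * A) + 1))). split.
  { apply Rmin_pos; [exact Hd|]. apply Rdiv_lt_0_compat; lra. }
  intros w Hw.
  pose proof (Rlt_le_trans _ _ _ Hw (Rmin_l _ _)) as H1.
  pose proof (Rlt_le_trans _ _ _ Hw (Rmin_r _ _)) as H2.
  assert (Bw : Cmod w <= r - d).
  { pose proof (Cmod_triangle_rev w z). unfold d in *; lra. }
  assert (Bz : Cmod z <= r - d) by (unfold d; lra).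
  assert (Inv : forall th y, Cmod y <= r - d -> Cmod (/ (circ r th - y))%C <= / d).
  { intros th y Hy. rewrite Cmod_inv by (apply circ_minus_neq; lra).
    apply Rinv_le_contravar; [exact Hd|].
    pose proof (Cmod_triangle_rev (circ r th) y) as Q. rewrite Cmod_circ in Q; lra. }
  replace (cauchy_kernel c r k w - cauchy_kernel c r k z
           - INR k * cauchy_kernel c r (S k) z * (w - z))%C with
    (CI (fun th => (c th * (/ (circ r th - w)) ^ k - c th * (/ (circ r th - z)) ^ k)
       - (INR k * (w - z)) * (c th * (/ (circ r th - z)) ^ S k))%C).
  2: { assert (Ck : forall j y th, Cmod y < r -> ct (fun t => c t * (/ (circ r t - y)) ^ j)%C th).
       { intros j y th Hy. apply ct_kernel; [apply Hc | exact Hy]. }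
       unfold cauchy_kernel.
       rewrite (CI_minus (fun th => c th * (/ (circ r th - w)) ^ k - c th * (/ (circ r th - z)) ^ k)%C
         (fun th => (INR k * (w - z)) * (c th * (/ (circ r th - z)) ^ S k))%C).
       - rewrite (CI_minus (fun th => c th * (/ (circ r th - w)) ^ k)%C
           (fun th => c th * (/ (circ r th - z)) ^ k)%C);
           [|intros th; apply Ck; lra|intros th; apply Ck; lra].
         rewrite (CI_scal (INR k * (w - z))%C (fun th => c th * (/ (circ r th - z)) ^ S k)%C);
           [ring|intros th; apply Ck; lra].
       - intros th. apply ct_minus; apply Ck; lra.
       - intros th. apply ct_mult; [apply ct_const|]. apply Ck; lra. }
  eapply Rle_trans.
  { apply CI_bound with (M := M * (A * (Cmod (w - z)%C * Cmod (w - z)%C))).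
    - intros th. apply ct_minus; [apply ct_minus; apply ct_kernel; auto; lra|].
      apply ct_mult; [apply ct_const|]. apply ct_kernel; [apply Hc | lra].
    - intros th.
      replace (c th * (/ (circ r th - w)) ^ k - c th * (/ (circ r th - z)) ^ k
        - INR k * (w - z) * (c th * (/ (circ r th - z)) ^ S k))%C with
        (c th * ((/ (circ r th - w)) ^ k - (/ (circ r th - z)) ^ k
        - INR k * (w - z) * (/ (circ r th - z)) ^ S k))%C by ring.
      rewrite Cmod_mult. apply Rmult_le_compat; try apply Cmod_ge_0; [apply HM|].
      apply T; [apply Inv, Bw | apply Inv, Bz|].
      field. split; apply circ_minus_neq; lra. }
  pose proof (Cmod_ge_0 (w - z)%C) as Pw. set (e := Cmod (w - z)%C) in *.
  replace (2 * PI * (M * (A * (e * e)))) with ((2 * PI * (M * A) * e) * e) by ring.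
  set (B := 2 * PI * (M * A)) in *.
  apply (Rmult_lt_compat_r (B + 1)) in H2; [|lra].
  unfold Rdiv in H2. rewrite Rmult_assoc, Rinv_l, Rmult_1_r in H2 by lra.
  apply Rmult_le_compat_r; [exact Pw|]. nra.
Qed.

Lemma polar (z : C) : exists t, 0 <= t <= 2 * PI /\ z = circ (Cmod z) t.
Proof.
  pose proof PI_RGT_0 as HPI.
  destruct (Ceq_dec z 0) as [->|N].
  { exists 0; split; [lra|]. rewrite Cmod_0. apply Ceq; simpl; ring. }
  apply Cmod_gt_0 in N. set (m := Cmod z) in *.
  assert (E : Re z * Re z + Im z * Im z = m * m) by (symmetry; apply Cmod_sqr).
  pose proof (re_le_Cmod z) as B. fold m in B. apply Rabs_le_between in B.
  set (c := Re z / m).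
  assert (Hc : -1 <= c <= 1).
  { unfold c; split; apply Rmult_le_reg_r with m; auto; unfold Rdiv;
      rewrite Rmult_assoc, Rinv_l; lra. }
  assert (Rc : Re z = m * c) by (unfold c; field; lra).
  assert (Sq : m * sqrt (1 - c²) = Rabs (Im z)).
  { rewrite <- (Rabs_pos_eq m) by lra. rewrite <- sqrt_Rsqr_abs, <- sqrt_mult_alt, <- sqrt_Rsqr_abs.
    2: apply Rle_0_sqr.
    f_equal. unfold Rsqr. rewrite Rc in E. lra. }
  pose proof (acos_bound c) as Ab.
  destruct (Rle_dec 0 (Im z)) as [Hi|Hi].
  - exists (acos c). split; [lra|]. unfold circ. rewrite cos_acos, sin_acos, Sq by exact Hc.
    apply Ceq; simpl; [exact Rc|]. rewrite Rabs_pos_eq; [reflexivity | exact Hi].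
  - exists (2 * PI - acos c). split; [lra|]. unfold circ.
    rewrite cos_minus, sin_minus, cos_2PI, sin_2PI, cos_acos, sin_acos by exact Hc.
    apply Ceq; simpl; [lra|].
    rewrite Rabs_left in Sq by lra. change (snd z) with (Im z). lra.
Qed.

Lemma hol_circ_bounded (f : C -> C) (r : R) : 0 < r < 1 ->
  (forall z, Cmod z < 1 -> ccont f z) ->
  (forall th, ct (fun t => f (circ r t)) th) /\
  exists M, forall th, Cmod (f (circ r th)) <= M.
Proof.
  intros Hr Hf.
  assert (Cn : forall th, ct (fun t => f (circ r t)) th).
  { intros th. apply (ct_comp f (circ r)); [apply ct_circ|].
    apply Hf. rewrite Cmod_circ; lra. }
  split; [exact Cn|].
  assert (B : forall g : R -> R, (forall t, continuous g t) ->
    exists M, forall t, 0 <= t <= 2 * PI -> Rabs (g t) <= M).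
  { intros g Hg.
    destruct (continuity_ab_maj (fun t => Rabs (g t)) 0 (2 * PI)) as [x [Hx _]].
    - apply Rlt_le, two_pi_pos.
    - intros t _. apply continuity_pt_filterlim. apply continuous_comp with (g := Rabs).
      + apply Hg.
      + apply continuous_Rabs.
    - exists (Rabs (g x)). exact Hx. }
  destruct (B (fun t => Re (f (circ r t)))) as [M1 H1]; [intros t; apply Cn|].
  destruct (B (fun t => Im (f (circ r t)))) as [M2 H2]; [intros t; apply Cn|].
  exists (M1 + M2). intros th.
  assert (P : exists t, 0 <= t <= 2 * PI /\ circ r th = circ r t).
  { destruct (polar (circ r th)) as [t [Ht E]]. exists t; split; [exact Ht|].
    rewrite Cmod_circ in E by lra. exact E. }
  destruct P as [t [Ht ->]].
  eapply Rle_trans; [apply Cmod_le_sum|]. apply Rplus_le_compat; auto.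
Qed.

Lemma two_pi_neq : RtoC (2 * PI) <> 0.
Proof. intro K. apply RtoC_inj in K. pose proof two_pi_pos; lra. Qed.

(** Cauchy's formula writes [f] as a kernel of order 1. By uniqueness of derivatives [f'] is the
    kernel of order 2, which can be differentiated again. *)
Lemma hol_kernel (f f' : C -> C) (r : R) (z : C) : hol f f' -> 0 < r < 1 -> Cmod z < r ->
  let K := cauchy_kernel (fun th => f (circ r th) * circ r th)%C r in
  f' z = (K 2%nat z / RtoC (2 * PI))%C /\ cder f' z (2 * K 3%nat z / RtoC (2 * PI))%C /\
  ccont (fun w => 2 * K 3%nat w / RtoC (2 * PI))%C z.
Proof.
  intros Hf Hr Hz K. pose proof two_pi_neq as N.
  destruct (hol_circ_bounded f r Hr) as [Hc [M HM]].
  { intros w Hw. eapply cder_ccont, Hf, Hw. }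
  assert (Cc : forall th, ct (fun t => f (circ r t) * circ r t)%C th).
  { intros th. apply ct_mult; [apply Hc | apply ct_circ]. }
  assert (Mc : forall th, Cmod (f (circ r th) * circ r th)%C <= M * r).
  { intros th. rewrite Cmod_mult, Cmod_circ by lra. apply Rmult_le_compat_r; [lra|apply HM]. }
  assert (D : forall k w, Cmod w < r -> cder (K k) w (INR k * K (S k) w)%C).
  { intros k w Hw. apply cder_cauchy_kernel with (M * r); assumption. }
  assert (E : forall w, Cmod w < r -> f w = (K 1%nat w * / RtoC (2 * PI))%C).
  { intros w Hw. unfold K, cauchy_kernel.
    rewrite (CI_ext _ (fun th => f (circ r th) * (circ r th / (circ r th - w)))%C).
    - rewrite (cauchy_formula f f' r w Hf Hr Hw). field. exact N.
    - intros th. simpl. field. apply circ_minus_neq, Hw. }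
  assert (Near : forall w v, Cmod w < r -> Cmod (v - w)%C < r - Cmod w -> Cmod v < r).
  { intros w v Hw Hv. pose proof (Cmod_triangle_rev v w); lra. }
  assert (E' : forall w, Cmod w < r -> f' w = (K 2%nat w * / RtoC (2 * PI))%C).
  { intros w Hw. apply (cder_unique f w).
    - apply Hf; lra.
    - apply cder_ext_loc with (fun v => / RtoC (2 * PI) * K 1%nat v)%C (r - Cmod w); [lra| |].
      + intros v Hv. rewrite E by (apply (Near w v); assumption). ring.
      + eapply cder_eq; [apply cder_scal, D, Hw|]. simpl INR. ring. }
  split; [apply E', Hz|]. split.
  - apply cder_ext_loc with (fun v => / RtoC (2 * PI) * K 2%nat v)%C (r - Cmod z); [lra| |].
    + intros v Hv. rewrite E' by (apply (Near z v); assumption). ring.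
    + eapply cder_eq; [apply cder_scal, D, Hz|].
      replace (RtoC (INR 2)) with (RtoC 2) by (f_equal; simpl; ring). field. exact N.
  - eapply cder_ccont.
    apply cder_ext_loc with (fun v => (2 / RtoC (2 * PI)) * K 3%nat v)%C 1; [lra| |].
    + intros v _. field. exact N.
    + apply cder_scal, D, Hz.
Qed.

(** To exhaust the disk the radius of the circle has to vary with the point. Kernels of different
    radii agree where both apply, each being the derivative of [f']. *)
Lemma hol_regular (f f' : C -> C) : hol f f' -> exists f'', hol f' f''.
Proof.
  intros Hf.
  set (rad := fun z => (1 + Cmod z) / 2).
  set (K := fun r z => (2 * cauchy_kernel (fun th => f (circ r th) * circ r th) r 3%nat z
                        / RtoC (2 * PI))%C).
  exists (fun z => K (rad z) z).
  assert (Hr : forall z, Cmod z < 1 -> 0 < rad z < 1 /\ Cmod z < rad z).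
  { intros z Hz. pose proof (Cmod_ge_0 z). unfold rad; lra. }
  intros z Hz. destruct (Hr z Hz) as [R1 R2].
  destruct (hol_kernel f f' (rad z) z Hf R1 R2) as [_ [D Cn]].
  split; [exact D|].
  intros eps Heps. destruct (Cn eps Heps) as [d [Hd H]].
  exists (Rmin d (rad z - Cmod z)); split; [apply Rmin_pos; lra|].
  intros w Hw.
  pose proof (Rlt_le_trans _ _ _ Hw (Rmin_l _ _)) as H1.
  pose proof (Rlt_le_trans _ _ _ Hw (Rmin_r _ _)) as H2.
  assert (Hw' : Cmod w < rad z) by (pose proof (Cmod_triangle_rev w z); lra).
  destruct (Hr w ltac:(lra)) as [R3 R4].
  replace (K (rad w) w) with (K (rad z) w); [apply H, H1|].
  apply (cder_unique f' w).
  - apply (hol_kernel f f' (rad z) w Hf R1 Hw').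
  - apply (hol_kernel f f' (rad w) w Hf R3 R4).
Qed.

Lemma ct_id (z : C) :
  ct (X := prod_UniformSpace R_UniformSpace R_UniformSpace) (fun w : C => w) z.
Proof. split; [apply continuous_fst | apply continuous_snd]. Qed.

Lemma ccont_iff_ct (f : C -> C) (z : C) :
  ccont f z <-> ct (X := prod_UniformSpace R_UniformSpace R_UniformSpace) f z.
Proof.
  split.
  - intros H. apply (ct_comp f (fun w : C => w) z); [apply ct_id | exact H].
  - intros [A B] eps Heps.
    assert (He : 0 < eps / 2) by lra.
    destruct (A _ (locally_ball _ (mkposreal _ He))) as [d1 H1].
    destruct (B _ (locally_ball _ (mkposreal _ He))) as [d2 H2].
    exists (Rmin d1 d2); split; [apply Rmin_pos; apply cond_pos|].
    intros w Hw.
    specialize (H1 w (C_NormedModule_mixin_compat1 z w d1 (Rlt_le_trans _ _ _ Hw (Rmin_l _ _)))).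
    specialize (H2 w (C_NormedModule_mixin_compat1 z w d2 (Rlt_le_trans _ _ _ Hw (Rmin_r _ _)))).
    change (Rabs (Re (f w) - Re (f z)) < eps / 2) in H1.
    change (Rabs (Im (f w) - Im (f z)) < eps / 2) in H2.
    eapply Rle_lt_trans; [apply Cmod_le_sum|]. rewrite re_minus, im_minus; lra.
Qed.

(* Landau's trick: Cauchy's formula for the powers of [f] loses a constant factor that
   disappears after taking n-th roots. *)
Lemma max_modulus_circle (f f' : C -> C) (r M : R) (z : C) : hol f f' -> 0 < r < 1 ->
  (forall th, Cmod (f (circ r th)) <= M) -> Cmod z < r -> Cmod (f z) <= M.
Proof.
  intros Hf Hr HM Hz. pose proof (Cmod_ge_0 z) as Pz.
  set (K := r / (r - Cmod z)).
  assert (HK : 0 < K) by (apply Rdiv_lt_0_compat; lra).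
  assert (PM : 0 <= M) by (eapply Rle_trans; [apply Cmod_ge_0 | apply (HM 0)]).
  assert (B : forall n, Cmod (f z) ^ n <= M ^ n * K).
  { intros n.
    assert (Hn : hol (fun w => f w ^ n)%C (fun w => INR n * f w ^ (pred n) * f' w)%C).
    { intros w Hw. destruct (Hf w Hw) as [D Cn]. split; [apply cder_pow, D|].
      apply ccont_iff_ct. apply ct_mult; [|apply ccont_iff_ct, Cn].
      apply ct_mult; [apply ct_const|]. apply ct_pow, ccont_iff_ct, (cder_ccont _ _ _ D). }
    pose proof (cauchy_formula _ _ r z Hn Hr Hz) as E.
    assert (F : Cmod (CI (fun th => f (circ r th) ^ n * (circ r th / (circ r th - z)))%C)
      <= 2 * PI * (M ^ n * K)).
    { apply CI_bound.
      - intros th. apply ct_mult.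
        + apply ct_pow, (ct_comp f (circ r)); [apply ct_circ|].
          eapply cder_ccont, Hf. rewrite Cmod_circ; lra.
        + apply ct_div; [apply ct_circ | apply ct_minus; [apply ct_circ | apply ct_const]
            | apply circ_minus_neq, Hz].
      - intros th. rewrite Cmod_mult, Cmod_pow.
        apply Rmult_le_compat; try apply Cmod_ge_0.
        + apply pow_le, Cmod_ge_0.
        + apply pow_incr; split; [apply Cmod_ge_0 | apply HM].
        + rewrite Cmod_div, Cmod_circ by (try apply circ_minus_neq; lra).
          unfold K, Rdiv. apply Rmult_le_compat_l; [lra|].
          apply Rinv_le_contravar; [lra|].
          pose proof (Cmod_triangle_rev (circ r th) z) as T. rewrite Cmod_circ in T; lra. }
    rewrite E, Cmod_mult, Cmod_R, Cmod_pow, Rabs_pos_eq in F by (pose proof two_pi_pos; lra).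
    apply Rmult_le_reg_l with (2 * PI); [apply two_pi_pos | exact F]. }
  destruct (Rle_dec (Cmod (f z)) M) as [|N]; [assumption|exfalso].
  apply Rnot_le_lt in N. set (m := Cmod (f z)) in *.
  destruct (Req_dec M 0) as [E0|N0].
  { specialize (B 1%nat). simpl in B. rewrite E0 in *. lra. }
  assert (HM0 : 0 < M) by lra.
  set (a := m / M - 1).
  assert (Ha : 0 < a).
  { unfold a. apply Rlt_Rminus. apply Rmult_lt_reg_r with M; [lra|].
    unfold Rdiv; rewrite Rmult_assoc, Rinv_l; lra. }
  assert (Ea : m = M * (1 + a)) by (unfold a; field; lra).
  (* By Bernoulli's inequality [(1 + a)^n] exceeds [K] for this [n]. *)
  destruct (INR_unbounded (K / a)) as [n Hn].
  specialize (B n). rewrite Ea, Rpow_mult_distr in B.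
  assert (PMn : 0 < M ^ n) by (apply pow_lt; lra).
  apply Rmult_le_reg_l in B; [|exact PMn].
  pose proof (poly n a Ha) as P.
  apply (Rmult_lt_compat_r a) in Hn; [|exact Ha].
  unfold Rdiv in Hn; rewrite Rmult_assoc, Rinv_l in Hn; lra.
Qed.

(** * Distortion of convex functions *)

Definition convex_order (alpha : R) (h h1 h2 : C -> C) : Prop :=
  hol h h1 /\ hol h1 h2 /\ h1 0%C = 1%C /\
  forall z, Cmod z < 1 -> h1 z <> 0%C /\ alpha < Re (1 + z * h2 z / h1 z)%C.

Lemma hol_div (f f' g g' : C -> C) : hol f f' -> hol g g' ->
  (forall z, Cmod z < 1 -> g z <> 0) ->
  hol (fun z => f z / g z)%C (fun z => (f' z * g z - f z * g' z) / (g z * g z))%C.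
Proof.
  intros Hf Hg N z Hz. destruct (Hf z Hz) as [Df Cf], (Hg z Hz) as [Dg Cg].
  split; [apply cder_div; auto|].
  pose proof (cder_ccont _ _ _ Df) as F. pose proof (cder_ccont _ _ _ Dg) as G.
  rewrite ccont_iff_ct in *.
  apply ct_div.
  - apply ct_minus; apply ct_mult; [exact Cf | exact G | exact F | exact Cg].
  - apply ct_mult; exact G.
  - apply Cmult_neq_0; apply N, Hz.
Qed.

Lemma hol_affine_mul (a : C) (f f' : C -> C) : hol f f' ->
  hol (fun z => a + z * f z)%C (fun z => f z + z * f' z)%C.
Proof.
  intros Hf z Hz. destruct (Hf z Hz) as [Df Cf]. split.
  - eapply cder_eq.
    + apply cder_plus; [apply cder_const|]. apply cder_mult; [apply cder_id | exact Df].
    + cbv beta; ring.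
  - pose proof (cder_ccont _ _ _ Df) as F. rewrite ccont_iff_ct in *.
    apply ct_plus; [exact F|]. apply ct_mult; [apply ct_id | exact Cf].
Qed.

Lemma pre_schwarzian_hol (alpha : R) (h h1 h2 : C -> C) : convex_order alpha h h1 h2 ->
  exists q', hol (fun z => h2 z / h1 z)%C q'.
Proof.
  intros [H [H1 [_ N]]]. destruct (hol_regular h1 h2 H1) as [h3 H2].
  eexists. apply (hol_div h2 h3 h1 h2); auto. intros z Hz; apply N, Hz.
Qed.

(* Schwarz's lemma for [b = (p - 1) / (p + 1 - 2 alpha)], [p = 1 + z h2/h1], which maps the
   disk into itself and fixes 0; [b(z)/z] is holomorphic by its explicit form. *)
Lemma pre_schwarzian_bound (alpha : R) (h h1 h2 : C -> C) (z : C) : alpha < 1 ->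
  convex_order alpha h h1 h2 -> Cmod z < 1 ->
  let q := fun w => (h2 w / h1 w)%C in
  Cmod (q z) <= Cmod (RtoC (2 * (1 - alpha)) + z * q z)%C.
Proof.
  intros Ha HC Hz q. destruct (pre_schwarzian_hol _ _ _ _ HC) as [q' Hq].
  destruct HC as [_ [_ [_ HN]]].
  set (c := 1 - alpha). assert (Hc : 0 < c) by (unfold c; lra).
  set (den := fun w => (RtoC (2 * c) + w * q w)%C).
  assert (Re_wq : forall w, Cmod w < 1 -> - c < Re (w * q w)%C).
  { intros w Hw. destruct (HN w Hw) as [_ K]. rewrite re_plus in K.
    change (Re (RtoC 1)) with 1 in K.
    replace (w * q w)%C with (w * h2 w / h1 w)%C by (unfold q, Cdiv; ring).
    unfold c. lra. }
  assert (Nd : forall w, Cmod w < 1 -> den w <> 0).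
  { intros w Hw E. pose proof (Re_wq w Hw) as K.
    assert (F : Re (den w) = 0) by (rewrite E; reflexivity).
    unfold den in F. rewrite re_plus in F.
    change (Re (RtoC (2 * c))) with (2 * c) in F. lra. }
  set (B := fun w => (q w / den w)%C).
  assert (HB : hol B (fun w => (q' w * den w - q w * (q w + w * q' w)) / (den w * den w))%C).
  { apply hol_div; [exact Hq | apply hol_affine_mul, Hq | exact Nd]. }
  assert (Bd : Cmod (B z) <= 1).
  { destruct (Rle_dec (Cmod (B z)) 1) as [|N]; [assumption|exfalso].
    apply Rnot_le_lt in N. set (m := Cmod (B z)) in *.
    assert (Im1 : / m < 1) by (rewrite <- Rinv_1; apply Rinv_lt_contravar; lra).
    assert (Ip : 0 < / m) by (apply Rinv_0_lt_compat; lra).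
    (* Any radius above both [Cmod z] and [/ m] would do: [B] is at most [/ r < m] on that circle,
       hence also at [z]. *)
    set (r := (1 + Rmax (Cmod z) (/ m)) / 2).
    pose proof (Rmax_l (Cmod z) (/ m)). pose proof (Rmax_r (Cmod z) (/ m)).
    assert (Mx : Rmax (Cmod z) (/ m) < 1) by (apply Rmax_lub_lt; lra).
    assert (Hr : 0 < r < 1) by (unfold r; lra).
    assert (K : Cmod (B z) <= / r).
    { apply (max_modulus_circle B _ r (/ r) z HB Hr); [|unfold r; lra].
      intros th. set (w := circ r th).
      assert (Ew : Cmod w = r) by (apply Cmod_circ; lra).
      assert (Hw : Cmod w < 1) by lra.
      pose proof (proj1 (Cmod_gt_0 _) (Nd w Hw)) as Pd.
      unfold B. rewrite Cmod_div by (apply Nd, Hw).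
      apply Rmult_le_reg_r with (r * Cmod (den w)).
      { apply Rmult_lt_0_compat; lra. }
      replace (Cmod (q w) / Cmod (den w) * (r * Cmod (den w))) with (r * Cmod (q w)) by (field; lra).
      replace (/ r * (r * Cmod (den w))) with (Cmod (den w)) by (field; lra).
      rewrite <- Ew, <- Cmod_mult.
      (* [|2 c + w q|^2 - |w q|^2 = 4 c (c + Re (w q))], which is positive by [Re_wq]. *)
      apply Rsqr_incr_0_var; [|apply Cmod_ge_0]. unfold Rsqr. rewrite !Cmod_sqr.
      unfold den. rewrite re_plus, im_plus.
      change (Re (RtoC (2 * c))) with (2 * c). change (Im (RtoC (2 * c))) with 0.
      pose proof (Re_wq w Hw). nra. }
    fold m in K. assert (/ m < r) by (unfold r; lra).
    assert (m * r <= 1).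
    { apply (Rmult_le_compat_r r) in K; [|lra]. rewrite Rinv_l in K; lra. }
    assert (1 < m * r).
    { replace 1 with (m * / m) by (field; lra). apply Rmult_lt_compat_l; lra. }
    lra. }
  unfold B in Bd. rewrite Cmod_div in Bd by (apply Nd, Hz).
  pose proof (proj1 (Cmod_gt_0 _) (Nd z Hz)) as Pd.
  apply (Rmult_le_compat_r (Cmod (den z))) in Bd; [|lra].
  unfold Rdiv in Bd. rewrite Rmult_assoc, Rinv_l in Bd by lra.
  unfold den in Bd. lra.
Qed.

(** Squaring [|Q| <= |2 c + t Q|] and discarding the term in [Im Q] leaves a quadratic inequality in
    [x = Re Q] that factors; its roots are the two bounds. *)
Lemma radial_log_derivative (alpha : R) (h h1 h2 : C -> C) (u : C) (t : R) : alpha < 1 ->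
  convex_order alpha h h1 h2 -> Cmod u = 1 -> 0 <= t < 1 ->
  let x := Re (u * (h2 (t * u) / h1 (t * u)))%C in
  - (2 * (1 - alpha) / (1 + t)) <= x <= 2 * (1 - alpha) / (1 - t).
Proof.
  intros Ha HC Hu Ht x.
  assert (Hz : Cmod (t * u)%C < 1).
  { rewrite Cmod_mult, Cmod_R, Hu, Rabs_pos_eq; lra. }
  pose proof (pre_schwarzian_bound alpha h h1 h2 (t * u)%C Ha HC Hz) as K. cbv beta zeta in K.
  set (Q := (u * (h2 (t * u) / h1 (t * u)))%C) in *.
  set (c := 1 - alpha) in *.
  assert (E : Cmod (h2 (t * u) / h1 (t * u))%C = Cmod Q).
  { unfold Q. rewrite Cmod_mult, Hu; ring. }
  rewrite E in K.
  replace (t * u * (h2 (t * u) / h1 (t * u)))%C with (t * Q)%C in K by (unfold Q; ring).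
  apply Rsqr_incr_1 in K; try apply Cmod_ge_0. unfold Rsqr in K. rewrite !Cmod_sqr in K.
  rewrite re_plus, im_plus, re_scal_l, im_scal_l in K.
  change (Re (RtoC (2 * c))) with (2 * c) in K. change (Im (RtoC (2 * c))) with 0 in K.
  fold x in K.
  assert (Hc : 0 < c) by (unfold c; lra).
  assert (P : ((1 - t) * x - 2 * c) * ((1 + t) * x + 2 * c) <= 0).
  { assert (0 <= (1 - t * t) * (Im Q * Im Q)) by (apply Rmult_le_pos; nra). nra. }
  split.
  - apply Rmult_le_reg_r with (1 + t); [lra|].
    replace (- (2 * c / (1 + t)) * (1 + t)) with (- (2 * c)) by (field; lra).
    destruct (Rle_dec (- (2 * c)) (x * (1 + t))) as [|N]; [assumption|exfalso].
    apply Rnot_le_lt in N.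
    assert (x < 0).
    { apply Rnot_le_lt. intros G. assert (0 <= x * (1 + t)) by (apply Rmult_le_pos; lra). lra. }
    assert (0 < (1 - t) * - x) by (apply Rmult_lt_0_compat; lra).
    assert (0 < (2 * c - (1 - t) * x) * - ((1 + t) * x + 2 * c)) by (apply Rmult_lt_0_compat; lra).
    lra.
  - apply Rmult_le_reg_r with (1 - t); [lra|].
    replace (2 * c / (1 - t) * (1 - t)) with (2 * c) by (field; lra).
    destruct (Rle_dec (x * (1 - t)) (2 * c)) as [|N]; [assumption|exfalso].
    apply Rnot_le_lt in N.
    assert (0 < x).
    { apply Rnot_le_lt. intros G. assert (0 <= - x * (1 - t)) by (apply Rmult_le_pos; lra). lra. }
    assert (0 < (1 + t) * x) by (apply Rmult_lt_0_compat; lra).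
    assert (0 < ((1 - t) * x - 2 * c) * ((1 + t) * x + 2 * c)) by (apply Rmult_lt_0_compat; lra).
    lra.
Qed.

Lemma pder_ray (f : C -> C) (u : C) (t : R) (l : C) : cder f (t * u)%C l ->
  pder (fun s => f (s * u)%C) t (l * u)%C.
Proof.
  intros H. apply (pder_comp f (fun s => s * u)%C); [|exact H].
  eapply pder_eq; [apply pder_mult; [apply pder_RtoC | apply pder_const]|]. cbv beta; ring.
Qed.

Lemma is_derive_log_Cmod_sqr (f : R -> C) (t : R) (l : C) : pder f t l -> f t <> 0 ->
  is_derive (fun s => ln (Cmod (f s) ^ 2)) t (2 * Re (l / f t)%C).
Proof.
  intros [A B] N.
  assert (P : 0 < Cmod (f t) ^ 2) by (apply pow_lt, Cmod_gt_0, N).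
  assert (D : is_derive (fun s => Cmod (f s) ^ 2) t
    (2 * (Re l * Re (f t) + Im l * Im (f t)))).
  { apply is_derive_ext with (fun s => Re (f s) * Re (f s) + Im (f s) * Im (f s)).
    { assert (Q : forall s, Re (f s) * Re (f s) + Im (f s) * Im (f s) = Cmod (f s) ^ 2)
        by (intros s; rewrite Cmod2_alt; ring).
      exact Q. }
    set (a := fun s => Re (f s)) in *. set (b := fun s => Im (f s)) in *.
    change (is_derive (fun s => a s * a s + b s * b s) t (2 * (Re l * a t + Im l * b t))).
    apply is_derive_unique in A as A'. apply is_derive_unique in B as B'.
    auto_derive.
    - repeat split; eexists; eassumption.
    - replace (Derive (fun x => a x) t) with (Re l) by (symmetry; exact A').
      replace (Derive (fun x => b x) t) with (Im l) by (symmetry; exact B'). ring. }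
  replace (2 * Re (l / f t)%C) with
    (2 * (Re l * Re (f t) + Im l * Im (f t)) * / (Cmod (f t) ^ 2)).
  - apply (is_derive_comp ln (fun s => Cmod (f s) ^ 2) t); [|exact D].
    apply is_derive_Reals. apply derivable_pt_lim_ln, P.
  - rewrite Cmod2_alt. rewrite Cmod2_alt in P.
    destruct l as [l1 l2], (f t) as [a b]; simpl in *. field. nra.
Qed.

(** Along the ray [L + 4 c ln (1 + t)] is nondecreasing and [L + 4 c ln (1 - t)] nonincreasing, and
    both vanish at 0. The [4] is the [2] of the radial bound doubled by the square of the
    modulus. *)
Lemma growth (alpha : R) (h h1 h2 : C -> C) (z : C) : 0 <= alpha < 1 ->
  convex_order alpha h h1 h2 -> Cmod z < 1 ->
  / Rpower (1 + Cmod z) (4 * (1 - alpha)) <= Cmod (h1 z) ^ 2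
    <= / Rpower (1 - Cmod z) (4 * (1 - alpha)).
Proof.
  intros Ha HC Hz. pose proof (Cmod_ge_0 z) as Pz. set (r := Cmod z) in *.
  destruct (polar z) as [th [_ Ez]]. fold r in Ez.
  rewrite circ_Cexp in Ez. set (u := Cexp (0, th)) in *.
  assert (Hu : Cmod u = 1) by (unfold u; rewrite Cmod_Cexp; simpl; apply exp_0).
  set (L := fun s : R => ln (Cmod (h1 (s * u)%C) ^ 2)).
  set (x := fun t : R => Re (u * (h2 (t * u) / h1 (t * u)))%C).
  assert (Ha1 : alpha < 1) by lra.
  pose proof (fun t Ht => radial_log_derivative alpha h h1 h2 u t Ha1 HC Hu Ht) as X.
  assert (In : forall t, 0 <= t < 1 -> Cmod (t * u)%C < 1).
  { intros t Ht. rewrite Cmod_mult, Cmod_R, Hu, Rabs_pos_eq; lra. }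
  destruct HC as [_ [H1 [H10 HN]]].
  assert (DL : forall t, 0 <= t < 1 -> is_derive L t (2 * x t)).
  { intros t Ht. unfold L, x.
    replace (u * (h2 (t * u) / h1 (t * u)))%C with (h2 (t * u) * u / h1 (t * u))%C
      by (unfold Cdiv; ring).
    apply (is_derive_log_Cmod_sqr (fun s => h1 (s * u)%C)).
    - apply pder_ray, H1, In, Ht.
    - apply HN, In, Ht. }
  assert (L0 : L 0 = 0).
  { unfold L. replace (0 * u)%C with (RtoC 0) by ring. rewrite H10, Cmod_1. simpl.
    rewrite !Rmult_1_r. apply ln_1. }
  assert (PL : 0 < Cmod (h1 z) ^ 2) by (apply pow_lt, Cmod_gt_0, HN, Hz).
  assert (ELr : Cmod (h1 z) ^ 2 = exp (L r)).
  { unfold L. rewrite <- Ez, exp_ln; auto. }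
  rewrite ELr. unfold Rpower. rewrite <- !exp_Ropp.
  set (c := 1 - alpha) in *.
  destruct (Req_dec r 0) as [R0|R0].
  { rewrite R0, L0, Rplus_0_r, Rminus_0_r, ln_1, Rmult_0_r, Ropp_0. lra. }
  assert (exp_le : forall a b, a <= b -> exp a <= exp b).
  { intros a b [Hab| ->]; [left; apply exp_increasing, Hab | right; reflexivity]. }
  split; apply exp_le.
  - destruct (MVT_gen (fun t => L t + 4 * c * ln (1 + t)) 0 r
      (fun t => 2 * x t + 4 * c / (1 + t))) as [t [Ht E]].
    + intros t Ht. rewrite Rmin_left, Rmax_right in Ht by lra.
      apply (is_derive_plus (K := R_AbsRing) (V := R_NormedModule)); [apply DL; lra|].
      auto_derive; [lra|field; lra].
    + intros t Ht. rewrite Rmin_left, Rmax_right in Ht by lra.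
      apply continuity_pt_filterlim.
      apply (ex_derive_continuous (V := R_NormedModule) (fun t => L t + 4 * c * ln (1 + t))).
      eexists. apply (is_derive_plus (K := R_AbsRing) (V := R_NormedModule)); [apply DL; lra|].
      apply Derive_correct. auto_derive; lra.
    + rewrite Rmin_left, Rmax_right in Ht by lra.
      rewrite L0, Rplus_0_r, ln_1 in E.
      destruct (X t) as [X1 _]; [lra|]. fold (x t) in X1.
      assert (0 <= 2 * x t + 4 * c / (1 + t)).
      { replace (4 * c / (1 + t)) with (2 * (2 * c / (1 + t))) by (field; lra). lra. }
      assert (0 <= (2 * x t + 4 * c / (1 + t)) * (r - 0)) by (apply Rmult_le_pos; lra).
      lra.
  - destruct (MVT_gen (fun t => L t + 4 * c * ln (1 - t)) 0 r
      (fun t => 2 * x t - 4 * c / (1 - t))) as [t [Ht E]].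
    + intros t Ht. rewrite Rmin_left, Rmax_right in Ht by lra.
      apply (is_derive_plus (K := R_AbsRing) (V := R_NormedModule)); [apply DL; lra|].
      auto_derive; [lra|field; lra].
    + intros t Ht. rewrite Rmin_left, Rmax_right in Ht by lra.
      apply continuity_pt_filterlim.
      apply (ex_derive_continuous (V := R_NormedModule) (fun t => L t + 4 * c * ln (1 - t))).
      eexists. apply (is_derive_plus (K := R_AbsRing) (V := R_NormedModule)); [apply DL; lra|].
      apply Derive_correct. auto_derive; lra.
    + rewrite Rmin_left, Rmax_right in Ht by lra.
      rewrite L0, Rminus_0_r, ln_1 in E.
      destruct (X t) as [_ X1]; [lra|]. fold (x t) in X1.
      assert (2 * x t - 4 * c / (1 - t) <= 0).
      { replace (4 * c / (1 - t)) with (2 * (2 * c / (1 - t))) by (field; lra). lra. }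
      assert ((2 * x t - 4 * c / (1 - t)) * (r - 0) <= 0) by nra.
      lra.
Qed.

(** * Bisection of rectangles *)

Section cousin.
Context (P : R -> R -> R -> R -> Prop).
Context (merge_h : forall a m b c d, a <= m <= b -> c <= d -> P a m c d -> P m b c d -> P a b c d).
Context (merge_v : forall a b c m d, a <= b -> c <= m <= d -> P a b c m -> P a b m d -> P a b c d).
Context (a0 c0 W H : R) (HW : 0 <= W) (HH : 0 <= H).

Let box (n : nat) (p : R * R) : Prop :=
  P (fst p) (fst p + W / 2 ^ n) (snd p) (snd p + H / 2 ^ n).

Let corner (n : nat) (p : R * R) (i j : bool) : R * R :=
  (fst p + (if i then W / 2 ^ S n else 0), snd p + (if j then H / 2 ^ S n else 0)).

(** A quarter on which [P] fails. The last quarter is the default: when the other three satisfy [P],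
    merging shows that it cannot. *)
Let pick (n : nat) (p : R * R) : R * R :=
  if excluded_middle_informative (box (S n) (corner n p false false)) then
  if excluded_middle_informative (box (S n) (corner n p true false)) then
  if excluded_middle_informative (box (S n) (corner n p false true)) then
    corner n p true true
  else corner n p false true else corner n p true false else corner n p false false.

Let half (X : R) (n : nat) : X / 2 ^ n = X / 2 ^ S n + X / 2 ^ S n.
Proof. pose proof (pow_lt 2 n ltac:(lra)). simpl. field. lra. Qed.

Let halfpos (X : R) (n : nat) : 0 <= X -> 0 <= X / 2 ^ n.
Proof.
  intros HX. apply Rmult_le_pos; [exact HX|].
  apply Rlt_le, Rinv_0_lt_compat, pow_lt; lra.
Qed.

Let pick_bad (n : nat) (p : R * R) : ~ box n p -> ~ box (S n) (pick n p).
Proof.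
  intros HB. unfold pick.
  destruct excluded_middle_informative as [B1|]; [|assumption].
  destruct excluded_middle_informative as [B2|]; [|assumption].
  destruct excluded_middle_informative as [B3|]; [|assumption].
  intros B4. apply HB. unfold box, corner in *; simpl fst in *; simpl snd in *.
  pose proof (halfpos W (S n) HW) as PW. pose proof (halfpos H (S n) HH) as PH.
  rewrite (half W n), (half H n).
  set (w := W / 2 ^ S n) in *. set (k := H / 2 ^ S n) in *.
  rewrite !Rplus_0_r in *. rewrite <- !Rplus_assoc.
  apply merge_v with (snd p + k); [lra|lra| |].
  - apply merge_h with (fst p + w); [lra|lra| |]; assumption.
  - apply merge_h with (fst p + w); [lra|lra| |]; assumption.
Qed.

Let pick_in (n : nat) (p : R * R) :
  (fst p <= fst (pick n p) /\ fst (pick n p) + W / 2 ^ S n <= fst p + W / 2 ^ n) /\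
  (snd p <= snd (pick n p) /\ snd (pick n p) + H / 2 ^ S n <= snd p + H / 2 ^ n).
Proof.
  pose proof (halfpos W (S n) HW). pose proof (halfpos H (S n) HH).
  rewrite (half W n), (half H n). unfold pick, corner.
  set (w := W / 2 ^ S n) in *. set (k := H / 2 ^ S n) in *.
  repeat destruct excluded_middle_informative; simpl fst; simpl snd; lra.
Qed.

Fixpoint bisect (n : nat) : R * R :=
  match n with O => (a0, c0) | S n => pick n (bisect n) end.

Let nested_limit (u : nat -> R) (X : R) : 0 <= X ->
  (forall n, u n <= u (S n) /\ u (S n) + X / 2 ^ S n <= u n + X / 2 ^ n) ->
  exists x, forall n, u n <= x <= u n + X / 2 ^ n.
Proof.
  intros HX Hu.
  assert (M : forall n k, u n <= u (n + k)%nat /\ u (n + k)%nat + X / 2 ^ (n + k) <= u n + X / 2 ^ n).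
  { intros n k. induction k as [|k IH].
    - rewrite Nat.add_0_r; lra.
    - rewrite Nat.add_succ_r. destruct (Hu (n + k)%nat); lra. }
  assert (M2 : forall n m, u m <= u n + X / 2 ^ n).
  { intros n m. destruct (Nat.le_ge_cases n m) as [L|L].
    - destruct (M n (m - n)%nat) as [_ Q]. replace (n + (m - n))%nat with m in Q by lia.
      pose proof (halfpos X m HX); lra.
    - destruct (M m (n - m)%nat) as [Q _]. replace (m + (n - m))%nat with n in Q by lia.
      pose proof (halfpos X n HX); lra. }
  destruct (completeness (fun y => exists n, y = u n)) as [x [U L]].
  - exists (u O + X / 2 ^ 0). intros y [n ->]. apply M2.
  - exists (u O), O. reflexivity.
  - exists x. intros n. split; [apply U; exists n; reflexivity|].
    apply L. intros y [m ->]. apply M2.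
Qed.

(** Repeated halving of both sides keeps every piece a copy of the original scaled by [t = 2^-n].
    The local hypothesis therefore speaks only of such copies that contain the point [(x, y)] and
    lie in the whole rectangle. *)
Lemma cousin_rectangle :
  (forall x y, a0 <= x <= a0 + W -> c0 <= y <= c0 + H -> exists del, 0 < del /\
    forall a c t, 0 < t < del -> a <= x <= a + t * W -> c <= y <= c + t * H ->
      a0 <= a -> a + t * W <= a0 + W -> c0 <= c -> c + t * H <= c0 + H ->
      P a (a + t * W) c (c + t * H)) ->
  P a0 (a0 + W) c0 (c0 + H).
Proof.
  intros Hloc. apply NNPP. intros HN.
  assert (Bad : forall n, ~ box n (bisect n)).
  { intros n. induction n as [|n IH].
    - unfold box; simpl. unfold Rdiv; rewrite !Rinv_1, !Rmult_1_r. exact HN.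
    - apply pick_bad, IH. }
  destruct (nested_limit (fun n => fst (bisect n)) W HW) as [x Hx].
  { intros n. apply (pick_in n (bisect n)). }
  destruct (nested_limit (fun n => snd (bisect n)) H HH) as [y Hy].
  { intros n. apply (pick_in n (bisect n)). }
  assert (In : forall n, (a0 <= fst (bisect n) /\ fst (bisect n) + W / 2 ^ n <= a0 + W) /\
    (c0 <= snd (bisect n) /\ snd (bisect n) + H / 2 ^ n <= c0 + H)).
  { intros n. induction n as [|n IH].
    - simpl. unfold Rdiv; rewrite !Rinv_1, !Rmult_1_r. lra.
    - pose proof (pick_in n (bisect n)). simpl bisect. lra. }
  pose proof (Hx O) as X0. pose proof (Hy O) as Y0. simpl in X0, Y0.
  unfold Rdiv in X0, Y0; rewrite Rinv_1, Rmult_1_r in X0, Y0.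
  destruct (Hloc x y X0 Y0) as [del [Hdel Q]].
  destruct (pow_lt_1_zero (/ 2) ltac:(rewrite Rabs_pos_eq; lra) del Hdel) as [n Hn].
  specialize (Hn n (Nat.le_refl n)).
  pose proof (pow_lt (/ 2) n ltac:(lra)) as Pn.
  rewrite Rabs_pos_eq in Hn by lra.
  apply (Bad n). unfold box.
  assert (E : forall X, X / 2 ^ n = (/ 2) ^ n * X).
  { intros X. rewrite pow_inv. unfold Rdiv; ring. }
  specialize (Hx n). specialize (Hy n). specialize (In n).
  rewrite !E in *. apply Q; lra.
Qed.
End cousin.

(** * Maxima on compact sets *)

(** Bisection is applied to the property that one point of [K] strictly beats all points of [K] in
    the rectangle. Without a maximum it holds locally, by upper semicontinuity or because [K] is
    absent, so it holds on a square containing [K], where the winner would beat itself. *)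
Lemma compact_max (K : C -> Prop) (phi : C -> R) (B : R) :
  (exists z, K z) -> (forall z, K z -> Cmod z <= B) ->
  (forall z, ~ K z -> exists del, 0 < del /\ forall w, Cmod (w - z)%C < del -> ~ K w) ->
  (forall z, K z -> forall eps, 0 < eps -> exists del, 0 < del /\
    forall w, K w -> Cmod (w - z)%C < del -> phi w < phi z + eps) ->
  exists z, K z /\ forall w, K w -> phi w <= phi z.
Proof.
  intros [k0 Hk0] HB Hcl Hct.
  apply NNPP. intros HN.
  assert (Up : forall z, K z -> exists w, K w /\ phi z < phi w).
  { intros z Hz. apply NNPP. intros N. apply HN. exists z; split; [exact Hz|].
    intros w Hw. apply Rnot_lt_le. intros L. apply N. exists w; auto. }
  assert (HB0 : 0 <= B) by (eapply Rle_trans; [apply Cmod_ge_0 | apply (HB k0 Hk0)]).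
  set (P := fun a b c d => exists z, K z /\ forall w, K w ->
    a <= Re w <= b -> c <= Im w <= d -> phi w < phi z).
  assert (Mrg : forall (Q1 Q2 Q : C -> Prop), (forall w, Q w -> Q1 w \/ Q2 w) ->
    (exists z, K z /\ forall w, K w -> Q1 w -> phi w < phi z) ->
    (exists z, K z /\ forall w, K w -> Q2 w -> phi w < phi z) ->
    exists z, K z /\ forall w, K w -> Q w -> phi w < phi z).
  { intros Q1 Q2 Q HQ [z1 [Kz1 H1]] [z2 [Kz2 H2]].
    destruct (Rle_dec (phi z1) (phi z2)) as [L|L].
    - exists z2; split; [exact Kz2|]. intros w Kw Qw. destruct (HQ w Qw) as [q|q].
      + specialize (H1 w Kw q); lra.
      + exact (H2 w Kw q).
    - exists z1; split; [exact Kz1|]. intros w Kw Qw. destruct (HQ w Qw) as [q|q].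
      + exact (H1 w Kw q).
      + specialize (H2 w Kw q); lra. }
  assert (All : P (- B) (- B + 2 * B) (- B) (- B + 2 * B)).
  { apply cousin_rectangle; [| |lra|lra|].
    - intros a m b c d Hm Hc [z1 [Kz1 H1]] [z2 [Kz2 H2]].
      destruct (Mrg (fun w => a <= Re w <= m /\ c <= Im w <= d)
        (fun w => m <= Re w <= b /\ c <= Im w <= d)
        (fun w => a <= Re w <= b /\ c <= Im w <= d)) as [z [Kz Hz]].
      + intros w [Hw1 Hw2]. destruct (Rle_dec (Re w) m); [left|right]; lra.
      + exists z1; split; [exact Kz1|]. intros w Kw [q1 q2]; auto.
      + exists z2; split; [exact Kz2|]. intros w Kw [q1 q2]; auto.
      + exists z; split; auto.
    - intros a b c m d Hm Hc [z1 [Kz1 H1]] [z2 [Kz2 H2]].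
      destruct (Mrg (fun w => a <= Re w <= b /\ c <= Im w <= m)
        (fun w => a <= Re w <= b /\ m <= Im w <= d)
        (fun w => a <= Re w <= b /\ c <= Im w <= d)) as [z [Kz Hz]].
      + intros w [Hw1 Hw2]. destruct (Rle_dec (Im w) m); [left|right]; lra.
      + exists z1; split; [exact Kz1|]. intros w Kw [q1 q2]; auto.
      + exists z2; split; [exact Kz2|]. intros w Kw [q1 q2]; auto.
      + exists z; split; auto.
    - intros x y _ _. set (z0 := (x, y) : C).
      assert (Near : forall del, 0 < del -> exists d, 0 < d /\ forall a c t w, 0 < t < d ->
        a <= x <= a + t * (2 * B) -> c <= y <= c + t * (2 * B) ->
        a <= Re w <= a + t * (2 * B) -> c <= Im w <= c + t * (2 * B) -> Cmod (w - z0)%C < del).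
      { intros del Hdel. exists (del / (4 * B + 1)); split; [apply Rdiv_lt_0_compat; lra|].
        intros a c t w [Ht1 Ht2] Hx Hy Hw1 Hw2.
        apply (Rmult_lt_compat_r (4 * B + 1)) in Ht2; [|lra].
        unfold Rdiv in Ht2; rewrite Rmult_assoc, Rinv_l, Rmult_1_r in Ht2 by lra.
        eapply Rle_lt_trans; [apply Cmod_le_sum|]. rewrite re_minus, im_minus.
        unfold z0; simpl Re; simpl Im.
        assert (Rabs (Re w - x) <= t * (2 * B)) by (apply Rabs_le; lra).
        assert (Rabs (Im w - y) <= t * (2 * B)) by (apply Rabs_le; lra).
        lra. }
      destruct (classic (K z0)) as [Kz|NKz].
      + destruct (Up z0 Kz) as [w1 [Kw1 Lt]].
        destruct (Hct z0 Kz (phi w1 - phi z0) ltac:(lra)) as [del [Hdel Q]].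
        destruct (Near del Hdel) as [d [Hd Nr]].
        exists d; split; [exact Hd|]. intros a c t Ht Hx Hy _ _ _ _.
        exists w1; split; [exact Kw1|]. intros w Kw Hw1 Hw2.
        specialize (Q w Kw (Nr a c t w Ht Hx Hy Hw1 Hw2)); lra.
      + destruct (Hcl z0 NKz) as [del [Hdel Q]].
        destruct (Near del Hdel) as [d [Hd Nr]].
        exists d; split; [exact Hd|]. intros a c t Ht Hx Hy _ _ _ _.
        exists k0; split; [exact Hk0|]. intros w Kw Hw1 Hw2.
        destruct (Q w (Nr a c t w Ht Hx Hy Hw1 Hw2) Kw). }
  destruct All as [z [Kz Hz]].
  assert (L : phi z < phi z); [|lra].
  apply Hz; auto; specialize (HB z Kz).
  - pose proof (re_le_Cmod z) as Q. apply Rabs_le_between in Q; lra.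
  - pose proof (im_le_Cmod z) as Q. apply Rabs_le_between in Q; lra.
Qed.

Lemma disk_max (phi : C -> R) (r : R) : 0 <= r ->
  (forall z, Cmod z <= r -> forall eps, 0 < eps -> exists del, 0 < del /\
    forall w, Cmod (w - z)%C < del -> phi w < phi z + eps) ->
  exists z, Cmod z <= r /\ forall w, Cmod w <= r -> phi w <= phi z.
Proof.
  intros Hr Hct. apply (compact_max (fun z => Cmod z <= r) phi r).
  - exists 0. rewrite Cmod_0; exact Hr.
  - auto.
  - intros z Hz. exists (Cmod z - r); split; [lra|]. intros w Hw Kw.
    pose proof (Cmod_triangle_rev z w) as T. rewrite Cmod_minus_sym in T. lra.
  - intros z Hz eps Heps. destruct (Hct z Hz eps Heps) as [d [Hd H]].
    exists d; split; auto.
Qed.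

(** * Supporting lines of convex images *)

Lemma pder_antiderivative (p : R -> C) (t : R) : (forall s, ct p s) ->
  pder (fun t => (RInt (fun s => Re (p s)) 0 t, RInt (fun s => Im (p s)) 0 t)) t (p t).
Proof.
  intros Hp. split; simpl.
  - apply (is_derive_RInt (fun s => Re (p s)) (fun t => RInt (fun s => Re (p s)) 0 t) 0 t).
    + exists (mkposreal 1 Rlt_0_1). intros y _.
      apply (RInt_correct (V := R_CompleteNormedModule)). apply (ct_ex_RInt p 0 y Hp).
    + apply Hp.
  - apply (is_derive_RInt (fun s => Im (p s)) (fun t => RInt (fun s => Im (p s)) 0 t) 0 t).
    + exists (mkposreal 1 Rlt_0_1). intros y _.
      apply (RInt_correct (V := R_CompleteNormedModule)). apply (ct_ex_RInt p 0 y Hp).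
    + apply Hp.
Qed.

Lemma MVT_strict (f f' : R -> R) (a b : R) : a < b ->
  (forall c, a <= c <= b -> is_derive f c (f' c)) ->
  exists c, a < c < b /\ f b - f a = f' c * (b - a).
Proof.
  intros Hab D. destruct (MVT_cor2 f f' a b Hab) as [c [E Hc]].
  - intros c Hc. apply is_derive_Reals, D, Hc.
  - exists c; auto.
Qed.

Lemma hol_rotate (f f' : C -> C) (u : C) : Cmod u = 1 -> hol f f' ->
  hol (fun z => f (u * z)%C) (fun z => f' (u * z) * u)%C.
Proof.
  intros Hu Hf z Hz.
  destruct (Hf (u * z)%C) as [D Cn]; [rewrite Cmod_mult, Hu; lra|]. split.
  - apply (cder_comp f (fun w => u * w)%C); [|exact D].
    eapply cder_eq; [apply cder_scal, cder_id | ring].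
  - apply ccont_iff_ct. apply ct_mult; [|apply ct_const].
    apply (ct_comp f'); [|exact Cn]. apply ct_mult; [apply ct_const | apply ct_id].
Qed.

(* The outer normal [z h1(z)] of the curve [h(|z| = r)] turns monotonically, since its
   logarithmic derivative in the angle is [i p], and makes exactly one turn, since the mean
   of [p] over the circle is [p 0 = 1]. *)
Lemma star_circle (alpha : R) (h h1 h2 : C -> C) (u : C) (r s : R) : 0 <= alpha < 1 ->
  convex_order alpha h h1 h2 -> Cmod u = 1 -> 0 < r < 1 -> 0 < s < 2 * PI ->
  let z t := (u * circ r t)%C in
  0 < Re (Cconj (z 0 * h1 (z 0)) * (h (z 0) - h (z s)))%C.
Proof.
  intros Ha HC Hu Hr Hs z.
  destruct (pre_schwarzian_hol _ _ _ _ HC) as [q' Hq].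
  destruct HC as [H [H1 [_ HN]]].
  set (q := fun w => (h2 w / h1 w)%C) in *.
  set (P := fun w => (1 + w * q w)%C).
  assert (HP : hol P (fun w => q w + w * q' w)%C) by (apply hol_affine_mul, Hq).
  assert (In : forall t, Cmod (z t) < 1).
  { intros t. unfold z. rewrite Cmod_mult, Hu, Cmod_circ; lra. }
  assert (Dz : forall t, pder z t (Ci * z t)%C).
  { intros t. eapply pder_eq; [apply pder_scal, pder_circ|]. unfold z; ring. }
  assert (Pc : forall t, ct (fun t => P (z t)) t).
  { intros t. apply (ct_comp P z); [eapply pder_ct, Dz|]. eapply cder_ccont, HP, In. }
  assert (Pre : forall t, 0 < Re (P (z t))).
  { intros t. destruct (HN (z t) (In t)) as [_ K]. unfold P, q.
    replace (1 + z t * (h2 (z t) / h1 (z t)))%C with (1 + z t * h2 (z t) / h1 (z t))%C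
      by (unfold Cdiv; ring). lra. }
  set (I := fun t => (RInt (fun s => Re (P (z s))) 0 t, RInt (fun s => Im (P (z s))) 0 t) : C).
  assert (DI : forall t, pder I t (P (z t))) by (intros t; apply (pder_antiderivative _ t Pc)).
  assert (I0 : I 0 = 0).
  { apply Ceq; unfold I; simpl; apply (RInt_point (V := R_CompleteNormedModule)). }
  assert (I2 : Re (I (2 * PI)) = 2 * PI).
  { change (Re (CI (fun t => P (z t))) = 2 * PI).
    pose proof (cauchy_formula _ _ r 0 (hol_rotate _ _ u Hu HP) Hr) as E.
    rewrite Cmod_0 in E. specialize (E (proj1 Hr)).
    rewrite (CI_ext _ (fun t => P (z t))) in E.
    - rewrite E. unfold P. replace (u * 0)%C with (RtoC 0) by ring.
      replace (RtoC (2 * PI) * (1 + 0 * q 0%C))%C with (RtoC (2 * PI)) by ring. reflexivity.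
    - intros t. cbv beta. unfold z. field. replace (circ r t - 0)%C with (circ r t) by ring.
      apply circ_0_neq; lra. }
  set (T := fun t => (z t * h1 (z t))%C).
  assert (ET : forall t, T t = (T 0 * Cexp (Ci * I t))%C).
  { assert (G : forall t, pder (fun t => T t * Cexp (- Ci * I t))%C t 0).
    { intros t. eapply pder_eq.
      - apply pder_mult.
        + apply pder_mult; [apply Dz|]. apply (pder_comp h1 z); [apply Dz | apply H1, In].
        + apply (pder_comp Cexp (fun t => - Ci * I t)%C); [|apply cder_Cexp].
          apply pder_scal, DI.
      - cbv beta. unfold T, P, q. field. apply HN, In. }
    assert (K : forall t, (T t * Cexp (- Ci * I t))%C = T 0).
    { intros t.
      transitivity (T 0 * Cexp (- Ci * I 0))%C.
      - destruct (Rtotal_order 0 t) as [L|[<-|L]].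
        + symmetry. apply (pder_zero_const (fun t => T t * Cexp (- Ci * I t))%C 0 t L). auto.
        + reflexivity.
        + apply (pder_zero_const (fun t => T t * Cexp (- Ci * I t))%C t 0 L). auto.
      - rewrite I0. replace (- Ci * 0)%C with (RtoC 0) by ring. rewrite Cexp_0. ring. }
    intros t. rewrite <- (K t), <- Cmult_assoc, <- Cexp_add.
    replace (- Ci * I t + Ci * I t)%C with (RtoC 0) by ring. rewrite Cexp_0. ring. }
  assert (NT : 0 < Cmod (T 0)).
  { apply Cmod_gt_0. unfold T. apply Cmult_neq_0; [|apply HN, In].
    apply Cmod_gt_0. unfold z. rewrite Cmod_mult, Hu, Cmod_circ; lra. }
  (* Up to the factor [|T 0|], the distance of [h (z t)] behind the tangent at [h (z 0)]. It
     vanishes at [0] and at [2 * PI], and its derivative has the sign of the sine of the turning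
     angle [A t]. *)
  set (d := fun t => Re (Cconj (T 0) * (h (z 0) - h (z t)))%C).
  assert (Dd : forall t, is_derive d t
    (Cmod (T 0) ^ 2 * exp (- Im (I t)) * sin (Re (I t)))).
  { intros t.
    assert (D : pder (fun t => Cconj (T 0) * (h (z 0) - h (z t)))%C t
      (Cconj (T 0) * (0 - h1 (z t) * (Ci * z t)))%C).
    { apply pder_scal, pder_minus; [apply pder_const|].
      apply (pder_comp h z); [apply Dz | apply H, In]. }
    destruct D as [D _].
    replace (Cmod (T 0) ^ 2 * exp (- Im (I t)) * sin (Re (I t))) with
      (Re (Cconj (T 0) * (0 - h1 (z t) * (Ci * z t)))%C); [exact D|].
    replace (Cconj (T 0) * (0 - h1 (z t) * (Ci * z t)))%C with
      (- Ci * (T 0 * Cconj (T 0)) * Cexp (Ci * I t))%C.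
    2: { replace (0 - h1 (z t) * (Ci * z t))%C with (- Ci * T t)%C by (unfold T; ring).
         rewrite (ET t). ring. }
    rewrite <- Cmod2_conj.
    set (m := Cmod (T 0) ^ 2). unfold Cexp. destruct (I t) as [a b]. simpl.
    replace (0 * a - 1 * b) with (- b) by ring. replace (0 * b + 1 * a) with a by ring. ring. }
  assert (D2 : d (2 * PI) = 0).
  { unfold d, z. rewrite circ_2PI, re_mult, re_minus, im_minus. ring. }
  assert (D0 : d 0 = 0) by (unfold d; rewrite re_mult, re_minus, im_minus; ring).
  set (A := fun t => Re (I t)).
  assert (DA : forall t, is_derive A t (Re (P (z t)))) by (intros t; apply DI).
  assert (Incr : forall a b, a < b -> A a < A b).
  { intros a b Hab. destruct (MVT_strict A (fun t => Re (P (z t))) a b Hab) as [c [_ E]].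
    - intros; apply DA.
    - pose proof (Rmult_lt_0_compat _ _ (Pre c) (Rlt_Rminus _ _ Hab)). lra. }
  assert (A2 : A (2 * PI) = 2 * PI) by exact I2.
  assert (A0 : A 0 = 0) by (unfold A; rewrite I0; reflexivity).
  change (0 < d s).
  assert (Pm : forall t, 0 < Cmod (T 0) ^ 2 * exp (- Im (I t))).
  { intros t. apply Rmult_lt_0_compat; [apply pow_lt, NT | apply exp_pos]. }
  (* Up to a half turn [d] has been increasing from 0; past it, [d] still has to decrease to 0.
     Either way it is positive at [s]. *)
  destruct (Rle_dec (A s) PI) as [L|L].
  - destruct (MVT_strict d (fun t => Cmod (T 0) ^ 2 * exp (- Im (I t)) * sin (Re (I t))) 0 s)
      as [c [Hc E]]; [lra|intros; apply Dd|].
    rewrite D0 in E.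
    assert (S : 0 < sin (A c)).
    { pose proof (Incr 0 c ltac:(lra)). pose proof (Incr c s ltac:(lra)).
      apply sin_gt_0; lra. }
    pose proof (Rmult_lt_0_compat _ _ (Rmult_lt_0_compat _ _ (Pm c) S) (Rlt_Rminus _ _ (proj1 Hs))).
    unfold A in *. lra.
  - destruct (MVT_strict d (fun t => Cmod (T 0) ^ 2 * exp (- Im (I t)) * sin (Re (I t))) s (2 * PI))
      as [c [Hc E]]; [lra|intros; apply Dd|].
    rewrite D2 in E.
    assert (S : sin (A c) < 0).
    { pose proof (Incr s c ltac:(lra)). pose proof (Incr c (2 * PI) ltac:(lra)).
      apply sin_lt_0; lra. }
    assert (S' : 0 < - sin (A c)) by lra.
    pose proof (Rmult_lt_0_compat _ _ (Rmult_lt_0_compat _ _ (Pm c) S') (Rlt_Rminus _ _ (proj2 Hs))).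
    unfold A in *. lra.
Qed.

Lemma increase_along (g : R -> R) (l del : R) : is_derive g 0 l -> 0 < l -> 0 < del ->
  exists s, 0 < s < del /\ g 0 < g s.
Proof.
  intros D Hl Hdel. rewrite is_derive_eps in D.
  destruct (D (l / 2)) as [e [He K]]; [lra|].
  set (s := Rmin e del / 2).
  pose proof (Rmin_pos e del He Hdel). pose proof (Rmin_l e del). pose proof (Rmin_r e del).
  assert (Hs : 0 < s) by (unfold s; lra).
  exists s. split; [unfold s in *; lra|].
  specialize (K s). rewrite Rminus_0_r, Rabs_pos_eq in K by lra.
  specialize (K ltac:(unfold s in *; lra)).
  apply Rabs_le_between in K.
  assert (0 < s * l) by (apply Rmult_lt_0_compat; lra).
  lra.
Qed.

Lemma pder_line (f : C -> C) (z v l : C) : cder f z l ->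
  pder (fun s => f (z + s * v)%C) 0 (l * v)%C.
Proof.
  intros H. apply (pder_comp f (fun s => z + s * v)%C).
  - eapply pder_eq.
    + apply pder_plus; [apply pder_const|]. apply pder_mult; [apply pder_RtoC | apply pder_const].
    + cbv beta; ring.
  - replace (z + 0 * v)%C with z by ring. exact H.
Qed.

(** In the direction [Cconj (a * l)] the derivative of [Re (a * h)] is [|a * l|^2 > 0]. *)
Lemma no_interior_max (h : C -> C) (z l a : C) (r : R) : cder h z l -> l <> 0 -> a <> 0 ->
  Cmod z < r -> exists w, Cmod w <= r /\ Re (a * h z)%C < Re (a * h w)%C.
Proof.
  intros D Nl Na Hz. set (v := Cconj (a * l)%C).
  assert (Nv : 0 < Cmod v) by (unfold v; rewrite Cmod_conj; apply Cmod_gt_0, Cmult_neq_0; assumption).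
  destruct (increase_along (fun s => Re (a * h (z + s * v)%C)%C) (Cmod v ^ 2) ((r - Cmod z) / Cmod v))
    as [s [Hs L]].
  - destruct (pder_scal a _ _ _ (pder_line h z v l D)) as [Q _].
    replace (Cmod v ^ 2) with (Re (a * (l * v))%C); [exact Q|].
    unfold v. replace (a * (l * Cconj (a * l)))%C with ((a * l) * Cconj (a * l))%C by ring.
    rewrite <- Cmod2_conj, Cmod_conj. reflexivity.
  - apply pow_lt, Nv.
  - apply Rdiv_lt_0_compat; lra.
  - exists (z + s * v)%C. split.
    + eapply Rle_trans; [apply Cmod_triangle|]. rewrite Cmod_mult, Cmod_R, Rabs_pos_eq by lra.
      destruct Hs as [_ Hs]. apply (Rmult_lt_compat_r (Cmod v)) in Hs; [|exact Nv].
      unfold Rdiv in Hs; rewrite Rmult_assoc, Rinv_l in Hs; lra.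
    + replace z with (z + 0 * v)%C at 1 by ring. exact L.
Qed.

(** The functional [phi] attains its maximum over the disk of radius [|z|], not inside since [h1]
    has no zero, and on the circle at no point other than [z] by [star_circle]. *)
Lemma supporting_line (alpha : R) (h h1 h2 : C -> C) (z w : C) : 0 <= alpha < 1 ->
  convex_order alpha h h1 h2 -> Cmod z < 1 -> Cmod w <= Cmod z -> w <> z ->
  0 < Re (Cconj (z * h1 z) * (h z - h w))%C.
Proof.
  intros Ha HC Hz Hw N. pose proof HC as [H [_ [_ HN]]].
  set (r := Cmod z) in *. pose proof (Cmod_ge_0 w) as Pw.
  assert (Nz : z <> 0).
  { intro E. apply N. unfold r in Hw. rewrite E, Cmod_0 in Hw.
    rewrite E. apply Cmod_eq_0. lra. }
  assert (Hr : 0 < r) by (apply Cmod_gt_0, Nz).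
  set (a := Cconj (z * h1 z)%C).
  assert (Na : a <> 0).
  { apply Cmod_gt_0. unfold a. rewrite Cmod_conj. apply Cmod_gt_0, Cmult_neq_0; [exact Nz|].
    apply HN, Hz. }
  set (phi := fun y => Re (a * h y)%C).
  assert (Crc : forall y, Cmod y = r -> y <> z -> phi y < phi z).
  { intros y Hy Ny.
    set (u := (z / r)%C).
    assert (Nr : RtoC r <> 0) by (intro K; apply RtoC_inj in K; lra).
    assert (Hu : Cmod u = 1).
    { unfold u. rewrite Cmod_div, Cmod_R, Rabs_pos_eq by (auto; lra). fold r. field. lra. }
    assert (Nu : u <> 0) by (apply Cmod_gt_0; lra).
    destruct (polar (y / u)%C) as [s [Hs Es]].
    rewrite Cmod_div, Hy, Hu, Rdiv_1_r in Es by exact Nu.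
    assert (Ey : y = (u * circ r s)%C) by (rewrite <- Es; field; exact Nu).
    assert (Ez : z = (u * circ r 0)%C).
    { unfold u. replace (circ r 0) with (RtoC r).
      - field. exact Nr.
      - unfold circ. rewrite cos_0, sin_0, Rmult_1_r, Rmult_0_r. reflexivity. }
    assert (Hs' : 0 < s < 2 * PI).
    { split.
      - destruct (Req_dec s 0) as [E|]; [|lra]. exfalso; apply Ny. rewrite Ey, Ez, E. reflexivity.
      - destruct (Req_dec s (2 * PI)) as [E|]; [|lra]. exfalso; apply Ny.
        rewrite Ey, Ez, E, circ_2PI. reflexivity. }
    pose proof (star_circle alpha h h1 h2 u r s Ha HC Hu ltac:(lra) Hs') as S.
    cbv beta zeta in S. rewrite <- Ez, <- Ey in S. fold a in S.
    unfold phi. replace (a * (h z - h y))%C with (a * h z - a * h y)%C in S by ring.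
    rewrite re_minus in S. lra. }
  assert (Int : forall y, Cmod y < r -> exists y', Cmod y' <= r /\ phi y < phi y').
  { intros y Hy. apply (no_interior_max h y (h1 y) a r); auto.
    - apply H; lra.
    - apply HN; lra. }
  assert (Max : forall y, Cmod y <= r -> phi y <= phi z).
  { destruct (disk_max phi r) as [m [Hm M]]; [lra| |].
    - intros y Hy eps Heps.
      destruct (cder_ccont (fun y => a * h y)%C y (a * h1 y)%C) with (eps := eps) as [d [Hd K]];
        [apply cder_scal, H; lra | exact Heps |].
      exists d; split; [exact Hd|]. intros y' Hy'. specialize (K y' Hy').
      pose proof (re_le_Cmod (a * h y' - a * h y)%C) as Q. rewrite re_minus in Q.
      apply Rabs_le_between in Q. unfold phi. lra.
    - destruct (Rle_lt_or_eq_dec _ _ Hm) as [L|E].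
      + destruct (Int m L) as [y' [Hy' L']]. specialize (M y' Hy'). lra.
      + destruct (Ceq_dec m z) as [->|Nm]; [exact M|].
        specialize (Crc m E Nm). intros y Hy. specialize (M y Hy). lra. }
  assert (G : phi w < phi z).
  { destruct (Rle_lt_or_eq_dec _ _ Hw) as [L|E]; [|apply Crc; assumption].
    destruct (Int w L) as [y [Hy Lt]]. specialize (Max y Hy). lra. }
  unfold phi in G. replace (a * (h z - h w))%C with (a * h z - a * h w)%C by ring.
  rewrite re_minus. lra.
Qed.

(** The supporting line is taken at the point of larger modulus; the image of the other lies
    strictly behind it. *)
Lemma convex_injective (alpha : R) (h h1 h2 : C -> C) (z w : C) : 0 <= alpha < 1 ->
  convex_order alpha h h1 h2 -> Cmod z < 1 -> Cmod w < 1 -> h z = h w -> z = w.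
Proof.
  intros Ha HC Hz Hw E. destruct (Ceq_dec z w) as [|N]; [assumption|exfalso].
  destruct (Rle_dec (Cmod w) (Cmod z)) as [L|L].
  - pose proof (supporting_line alpha h h1 h2 z w Ha HC Hz L (not_eq_sym N)) as S.
    rewrite E in S. replace (h w - h w)%C with (RtoC 0) in S by ring.
    rewrite Cmult_0_r in S. simpl in S; lra.
  - pose proof (supporting_line alpha h h1 h2 w z Ha HC Hw ltac:(lra) N) as S.
    rewrite E in S. replace (h w - h w)%C with (RtoC 0) in S by ring.
    rewrite Cmult_0_r in S. simpl in S; lra.
Qed.

(** * Univalence of the harmonic map *)

(* At a maximum [z] of [|g z - g w| - k |h z - h w|] over the closed disk, moving [h z]
   straight towards [h w] stays in the disk by [supporting_line], and it decreases
   [|h z - h w|] faster than [k^-1 |g z - g w|]: the maximum must be nonpositive. *)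
Lemma dilatation_lipschitz (alpha : R) (h h1 h2 g g1 : C -> C) (t kap k : R) (z w : C) :
  0 <= alpha < 1 -> convex_order alpha h h1 h2 ->
  (forall z, Cmod z < 1 -> cder g z (g1 z)) ->
  t < 1 -> 0 <= kap < k ->
  (forall z, Cmod z <= t -> Cmod (g1 z) <= kap * Cmod (h1 z)) ->
  Cmod z <= t -> Cmod w <= t ->
  Cmod (g z - g w)%C <= k * Cmod (h z - h w)%C.
Proof.
  intros Ha HC Hg Ht Hk Hdil Hz Hw. pose proof HC as [H [_ [_ HN]]].
  assert (Pt : 0 <= t) by (eapply Rle_trans; [apply Cmod_ge_0 | exact Hz]).
  set (N := fun y => Cmod (g y - g w)%C - k * Cmod (h y - h w)%C).
  destruct (disk_max N t Pt) as [m [Hm M]].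
  { intros y Hy eps Heps.
    assert (He : 0 < eps / (2 * (k + 1))) by (apply Rdiv_lt_0_compat; lra).
    destruct (cder_ccont g y _ (Hg y ltac:(lra)) (eps / 2) ltac:(lra)) as [d1 [Hd1 K1]].
    destruct (cder_ccont h y _ (proj1 (H y ltac:(lra))) _ He) as [d2 [Hd2 K2]].
    exists (Rmin d1 d2); split; [apply Rmin_pos; lra|]. intros v Hv.
    specialize (K1 v (Rlt_le_trans _ _ _ Hv (Rmin_l _ _))).
    specialize (K2 v (Rlt_le_trans _ _ _ Hv (Rmin_r _ _))).
    unfold N.
    pose proof (Cmod_triangle_rev (g v - g w)%C (g y - g w)%C) as T1.
    replace (g v - g w - (g y - g w))%C with (g v - g y)%C in T1 by ring.
    pose proof (Cmod_triangle_rev (h y - h w)%C (h v - h w)%C) as T2.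
    replace (h y - h w - (h v - h w))%C with (h y - h v)%C in T2 by ring.
    rewrite (Cmod_minus_sym (h y) (h v)) in T2.
    assert (k * Cmod (h v - h y)%C <= k * (eps / (2 * (k + 1)))) by (apply Rmult_le_compat_l; lra).
    assert (k * (eps / (2 * (k + 1))) <= eps / 2).
    { replace (eps / 2) with ((k + 1) * (eps / (2 * (k + 1)))) by (field; lra).
      apply Rmult_le_compat_r; lra. }
    assert (k * (Cmod (h y - h w)%C - Cmod (h v - h w)%C) <= k * Cmod (h v - h y)%C).
    { apply Rmult_le_compat_l; lra. }
    lra. }
  destruct (Rle_dec (N m) 0) as [L|L].
  { specialize (M z Hz). unfold N in *. lra. }
  exfalso. apply Rnot_le_lt in L.
  assert (Nmw : m <> w).
  { intro E. rewrite E in L. unfold N in L.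
    replace (g w - g w)%C with (RtoC 0) in L by ring.
    replace (h w - h w)%C with (RtoC 0) in L by ring. rewrite Cmod_0 in L. lra. }
  set (X := (h m - h w)%C). set (G := (g m - g w)%C).
  assert (NX : X <> 0).
  { intro E. apply Nmw. apply (convex_injective alpha h h1 h2); auto; try lra.
    replace (h m) with (X + h w)%C by (unfold X; ring). rewrite E; ring. }
  assert (Hm1 : Cmod m < 1) by lra.
  destruct (HN m Hm1) as [N1 _].
  (* Solves [h1 m * v = - X]: to first order [h] moves straight from [h m] to [h w]. *)
  set (v := (- X / h1 m)%C).
  assert (Nv : v <> 0).
  { intro E. apply NX. replace X with (- v * h1 m)%C by (unfold v; field; exact N1). rewrite E; ring. }
  apply Cmod_gt_0 in Nv. pose proof (proj1 (Cmod_gt_0 _) NX) as PX.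
  assert (Stay : exists d, 0 < d /\ forall s, 0 < s < d -> Cmod (m + s * v)%C <= t).
  { destruct (Rle_lt_or_eq_dec _ _ Hm) as [Lt|E].
    - exists ((t - Cmod m) / Cmod v); split; [apply Rdiv_lt_0_compat; lra|].
      intros s [Hs1 Hs2]. eapply Rle_trans; [apply Cmod_triangle|].
      rewrite Cmod_mult, Cmod_R, Rabs_pos_eq by lra.
      apply (Rmult_lt_compat_r (Cmod v)) in Hs2; [|exact Nv].
      unfold Rdiv in Hs2; rewrite Rmult_assoc, Rinv_l in Hs2; lra.
    - pose proof (supporting_line alpha h h1 h2 m w Ha HC Hm1 ltac:(lra) (not_eq_sym Nmw)) as S.
      fold X in S.
      (* On the boundary circle the supporting line at [h m] makes [v] point strictly inward. With
         [b = - Re (Cconj m * v)], [|m + s v|^2 = t^2 - 2 s b + s^2 |v|^2] is then at most [t^2] for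
         small [s]. *)
      assert (S' : Re (Cconj m * v)%C < 0).
      { replace X with (- (h1 m * v))%C in S by (unfold v; field; exact N1).
        rewrite Cmult_conj in S.
        replace (Cconj m * Cconj (h1 m) * - (h1 m * v))%C with
          ((h1 m * Cconj (h1 m)) * - (Cconj m * v))%C in S by ring.
        rewrite <- Cmod2_conj, re_scal_l, re_opp in S.
        assert (0 < Cmod (h1 m) ^ 2) by (apply pow_lt, Cmod_gt_0, N1).
        apply Rnot_le_lt. intros Q.
        assert (0 <= Cmod (h1 m) ^ 2 * Re (Cconj m * v)%C) by (apply Rmult_le_pos; lra). lra. }
      set (b := - Re (Cconj m * v)%C) in *.
      assert (Pv2 : 0 < Cmod v ^ 2) by (apply pow_lt, Nv).
      exists (2 * b / Cmod v ^ 2); split; [apply Rdiv_lt_0_compat; unfold b; lra|].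
      intros s [Hs1 Hs2].
      apply Rsqr_incr_0_var; [|exact Pt]. unfold Rsqr. rewrite Cmod_sqr.
      assert (Em : Re m * Re m + Im m * Im m = t * t) by (rewrite <- Cmod_sqr, E; reflexivity).
      assert (Ev : Cmod v ^ 2 = Re v ^ 2 + Im v ^ 2) by apply Cmod2_alt.
      rewrite re_plus, im_plus, re_scal_l, im_scal_l.
      assert (Eb : b = - (Re m * Re v + Im m * Im v)).
      { unfold b. rewrite re_mult, re_conj, im_conj. ring. }
      apply (Rmult_lt_compat_r (Cmod v ^ 2)) in Hs2; [|exact Pv2].
      unfold Rdiv in Hs2; rewrite Rmult_assoc, Rinv_l, Rmult_1_r in Hs2 by lra.
      assert (s * (s * Cmod v ^ 2) <= s * (2 * b)) by (apply Rmult_le_compat_l; lra).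
      rewrite Ev, Eb in H0.
      replace ((Re m + s * Re v) * (Re m + s * Re v) + (Im m + s * Im v) * (Im m + s * Im v)) with
        ((Re m * Re m + Im m * Im m) + 2 * s * (Re m * Re v + Im m * Im v)
         + s * (s * (Re v ^ 2 + Im v ^ 2))) by ring.
      lra. }
  destruct Stay as [d [Hd Stay]].
  (* Along [v] the gain of [N] is at least [s * (k - kap) * |X|] to first order, and the remainders
     cost at most [s * e * (1 + k)]; this [e] makes the cost half of the gain. *)
  set (e := (k - kap) * Cmod X / (2 * (1 + k))).
  assert (He : 0 < e).
  { apply Rdiv_lt_0_compat; [|lra]. apply Rmult_lt_0_compat; lra. }
  destruct (proj1 (pder_eps _ _ _) (pder_line h m v _ (proj1 (H m Hm1))) e He) as [d1 [Hd1 K1]].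
  destruct (proj1 (pder_eps _ _ _) (pder_line g m v _ (Hg m Hm1)) e He) as [d2 [Hd2 K2]].
  set (s := Rmin (Rmin d 1) (Rmin d1 d2) / 2).
  assert (Hs0 : 0 < Rmin (Rmin d 1) (Rmin d1 d2)) by (repeat apply Rmin_pos; lra).
  pose proof (Rmin_l (Rmin d 1) (Rmin d1 d2)). pose proof (Rmin_r (Rmin d 1) (Rmin d1 d2)).
  pose proof (Rmin_l d 1). pose proof (Rmin_r d 1).
  pose proof (Rmin_l d1 d2). pose proof (Rmin_r d1 d2).
  assert (Hs : 0 < s /\ s < d /\ s < 1 /\ s < d1 /\ s < d2) by (unfold s; lra).
  clearbody s.
  specialize (Stay s ltac:(lra)). specialize (M (m + s * v)%C Stay).
  specialize (K1 s). specialize (K2 s). rewrite Rminus_0_r, Rabs_pos_eq in K1, K2 by lra.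
  specialize (K1 ltac:(lra)). specialize (K2 ltac:(lra)).
  replace (m + 0 * v)%C with m in K1, K2 by ring.
  assert (Eh : (h1 m * v)%C = (- X)%C) by (unfold v; field; exact N1).
  rewrite Eh in K1.
  assert (B1 : Cmod (h (m + s * v) - h w)%C <= (1 - s) * Cmod X + e * s).
  { replace (h (m + s * v) - h w)%C with
      ((1 - s)%R * X + (h (m + s * v) - h m - s * - X))%C.
    2: { unfold X; rewrite RtoC_minus; ring. }
    eapply Rle_trans; [apply Cmod_triangle|]. rewrite Cmod_mult, Cmod_R, Rabs_pos_eq by lra. lra. }
  assert (B2 : Cmod G - s * (kap * Cmod X) - e * s <= Cmod (g (m + s * v) - g w)%C).
  { pose proof (Cmod_triangle_rev G (G - (g (m + s * v) - g w))%C) as T.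
    replace (G - (G - (g (m + s * v) - g w)))%C with (g (m + s * v) - g w)%C in T by ring.
    assert (Q : Cmod (G - (g (m + s * v) - g w))%C <= s * (kap * Cmod X) + e * s).
    { rewrite Cmod_minus_sym.
      replace (g (m + s * v) - g w - G)%C with
        (s * (g1 m * v) + (g (m + s * v) - g m - s * (g1 m * v)))%C by (unfold G; ring).
      eapply Rle_trans; [apply Cmod_triangle|].
      rewrite !Cmod_mult, Cmod_R, Rabs_pos_eq by lra.
      apply Rplus_le_compat; [|exact K2]. apply Rmult_le_compat_l; [lra|].
      apply Rle_trans with (kap * Cmod (h1 m) * Cmod v).
      - apply Rmult_le_compat_r; [lra | apply Hdil, Hm].
      - rewrite Rmult_assoc, <- Cmod_mult, Eh, Cmod_opp. lra. }
    lra. }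
  unfold N in M. fold X G in M.
  assert (B3 : k * Cmod (h (m + s * v) - h w)%C <= k * ((1 - s) * Cmod X + e * s)).
  { apply Rmult_le_compat_l; lra. }
  assert (Ee : e * (1 + k) = (k - kap) * Cmod X / 2) by (unfold e; field; lra).
  assert (Pf : 0 < s * ((k - kap) * Cmod X / 2)).
  { apply Rmult_lt_0_compat; [lra|]. rewrite <- Ee. apply Rmult_lt_0_compat; lra. }
  assert (s * ((k - kap) * Cmod X) - s * (e * (1 + k)) <= 0) by lra.
  rewrite Ee in *. lra.
Qed.

(** Equal values force [|h z - h w| = |g z - g w|], which contradicts a Lipschitz constant below 1.
    On the disk of radius [t] the dilatation is at most [t], and [(1 + t) / 2] lies strictly between
    [t] and 1. *)
Lemma harmonic_injective (alpha : R) (h h1 h2 g g1 : C -> C) (z w : C) :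
  0 <= alpha < 1 -> convex_order alpha h h1 h2 ->
  (forall z, Cmod z < 1 -> cder g z (g1 z)) ->
  (forall z, Cmod z < 1 -> Cmod (g1 z) <= Cmod z * Cmod (h1 z)) ->
  Cmod z < 1 -> Cmod w < 1 ->
  (h z + Cconj (g z))%C = (h w + Cconj (g w))%C -> z = w.
Proof.
  intros Ha HC Hg Hdil Hz Hw E.
  destruct (Ceq_dec z w) as [|N]; [assumption|exfalso].
  set (t := Rmax (Cmod z) (Cmod w)).
  assert (Ht : t < 1) by (apply Rmax_lub_lt; assumption).
  pose proof (Rmax_l (Cmod z) (Cmod w)) as L1. pose proof (Rmax_r (Cmod z) (Cmod w)) as L2.
  fold t in L1, L2. pose proof (Cmod_ge_0 z).
  pose proof (dilatation_lipschitz alpha h h1 h2 g g1 t t ((1 + t) / 2) z w Ha HC Hg Ht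
    ltac:(lra)) as K.
  specialize (K ltac:(intros y Hy; eapply Rle_trans; [apply Hdil; lra|];
    apply Rmult_le_compat_r; [apply Cmod_ge_0 | exact Hy]) L1 L2).
  assert (Nh : (h z - h w)%C <> 0).
  { intro Q. apply N. apply (convex_injective alpha h h1 h2); auto.
    replace (h z) with ((h z - h w) + h w)%C by ring. rewrite Q; ring. }
  apply Cmod_gt_0 in Nh.
  assert (Eq : Cmod (h z - h w)%C = Cmod (g z - g w)%C).
  { replace (h z - h w)%C with (- Cconj (g z - g w))%C.
    - rewrite Cmod_opp, Cmod_conj. reflexivity.
    - rewrite Cminus_conj.
      replace (h z) with (h w + Cconj (g w) - Cconj (g z))%C by (rewrite <- E; ring). ring. }
  rewrite <- Eq in K. nra.
Qed.

(** * Area distortion of a planar map near a point *)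

(** The general real-linear map of the plane, with determinant [|a|^2 - |b|^2]. In this form the
    differential of [h + Cconj g] has the complex derivatives of [h] and [g] as coefficients. *)
Definition linmap (a b v : C) : C := (a * v + Cconj (b * v))%C.

Definition linmap_inv (a b v : C) : C :=
  ((Cconj a * v - Cconj (b * v)) / RtoC (Cmod a ^ 2 - Cmod b ^ 2))%C.

Definition fder (F : C -> C) (z a b : C) : Prop :=
  forall eps, 0 < eps -> exists del, 0 < del /\ forall w, Cmod (w - z)%C < del ->
    Cmod (F w - F z - linmap a b (w - z))%C <= eps * Cmod (w - z)%C.

Definition rect (a b c d : R) (w : C) : Prop := a <= Re w <= b /\ c <= Im w <= d.
(** Packing uses open rectangles: the two halves of a cut are disjoint, and so are their images
    under an injective map. *)
Definition orect (a b c d : R) (w : C) : Prop := a < Re w < b /\ c < Im w < d.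

Definition image (F : C -> C) (S : C -> Prop) (p : R * R) : Prop := exists w, S w /\ p = F w.

Lemma Cmod_sqr_lt (a b : C) : Cmod b < Cmod a -> 0 < Cmod a ^ 2 - Cmod b ^ 2.
Proof. intros H. pose proof (Cmod_ge_0 b). nra. Qed.

Lemma linmap_invK (a b v : C) : Cmod b < Cmod a -> linmap a b (linmap_inv a b v) = v.
Proof.
  intros H. pose proof (Cmod_sqr_lt a b H) as P.
  assert (N : RtoC (Cmod a ^ 2 - Cmod b ^ 2) <> 0) by (intro E; apply RtoC_inj in E; lra).
  unfold linmap, linmap_inv. set (D := RtoC (Cmod a ^ 2 - Cmod b ^ 2)) in *.
  assert (ED : D = (a * Cconj a - b * Cconj b)%C).
  { unfold D. rewrite RtoC_minus, !Cmod2_conj. reflexivity. }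
  rewrite !Cmult_conj, Cdiv_conj, Cminus_conj, !Cmult_conj, !Cconj_conj by exact N.
  replace (Cconj D) with D by (unfold D; apply Ceq; simpl; ring).
  transitivity ((a * Cconj a - b * Cconj b) / D * v)%C; [field; exact N|].
  rewrite <- ED. field. exact N.
Qed.

Lemma linmap_plus (a b v w : C) : linmap a b (v + w)%C = (linmap a b v + linmap a b w)%C.
Proof. unfold linmap. rewrite !Cmult_conj, Cplus_conj. ring. Qed.

Lemma linmap_minus (a b v w : C) : linmap a b (v - w)%C = (linmap a b v - linmap a b w)%C.
Proof. unfold linmap. rewrite !Cmult_conj, Cminus_conj. ring. Qed.

Lemma linmap_lower (a b v : C) : (Cmod a - Cmod b) * Cmod v <= Cmod (linmap a b v).
Proof.
  unfold linmap. pose proof (Cmod_triangle_rev (a * v)%C (- Cconj (b * v))%C) as T.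
  replace (a * v - - Cconj (b * v))%C with (a * v + Cconj (b * v))%C in T by ring.
  rewrite Cmod_opp, Cmod_conj, !Cmod_mult in T. lra.
Qed.

Lemma linmap_inv_bound (a b v : C) : Cmod b < Cmod a ->
  (Cmod a - Cmod b) * Cmod (linmap_inv a b v) <= Cmod v.
Proof.
  intros H. rewrite <- (linmap_invK a b v H) at 2. apply linmap_lower.
Qed.

Lemma linmap_inv_unique (a b v w : C) : Cmod b < Cmod a -> linmap a b v = w ->
  linmap_inv a b w = v.
Proof.
  intros H E.
  assert (K : Cmod (linmap_inv a b w - v)%C = 0).
  { pose proof (linmap_lower a b (linmap_inv a b w - v)%C) as L.
    rewrite linmap_minus, linmap_invK, E in L by exact H.
    replace (w - w)%C with (RtoC 0) in L by ring. rewrite Cmod_0 in L.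
    pose proof (Cmod_ge_0 (linmap_inv a b w - v)%C). nra. }
  apply Cmod_eq_0 in K. replace v with (linmap_inv a b w - (linmap_inv a b w - v))%C by ring.
  rewrite K; ring.
Qed.

(** The image of the rectangle under [v => p + linmap a b (v - q)], written through the inverse so
    that [affine_box] applies. The numbers [m11] to [m22] are the real matrix of [linmap_inv], of
    determinant [/ D]. *)
Lemma area_parallelogram (a b p q : C) (x1 x2 y1 y2 : R) : Cmod b < Cmod a ->
  x1 <= x2 -> y1 <= y2 ->
  let A := fun y : R * R => rect x1 x2 y1 y2 (q + linmap_inv a b (y - p))%C in
  let m := (x2 - x1) * (y2 - y1) * (Cmod a ^ 2 - Cmod b ^ 2) in
  area_le A m /\ area_ge A m.
Proof.
  intros H Hx Hy A m. pose proof (Cmod_sqr_lt a b H) as P.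
  set (D := Cmod a ^ 2 - Cmod b ^ 2) in *.
  assert (ED : D = Re a ^ 2 + Im a ^ 2 - (Re b ^ 2 + Im b ^ 2)).
  { unfold D. rewrite !Cmod2_alt. ring. }
  set (m11 := (Re a - Re b) / D). set (m12 := (Im a + Im b) / D).
  set (m21 := (Im b - Im a) / D). set (m22 := (Re a + Re b) / D).
  set (e := Re q - m11 * Re p - m12 * Im p). set (k := Im q - m21 * Re p - m22 * Im p).
  assert (ED2 : m11 * m22 - m12 * m21 = / D).
  { unfold m11, m12, m21, m22.
    transitivity ((Re a ^ 2 + Im a ^ 2 - (Re b ^ 2 + Im b ^ 2)) / (D * D)); [field; lra|].
    rewrite <- ED. field. lra. }
  destruct (affine_box m11 m12 e m21 m22 k x1 x2 y1 y2) with (A := A) as [H1 H2].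
  - rewrite ED2. apply Rinv_neq_0_compat. lra.
  - exact Hx.
  - exact Hy.
  - intros [y1' y2']. unfold A, rect, linmap_inv. fold D.
    assert (V : forall v : C, (v / RtoC D)%C = (Re v / D, Im v / D)).
    { intros v. replace (v / RtoC D)%C with (v * RtoC (/ D))%C.
      - apply Ceq; rewrite ?re_scal_r, ?im_scal_r; reflexivity.
      - rewrite RtoC_inv; [reflexivity | lra]. }
    rewrite V, re_plus, im_plus. cbn [Re Im fst snd].
    rewrite !re_minus, !im_minus, !re_mult, !im_mult, !re_conj, !im_conj, !re_mult, !im_mult,
      re_minus, im_minus. cbn [Re Im fst snd].
    change (fst q) with (Re q). change (snd q) with (Im q).
    replace (Re q + (Re a * (y1' - Re p) - - Im a * (y2' - Im p) -
       (Re b * (y1' - Re p) - Im b * (y2' - Im p))) / D)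
      with (m11 * y1' + m12 * y2' + e) by (unfold e, m11, m12; field; lra).
    replace (Im q + (Re a * (y2' - Im p) + - Im a * (y1' - Re p) -
       - (Re b * (y2' - Im p) + Im b * (y1' - Re p))) / D)
      with (m21 * y1' + m22 * y2' + k) by (unfold k, m21, m22; field; lra).
    reflexivity.
  - rewrite ED2 in H1, H2. rewrite Rabs_pos_eq in H1, H2.
    2, 3: apply Rlt_le, Rinv_0_lt_compat, P.
    unfold Rdiv in H1, H2. rewrite Rinv_inv in H1, H2. split; assumption.
Qed.

Lemma rect_diam (x y W H t : R) (w0 w : C) : 0 < t -> 0 < W -> 0 < H ->
  rect x (x + t * W) y (y + t * H) w0 -> rect x (x + t * W) y (y + t * H) w ->
  Cmod (w - w0)%C <= t * (W + H).
Proof.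
  intros Ht HW HH [A B] [A' B'].
  eapply Rle_trans; [apply Cmod_le_sum|]. rewrite re_minus, im_minus.
  assert (Rabs (Re w - Re w0) <= t * W) by (apply Rabs_le; lra).
  assert (Rabs (Im w - Im w0) <= t * H) by (apply Rabs_le; lra). lra.
Qed.

(** Pulled back by the inverse differential, the remainder of [F] is at most [eta * t], so the image
    lies in the parallelogram over the rectangle widened by [eta * t] on every side. *)
Lemma local_area_le (F : C -> C) (w0 a b : C) (W H kap : R) :
  fder F w0 a b -> Cmod b < Cmod a -> 0 < W -> 0 < H -> 0 < kap ->
  exists del, 0 < del /\ forall x y t, 0 < t < del ->
    rect x (x + t * W) y (y + t * H) w0 ->
    area_le (image F (rect x (x + t * W) y (y + t * H)))
      ((Cmod a ^ 2 - Cmod b ^ 2 + kap) * (t * W) * (t * H)).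
Proof.
  intros D Hab HW HH Hk. pose proof (Cmod_sqr_lt a b Hab) as PJ.
  set (J := Cmod a ^ 2 - Cmod b ^ 2) in *. set (m := Cmod a - Cmod b).
  assert (Hm : 0 < m) by (unfold m; lra).
  assert (HWH : 0 < W * H) by (apply Rmult_lt_0_compat; lra).
  assert (HQ : 0 < J * (2 * (W + H) + 4)) by (apply Rmult_lt_0_compat; lra).
  (* The widening adds [t^2 * eta * (2 (W + H) + 4 eta)] to the area of the rectangle; [eta <= 1]
     bounds the inner [4 eta] by 4. *)
  set (eta := Rmin 1 (kap * (W * H) / (J * (2 * (W + H) + 4)))).
  assert (He : 0 < eta).
  { apply Rmin_pos; [lra|]. apply Rdiv_lt_0_compat; [|lra]. apply Rmult_lt_0_compat; lra. }
  assert (He1 : eta <= 1) by apply Rmin_l.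
  assert (He2 : eta * (J * (2 * (W + H) + 4)) <= kap * (W * H)).
  { replace (kap * (W * H)) with
      (kap * (W * H) / (J * (2 * (W + H) + 4)) * (J * (2 * (W + H) + 4))) by (field; lra).
    apply Rmult_le_compat_r; [lra | apply Rmin_r]. }
  destruct (D (eta * m / (W + H))) as [d [Hd K]].
  { apply Rdiv_lt_0_compat; [|lra]. apply Rmult_lt_0_compat; lra. }
  exists (d / (W + H)); split; [apply Rdiv_lt_0_compat; lra|].
  intros x y t [Ht1 Ht2] Hw0.
  assert (Htd : t * (W + H) < d).
  { apply (Rmult_lt_compat_r (W + H)) in Ht2; [|lra].
    unfold Rdiv in Ht2; rewrite Rmult_assoc, Rinv_l in Ht2; lra. }
  destruct (area_parallelogram a b (F w0) w0 (x - eta * t) (x + t * W + eta * t)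
    (y - eta * t) (y + t * H + eta * t) Hab) as [Q _].
  { assert (0 < t * W) by (apply Rmult_lt_0_compat; lra).
    assert (0 < eta * t) by (apply Rmult_lt_0_compat; lra). lra. }
  { assert (0 < t * H) by (apply Rmult_lt_0_compat; lra).
    assert (0 < eta * t) by (apply Rmult_lt_0_compat; lra). lra. }
  eapply area_le_mono; [| |exact Q].
  - intros p [w [Hw ->]].
    pose proof (rect_diam x y W H t w0 w Ht1 HW HH Hw0 Hw) as B.
    specialize (K w ltac:(lra)).
    set (E := (F w - F w0 - linmap a b (w - w0))%C) in *.
    assert (EX : linmap_inv a b (F w - F w0)%C = ((w - w0) + linmap_inv a b E)%C).
    { apply linmap_inv_unique; [exact Hab|].
      rewrite linmap_plus, linmap_invK by exact Hab. unfold E; ring. }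
    assert (BE : Cmod (linmap_inv a b E) <= eta * t).
    { apply Rmult_le_reg_l with m; [exact Hm|].
      eapply Rle_trans; [apply linmap_inv_bound, Hab|].
      eapply Rle_trans; [exact K|].
      replace (m * (eta * t)) with (eta * m / (W + H) * (t * (W + H))) by (field; lra).
      apply Rmult_le_compat_l; [|exact B].
      apply Rlt_le, Rdiv_lt_0_compat; [|lra]. apply Rmult_lt_0_compat; lra. }
    rewrite EX. replace (w0 + (w - w0 + linmap_inv a b E))%C with (w + linmap_inv a b E)%C by ring.
    pose proof (re_le_Cmod (linmap_inv a b E)) as R1. pose proof (im_le_Cmod (linmap_inv a b E)) as R2.
    pose proof (Rle_trans _ _ _ R1 BE) as R3. pose proof (Rle_trans _ _ _ R2 BE) as R4.
    apply Rabs_le_between in R3. apply Rabs_le_between in R4.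
    destruct Hw as [A B']. unfold rect. rewrite re_plus, im_plus. lra.
  - fold J.
    replace ((x + t * W + eta * t - (x - eta * t)) * (y + t * H + eta * t - (y - eta * t)) * J)
      with (t * t * (J * (W * H) + J * (eta * (2 * (W + H) + 4 * eta)))) by ring.
    replace ((J + kap) * (t * W) * (t * H)) with (t * t * (J * (W * H) + kap * (W * H))) by ring.
    apply Rmult_le_compat_l; [apply Rmult_le_pos; lra|].
    apply Rplus_le_compat_l. eapply Rle_trans; [|exact He2].
    replace (eta * (J * (2 * (W + H) + 4))) with (J * (eta * (2 * (W + H) + 4))) by ring.
    apply Rmult_le_compat_l; [lra|]. apply Rmult_le_compat_l; lra.
Qed.

(** A short damped Newton step: along the solution [v] of [linmap a b v = y - F w], the remainder
    costs at most half of the first-order decrease. *)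
Lemma fder_decrease (F : C -> C) (w a b y : C) (r : R) : fder F w a b -> Cmod b < Cmod a ->
  0 < r -> F w <> y ->
  exists w', Cmod (w' - w)%C < r /\ Cmod (F w' - y)%C < Cmod (F w - y)%C.
Proof.
  intros D Hab Hr N.
  set (X := (F w - y)%C).
  assert (PX : 0 < Cmod X).
  { apply Cmod_gt_0. intro E. apply N. replace (F w) with (X + y)%C by (unfold X; ring).
    rewrite E; ring. }
  set (v := linmap_inv a b (- X)%C).
  assert (Lv : linmap a b v = (- X)%C) by (apply linmap_invK, Hab).
  pose proof (Cmod_ge_0 v) as Pv.
  assert (He : 0 < Cmod X / (2 * (Cmod v + 1))) by (apply Rdiv_lt_0_compat; lra).
  destruct (D _ He) as [d [Hd K]].
  set (s := Rmin 1 (Rmin d r / (Cmod v + 1)) / 2).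
  assert (Hdr : 0 < Rmin d r) by (apply Rmin_pos; lra).
  assert (Hq : 0 < Rmin d r / (Cmod v + 1)) by (apply Rdiv_lt_0_compat; lra).
  pose proof (Rmin_l 1 (Rmin d r / (Cmod v + 1))). pose proof (Rmin_r 1 (Rmin d r / (Cmod v + 1))).
  pose proof (Rmin_pos 1 _ Rlt_0_1 Hq).
  assert (Hs : 0 < s < 1 /\ s < Rmin d r / (Cmod v + 1)) by (unfold s; lra).
  destruct Hs as [Hs1 Hs2]. clearbody s.
  apply (Rmult_lt_compat_r (Cmod v + 1)) in Hs2; [|lra].
  unfold Rdiv in Hs2; rewrite Rmult_assoc, Rinv_l, Rmult_1_r in Hs2 by lra.
  pose proof (Rmin_l d r). pose proof (Rmin_r d r).
  assert (Ew : (w + s * v - w)%C = (s * v)%C) by ring.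
  assert (Em : Cmod (s * v)%C = s * Cmod v) by (rewrite Cmod_mult, Cmod_R, Rabs_pos_eq by lra; ring).
  exists (w + s * v)%C. rewrite Ew, Em. split; [lra|].
  specialize (K (w + s * v)%C). rewrite Ew, Em in K. specialize (K ltac:(lra)).
  assert (Ls : linmap a b (s * v)%C = (s * linmap a b v)%C).
  { unfold linmap. rewrite !Cmult_conj. replace (Cconj s) with (RtoC s).
    - ring.
    - apply Ceq; simpl; ring. }
  rewrite Ls, Lv in K. fold X.
  replace (F (w + s * v) - y)%C with ((1 - s)%R * X + (F (w + s * v) - F w - s * - X))%C.
  2: { unfold X. rewrite RtoC_minus. ring. }
  eapply Rle_lt_trans; [apply Cmod_triangle|].
  rewrite Cmod_mult, Cmod_R, Rabs_pos_eq by lra.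
  assert (B : Cmod X / (2 * (Cmod v + 1)) * (s * Cmod v) <= Cmod X / 2 * s).
  { replace (Cmod X / 2 * s) with (Cmod X / (2 * (Cmod v + 1)) * (s * (Cmod v + 1))) by (field; lra).
    apply Rmult_le_compat_l; [lra|]. apply Rmult_le_compat_l; lra. }
  assert (0 < Cmod X / 2 * s) by (apply Rmult_lt_0_compat; lra).
  lra.
Qed.

(** The image must be shown to contain the parallelogram over the shrunken rectangle. For [p] in it,
    [|F w - p|] is minimised over the closed rectangle; the linear approximation keeps the minimiser
    inside, and there a nonzero minimum could be lowered by [fder_decrease]. This replaces the
    inverse function theorem. *)
Lemma local_area_ge (F : C -> C) (w0 a b : C) (W H kap : R) :
  fder F w0 a b -> Cmod b < Cmod a -> 0 < W -> 0 < H -> 0 < kap ->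
  exists del, 0 < del /\ forall x y t, 0 < t < del ->
    rect x (x + t * W) y (y + t * H) w0 ->
    (forall w, rect x (x + t * W) y (y + t * H) w ->
       exists a' b', fder F w a' b' /\ Cmod b' < Cmod a') ->
    area_ge (image F (orect x (x + t * W) y (y + t * H)))
      ((Cmod a ^ 2 - Cmod b ^ 2 - kap) * (t * W) * (t * H)).
Proof.
  intros D Hab HW HH Hk. pose proof (Cmod_sqr_lt a b Hab) as PJ.
  set (J := Cmod a ^ 2 - Cmod b ^ 2) in *. set (m := Cmod a - Cmod b).
  assert (Hm : 0 < m) by (unfold m; lra).
  assert (HWH : 0 < W * H) by (apply Rmult_lt_0_compat; lra).
  assert (HQ : 0 < J * (2 * (W + H))) by (apply Rmult_lt_0_compat; lra).
  (* The first two bounds keep the shrunken rectangle nonempty, and the third limits the lost area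
     to the share of [kap]. *)
  set (eta := Rmin (Rmin (W / 2) (H / 2)) (kap * (W * H) / (J * (2 * (W + H))))).
  assert (He : 0 < eta).
  { apply Rmin_pos; [apply Rmin_pos; lra|].
    apply Rdiv_lt_0_compat; [|lra]. apply Rmult_lt_0_compat; lra. }
  assert (HeW : eta <= W / 2) by (eapply Rle_trans; [apply Rmin_l | apply Rmin_l]).
  assert (HeH : eta <= H / 2) by (eapply Rle_trans; [apply Rmin_l | apply Rmin_r]).
  assert (He2 : eta * (J * (2 * (W + H))) <= kap * (W * H)).
  { replace (kap * (W * H)) with
      (kap * (W * H) / (J * (2 * (W + H))) * (J * (2 * (W + H)))) by (field; lra).
    apply Rmult_le_compat_r; [lra | apply Rmin_r]. }
  clearbody eta.
  (* The remainder is used twice, at the minimiser and at [x0]; two thirds of [eta * m * t] still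
     fall short of the margin. *)
  set (eps := eta * m / (3 * (W + H))).
  assert (Heps : 0 < eps).
  { apply Rdiv_lt_0_compat; [|lra]. apply Rmult_lt_0_compat; lra. }
  destruct (D eps Heps) as [d [Hd K]].
  exists (d / (W + H)); split; [apply Rdiv_lt_0_compat; lra|].
  intros x y t [Ht1 Ht2] Hw0 DF.
  assert (Htd : t * (W + H) < d).
  { apply (Rmult_lt_compat_r (W + H)) in Ht2; [|lra].
    unfold Rdiv in Ht2; rewrite Rmult_assoc, Rinv_l in Ht2; lra. }
  assert (TW : eta * t <= W / 2 * t) by (apply Rmult_le_compat_r; lra).
  assert (TH : eta * t <= H / 2 * t) by (apply Rmult_le_compat_r; lra).
  assert (Pe : 0 < eta * t) by (apply Rmult_lt_0_compat; lra).
  destruct (area_parallelogram a b (F w0) w0 (x + eta * t) (x + t * W - eta * t)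
    (y + eta * t) (y + t * H - eta * t) Hab) as [_ Q]; [lra|lra|].
  eapply area_ge_mono; [| |exact Q].
  - intros p Hp. set (S := rect x (x + t * W) y (y + t * H)) in *.
    set (x0 := (w0 + linmap_inv a b (p - F w0))%C) in *.
    change (rect (x + eta * t) (x + t * W - eta * t) (y + eta * t) (y + t * H - eta * t) x0) in Hp.
    assert (Lx0 : linmap a b (x0 - w0)%C = (p - F w0)%C).
    { unfold x0. replace (w0 + linmap_inv a b (p - F w0) - w0)%C with (linmap_inv a b (p - F w0)%C)
        by ring. apply linmap_invK, Hab. }
    assert (Sx0 : S x0) by (unfold S, rect in *; lra).
    assert (Approx : forall w, S w ->
      Cmod (F w - p - linmap a b (w - x0))%C <= eta * m * t / 3).
    { intros w Hw. pose proof (rect_diam x y W H t w0 w Ht1 HW HH Hw0 Hw) as B.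
      specialize (K w ltac:(lra)).
      replace (F w - p - linmap a b (w - x0))%C with (F w - F w0 - linmap a b (w - w0))%C.
      2: { replace (w - x0)%C with ((w - w0) - (x0 - w0))%C by ring.
           rewrite (linmap_minus a b (w - w0)%C), Lx0. ring. }
      eapply Rle_trans; [exact K|].
      replace (eta * m * t / 3) with (eps * (t * (W + H))) by (unfold eps; field; lra).
      apply Rmult_le_compat_l; lra. }
    destruct (compact_max S (fun w => - Cmod (F w - p)%C) (Cmod w0 + t * (W + H)))
      as [w [Sw Min]].
    + exists w0; exact Hw0.
    + intros w Hw. pose proof (rect_diam x y W H t w0 w Ht1 HW HH Hw0 Hw) as B.
      pose proof (Cmod_triangle_rev w w0). lra.
    + intros w Nw.
      assert (G : exists del, 0 < del /\ forall w', Rabs (Re w' - Re w) < del ->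
        Rabs (Im w' - Im w) < del -> ~ S w').
      { unfold S, rect in *.
        destruct (Rlt_dec (Re w) x) as [L|L].
        { exists (x - Re w); split; [lra|]. intros w' B _. apply Rabs_lt_between in B. lra. }
        destruct (Rlt_dec (x + t * W) (Re w)) as [L2|L2].
        { exists (Re w - (x + t * W)); split; [lra|]. intros w' B _. apply Rabs_lt_between in B. lra. }
        destruct (Rlt_dec (Im w) y) as [L3|L3].
        { exists (y - Im w); split; [lra|]. intros w' _ B. apply Rabs_lt_between in B. lra. }
        exists (Im w - (y + t * H)); split; [lra|]. intros w' _ B. apply Rabs_lt_between in B. lra. }
      destruct G as [del [Hdel G]]. exists del; split; [exact Hdel|]. intros w' Hw'. apply G.
      * rewrite <- re_minus. eapply Rle_lt_trans; [apply re_le_Cmod | exact Hw'].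
      * rewrite <- im_minus. eapply Rle_lt_trans; [apply im_le_Cmod | exact Hw'].
    + intros w Hw e Hee. destruct (DF w Hw) as [a' [b' [D' _]]].
      pose proof (Cmod_ge_0 a') as Pa. pose proof (Cmod_ge_0 b') as Pb.
      set (M := Cmod a' + Cmod b' + 1). assert (HM : 0 < M) by (unfold M; lra).
      destruct (D' 1 Rlt_0_1) as [d1 [Hd1 K1]].
      exists (Rmin d1 (e / M)); split; [apply Rmin_pos; [lra | apply Rdiv_lt_0_compat; lra]|].
      intros w' _ Hw'.
      specialize (K1 w' (Rlt_le_trans _ _ _ Hw' (Rmin_l _ _))).
      pose proof (Rlt_le_trans _ _ _ Hw' (Rmin_r _ _)) as H2.
      apply (Rmult_lt_compat_r M) in H2; [|exact HM].
      unfold Rdiv in H2; rewrite Rmult_assoc, Rinv_l, Rmult_1_r in H2 by lra.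
      assert (BL : Cmod (linmap a' b' (w' - w)) <= (Cmod a' + Cmod b') * Cmod (w' - w)%C).
      { unfold linmap. eapply Rle_trans; [apply Cmod_triangle|].
        rewrite Cmod_conj, !Cmod_mult. lra. }
      assert (BF : Cmod (F w' - F w)%C <= M * Cmod (w' - w)%C).
      { replace (F w' - F w)%C with ((F w' - F w - linmap a' b' (w' - w)) + linmap a' b' (w' - w))%C
          by ring.
        eapply Rle_trans; [apply Cmod_triangle|]. unfold M. lra. }
      pose proof (Cmod_triangle_rev (F w - p)%C (F w' - p)%C) as T.
      replace (F w - p - (F w' - p))%C with (- (F w' - F w))%C in T by ring.
      rewrite Cmod_opp in T. lra.
    + exists w. destruct (Ceq_dec (F w) p) as [E|N].
      * split; [|symmetry; exact E].
        assert (Far : Cmod (w - x0)%C < eta * t).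
        { pose proof (Approx w Sw) as A. rewrite E in A.
          replace (p - p - linmap a b (w - x0))%C with (- linmap a b (w - x0))%C in A by ring.
          rewrite Cmod_opp in A. pose proof (linmap_lower a b (w - x0)%C) as L. fold m in L.
          apply Rmult_lt_reg_l with m; [exact Hm|].
          assert (0 < m * (eta * t)) by (apply Rmult_lt_0_compat; lra). lra. }
        pose proof (re_le_Cmod (w - x0)%C) as R1. pose proof (im_le_Cmod (w - x0)%C) as R2.
        rewrite re_minus in R1. rewrite im_minus in R2.
        assert (R3 : Rabs (Re w - Re x0) < eta * t) by lra.
        assert (R4 : Rabs (Im w - Im x0) < eta * t) by lra.
        apply Rabs_lt_between in R3. apply Rabs_lt_between in R4.
        destruct Hp as [P1 P2]. unfold orect. lra.
      (* The minimiser is closer than [eta * t] to [x0], so the disk of radius [rad] about it stays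
         in [S], and a smaller value there contradicts minimality. *)
      * exfalso.
        pose proof (Min x0 Sx0) as M0. cbv beta in M0.
        pose proof (Approx x0 Sx0) as A0.
        replace (x0 - x0)%C with (RtoC 0) in A0 by ring.
        replace (F x0 - p - linmap a b 0)%C with (F x0 - p)%C in A0.
        2: { unfold linmap. rewrite !Cmult_0_r. replace (Cconj 0) with (RtoC 0).
             - ring.
             - apply Ceq; simpl; ring. }
        assert (Far : Cmod (w - x0)%C < eta * t).
        { pose proof (Approx w Sw) as A.
          pose proof (linmap_lower a b (w - x0)%C) as L. fold m in L.
          pose proof (Cmod_triangle_rev (linmap a b (w - x0)) (- (F w - p - linmap a b (w - x0)))%C) as T.
          replace (linmap a b (w - x0) - - (F w - p - linmap a b (w - x0)))%C with (F w - p)%C in T by ring.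
          rewrite Cmod_opp in T.
          apply Rmult_lt_reg_l with m; [exact Hm|].
          assert (0 < m * (eta * t)) by (apply Rmult_lt_0_compat; lra). lra. }
        pose proof (re_le_Cmod (w - x0)%C) as R1. pose proof (im_le_Cmod (w - x0)%C) as R2.
        rewrite re_minus in R1. rewrite im_minus in R2.
        set (rad := eta * t - Cmod (w - x0)%C).
        destruct (DF w Sw) as [a' [b' [D' Hab']]].
        destruct (fder_decrease F w a' b' p rad D' Hab' ltac:(unfold rad; lra) N) as [w' [Hw' Lt]].
        assert (Sw' : S w').
        { pose proof (re_le_Cmod (w' - w)%C) as R5. pose proof (im_le_Cmod (w' - w)%C) as R6.
          rewrite re_minus in R5. rewrite im_minus in R6.
          apply Rabs_le_between in R1. apply Rabs_le_between in R2.
          apply Rabs_le_between in R5. apply Rabs_le_between in R6.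
          destruct Hp as [P1 P2]. unfold S, rect, rad in *. lra. }
        specialize (Min w' Sw'). cbv beta in Min. lra.
  - fold J.
    replace ((x + t * W - eta * t - (x + eta * t)) * (y + t * H - eta * t - (y + eta * t)) * J)
      with (t * t * (J * (W * H) - eta * (J * (2 * (W + H))) + J * (4 * (eta * eta)))) by ring.
    replace ((J - kap) * (t * W) * (t * H)) with (t * t * (J * (W * H) - kap * (W * H))) by ring.
    apply Rmult_le_compat_l; [apply Rmult_le_pos; lra|].
    assert (0 <= J * (4 * (eta * eta))).
    { apply Rmult_le_pos; [lra|]. pose proof (Rmult_lt_0_compat _ _ He He). lra. }
    lra.
Qed.

(** Straddle estimate: as [s] lies between the endpoints, the errors at the two ends add up to [eps]
    times the length of the interval. *)
Lemma increment_bounds (Psi : R -> R) (s m eps W : R) : is_derive Psi s m -> 0 < eps -> 0 < W ->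
  exists del, 0 < del /\ forall a t, 0 < t < del -> a <= s <= a + t * W ->
    (m - eps) * (t * W) <= Psi (a + t * W) - Psi a <= (m + eps) * (t * W).
Proof.
  intros D Heps HW. rewrite is_derive_eps in D. destruct (D eps Heps) as [d [Hd K]].
  exists (d / W); split; [apply Rdiv_lt_0_compat; lra|].
  intros a t [Ht1 Ht2] Hs.
  apply (Rmult_lt_compat_r W) in Ht2; [|exact HW].
  unfold Rdiv in Ht2; rewrite Rmult_assoc, Rinv_l, Rmult_1_r in Ht2 by lra.
  pose proof (K (a + t * W)) as K1. pose proof (K a) as K2.
  rewrite Rabs_pos_eq in K1 by lra. specialize (K1 ltac:(lra)).
  rewrite (Rabs_minus_sym a s), (Rabs_pos_eq (s - a)) in K2 by lra. specialize (K2 ltac:(lra)).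
  apply Rabs_le_between in K1. apply Rabs_le_between in K2.
  assert (E1 : (a + t * W - s) * m + (s - a) * m = m * (t * W)) by ring.
  assert (E2 : eps * (a + t * W - s) + eps * (s - a) = eps * (t * W)) by ring.
  assert (E3 : (a - s) * m = - ((s - a) * m)) by ring.
  lra.
Qed.

(** * From local area estimates to integrals over rectangles *)

Section area_integral.
Context (F a b : C -> C) (M Psi : R -> R) (x0 y0 W H : R).
Context (HW : 0 < W) (HH : 0 < H).
Context (DF : forall w, rect x0 (x0 + W) y0 (y0 + H) w ->
  fder F w (a w) (b w) /\ Cmod (b w) < Cmod (a w)).
Context (DPsi : forall s, x0 <= s <= x0 + W -> is_derive Psi s (M s)).

(** The right-hand side is additive under vertical and horizontal cuts, so bisection reduces the
    claim to small rectangles. There half of [eps] pays for the area estimate and half for the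
    increment of [Psi]. *)
Lemma area_le_integral (eps : R) : 0 < eps ->
  (forall w, rect x0 (x0 + W) y0 (y0 + H) w -> Cmod (a w) ^ 2 - Cmod (b w) ^ 2 <= M (Re w)) ->
  area_le (image F (rect x0 (x0 + W) y0 (y0 + H)))
    (H * (Psi (x0 + W) - Psi x0) + eps * W * H).
Proof.
  intros Heps HJ.
  set (P := fun x1 x2 y1 y2 => area_le (image F (rect x1 x2 y1 y2))
    ((y2 - y1) * (Psi x2 - Psi x1) + eps * (x2 - x1) * (y2 - y1))).
  assert (All : P x0 (x0 + W) y0 (y0 + H)).
  { apply cousin_rectangle; [| |lra|lra|].
    - intros x1 m x2 y1 y2 Hm Hy P1 P2. unfold P in *.
      replace ((y2 - y1) * (Psi x2 - Psi x1) + eps * (x2 - x1) * (y2 - y1)) with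
        (((y2 - y1) * (Psi m - Psi x1) + eps * (m - x1) * (y2 - y1)) +
         ((y2 - y1) * (Psi x2 - Psi m) + eps * (x2 - m) * (y2 - y1))) by ring.
      refine (area_le_union _ _ _ _ _ _ P1 P2).
      intros p [w [[Hw1 Hw2] ->]].
      destruct (Rle_dec (Re w) m); [left|right]; exists w; (split; [split; lra|reflexivity]).
    - intros x1 x2 y1 m y2 Hx Hm P1 P2. unfold P in *.
      replace ((y2 - y1) * (Psi x2 - Psi x1) + eps * (x2 - x1) * (y2 - y1)) with
        (((m - y1) * (Psi x2 - Psi x1) + eps * (x2 - x1) * (m - y1)) +
         ((y2 - m) * (Psi x2 - Psi x1) + eps * (x2 - x1) * (y2 - m))) by ring.
      refine (area_le_union _ _ _ _ _ _ P1 P2).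
      intros p [w [[Hw1 Hw2] ->]].
      destruct (Rle_dec (Im w) m); [left|right]; exists w; (split; [split; lra|reflexivity]).
    - intros x y Hx Hy. set (w := (x, y) : C).
      assert (Hw : rect x0 (x0 + W) y0 (y0 + H) w) by (split; assumption).
      destruct (DF w Hw) as [D Lt].
      destruct (local_area_le F w (a w) (b w) W H (eps / 2) D Lt HW HH ltac:(lra)) as [d1 [Hd1 K1]].
      destruct (increment_bounds Psi x (M x) (eps / 2) W (DPsi x Hx) ltac:(lra) HW) as [d2 [Hd2 K2]].
      exists (Rmin d1 d2); split; [apply Rmin_pos; lra|].
      intros x1 y1 t [Ht1 Ht2] Hx1 Hy1 _ _ _ _.
      pose proof (Rlt_le_trans _ _ _ Ht2 (Rmin_l _ _)) as L1.
      pose proof (Rlt_le_trans _ _ _ Ht2 (Rmin_r _ _)) as L2.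
      specialize (K1 x1 y1 t (conj Ht1 L1) (conj Hx1 Hy1)).
      destruct (K2 x1 t (conj Ht1 L2) Hx1) as [K3 _].
      unfold P. eapply area_le_mono; [|  |exact K1]; [auto|].
      replace (y1 + t * H - y1) with (t * H) by ring.
      replace (x1 + t * W - x1) with (t * W) by ring.
      pose proof (HJ w Hw) as J. change (Re w) with x in J.
      pose proof (Rmult_lt_0_compat _ _ Ht1 HW) as PW. pose proof (Rmult_lt_0_compat _ _ Ht1 HH) as PH.
      apply Rle_trans with (((M x - eps / 2) * (t * W) + eps * (t * W)) * (t * H)).
      + apply Rmult_le_compat_r; [lra|].
        apply Rle_trans with ((M x + eps / 2) * (t * W)); [|lra].
        apply Rmult_le_compat_r; lra.
      + replace (t * H * (Psi (x1 + t * W) - Psi x1) + eps * (t * W) * (t * H)) with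
          ((Psi (x1 + t * W) - Psi x1 + eps * (t * W)) * (t * H)) by ring.
        apply Rmult_le_compat_r; lra. }
  unfold P in All. eapply area_le_mono; [| |exact All]; [auto|].
  replace (y0 + H - y0) with H by ring. replace (x0 + W - x0) with W by ring. lra.
Qed.

Lemma area_ge_integral (eps : R) : 0 < eps ->
  (forall w, rect x0 (x0 + W) y0 (y0 + H) w -> M (Re w) <= Cmod (a w) ^ 2 - Cmod (b w) ^ 2) ->
  (forall w w', orect x0 (x0 + W) y0 (y0 + H) w -> orect x0 (x0 + W) y0 (y0 + H) w' ->
     F w = F w' -> w = w') ->
  area_ge (image F (orect x0 (x0 + W) y0 (y0 + H)))
    (H * (Psi (x0 + W) - Psi x0) - eps * W * H).
Proof.
  intros Heps HJ Inj.
  (* Inclusion in the large rectangle is carried along: injectivity, which separates the images of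
     two halves, and differentiability are assumed only there. *)
  set (P := fun x1 x2 y1 y2 =>
    x0 <= x1 -> x2 <= x0 + W -> y0 <= y1 -> y2 <= y0 + H ->
    area_ge (image F (orect x1 x2 y1 y2))
    ((y2 - y1) * (Psi x2 - Psi x1) - eps * (x2 - x1) * (y2 - y1))).
  assert (All : P x0 (x0 + W) y0 (y0 + H)).
  { apply cousin_rectangle; [| |lra|lra|].
    - intros x1 m x2 y1 y2 Hm Hy P1 P2 I1 I2 I3 I4. unfold P in *.
      specialize (P1 I1 ltac:(lra) I3 I4). specialize (P2 ltac:(lra) I2 I3 I4).
      replace ((y2 - y1) * (Psi x2 - Psi x1) - eps * (x2 - x1) * (y2 - y1)) with
        (((y2 - y1) * (Psi m - Psi x1) - eps * (m - x1) * (y2 - y1)) +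
         ((y2 - y1) * (Psi x2 - Psi m) - eps * (x2 - m) * (y2 - y1))) by ring.
      refine (area_ge_union _ _ _ _ _ _ _ P1 P2).
      + intros p [[w [[Hw1 Hw2] ->]]|[w [[Hw1 Hw2] ->]]];
          exists w; (split; [split; lra|reflexivity]).
      + intros p [w [[Hw1 Hw2] ->]] [w' [[Hw1' Hw2'] E]].
        assert (Eq : w = w') by (apply Inj; [split; lra | split; lra | exact E]).
        rewrite Eq in Hw1. lra.
    - intros x1 x2 y1 m y2 Hx Hm P1 P2 I1 I2 I3 I4. unfold P in *.
      specialize (P1 I1 I2 I3 ltac:(lra)). specialize (P2 I1 I2 ltac:(lra) I4).
      replace ((y2 - y1) * (Psi x2 - Psi x1) - eps * (x2 - x1) * (y2 - y1)) with
        (((m - y1) * (Psi x2 - Psi x1) - eps * (x2 - x1) * (m - y1)) +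
         ((y2 - m) * (Psi x2 - Psi x1) - eps * (x2 - x1) * (y2 - m))) by ring.
      refine (area_ge_union _ _ _ _ _ _ _ P1 P2).
      + intros p [[w [[Hw1 Hw2] ->]]|[w [[Hw1 Hw2] ->]]];
          exists w; (split; [split; lra|reflexivity]).
      + intros p [w [[Hw1 Hw2] ->]] [w' [[Hw1' Hw2'] E]].
        assert (Eq : w = w') by (apply Inj; [split; lra | split; lra | exact E]).
        rewrite Eq in Hw2. lra.
    - intros x y Hx Hy. set (w := (x, y) : C).
      assert (Hw : rect x0 (x0 + W) y0 (y0 + H) w) by (split; assumption).
      destruct (DF w Hw) as [D Lt].
      destruct (local_area_ge F w (a w) (b w) W H (eps / 2) D Lt HW HH ltac:(lra)) as [d1 [Hd1 K1]].
      destruct (increment_bounds Psi x (M x) (eps / 2) W (DPsi x Hx) ltac:(lra) HW) as [d2 [Hd2 K2]].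
      exists (Rmin d1 d2); split; [apply Rmin_pos; lra|].
      intros x1 y1 t [Ht1 Ht2] Hx1 Hy1 I1 I2 I3 I4 _ _ _ _.
      pose proof (Rlt_le_trans _ _ _ Ht2 (Rmin_l _ _)) as L1.
      pose proof (Rlt_le_trans _ _ _ Ht2 (Rmin_r _ _)) as L2.
      specialize (K1 x1 y1 t (conj Ht1 L1) (conj Hx1 Hy1)).
      destruct (K2 x1 t (conj Ht1 L2) Hx1) as [_ K3].
      eapply area_ge_mono; [| |apply K1]; [auto| |].
      + replace (y1 + t * H - y1) with (t * H) by ring.
        replace (x1 + t * W - x1) with (t * W) by ring.
        pose proof (HJ w Hw) as J. change (Re w) with x in J.
        pose proof (Rmult_lt_0_compat _ _ Ht1 HW) as PW. pose proof (Rmult_lt_0_compat _ _ Ht1 HH) as PH.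
        apply Rle_trans with (((M x + eps / 2) * (t * W) - eps * (t * W)) * (t * H)).
        * replace (t * H * (Psi (x1 + t * W) - Psi x1) - eps * (t * W) * (t * H)) with
            ((Psi (x1 + t * W) - Psi x1 - eps * (t * W)) * (t * H)) by ring.
          apply Rmult_le_compat_r; lra.
        * apply Rmult_le_compat_r; [lra|].
          apply Rle_trans with ((M x - eps / 2) * (t * W)); [lra|].
          apply Rmult_le_compat_r; lra.
      + intros w' [Hw1 Hw2]. exists (a w'), (b w'). apply DF. split; lra. }
  unfold P in All. eapply area_ge_mono; [| |apply All; lra]; [auto|].
  replace (y0 + H - y0) with H by ring. replace (x0 + W - x0) with W by ring. lra.
Qed.
End area_integral.

(** * Areas of images of disks *)

Lemma fder_harmonic (h g : C -> C) (z a b : C) : cder h z a -> cder g z b ->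
  fder (fun w => h w + Cconj (g w))%C z a b.
Proof.
  intros Dh Dg eps Heps.
  destruct (Dh (eps / 2)) as [d1 [Hd1 K1]]; [lra|].
  destruct (Dg (eps / 2)) as [d2 [Hd2 K2]]; [lra|].
  exists (Rmin d1 d2); split; [apply Rmin_pos; lra|]. intros w Hw.
  specialize (K1 w (Rlt_le_trans _ _ _ Hw (Rmin_l _ _))).
  specialize (K2 w (Rlt_le_trans _ _ _ Hw (Rmin_r _ _))).
  rewrite <- Cmod_conj in K2.
  replace (h w + Cconj (g w) - (h z + Cconj (g z)) - linmap a b (w - z))%C with
    ((h w - h z - a * (w - z)) + Cconj (g w - g z - b * (w - z)))%C.
  2: { unfold linmap. rewrite !Cminus_conj, !Cmult_conj, Cminus_conj. ring. }
  eapply Rle_trans; [apply Cmod_triangle|]. lra.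
Qed.

Section primitive.
Context (G : R -> R) (HG : forall x, -1 < x < 1 -> continuous G x).

Lemma is_derive_primitive (x : R) : -1 < x < 1 -> is_derive (fun x => RInt G 0 x) x (G x).
Proof.
  intros Hx. apply (is_derive_RInt G (fun x => RInt G 0 x) 0 x); [|apply HG, Hx].
  assert (Hd : 0 < Rmin (x + 1) (1 - x)) by (apply Rmin_pos; lra).
  exists (mkposreal _ Hd). intros y Hy.
  apply (RInt_correct (V := R_CompleteNormedModule)).
  apply (ex_RInt_continuous (V := R_CompleteNormedModule)). intros z Hz. apply HG.
  assert (B : Rabs (y - x) < Rmin (x + 1) (1 - x)) by exact Hy.
  apply Rabs_lt_between in B.
  pose proof (Rmin_l (x + 1) (1 - x)). pose proof (Rmin_r (x + 1) (1 - x)).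
  assert (-1 < Rmin 0 y) by (apply Rmin_glb_lt; lra).
  assert (Rmax 0 y < 1) by (apply Rmax_lub_lt; lra). lra.
Qed.

Lemma is_derive_primitive_exp (s : R) : s < 0 ->
  is_derive (fun s => RInt G 0 (exp s)) s (exp s * G (exp s)).
Proof.
  intros Hs. pose proof (exp_pos s).
  assert (exp s < 1) by (rewrite <- exp_0; apply exp_increasing, Hs).
  apply (is_derive_comp (fun x => RInt G 0 x) exp s (G (exp s)) (exp s)).
  - apply is_derive_primitive; lra.
  - apply is_derive_Reals, derivable_pt_lim_exp.
Qed.

(** Since [G] is continuous on both sides of 0, its primitive is differentiable there, hence at most
    [(|G 0| + 1) * x] for small [x]. *)
Lemma primitive_small (eps : R) : 0 < eps -> exists del, 0 < del /\
  forall x, 0 < x < del -> Rabs (RInt G 0 x) < eps.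
Proof.
  intros Heps.
  pose proof (is_derive_primitive 0 ltac:(lra)) as D. rewrite is_derive_eps in D.
  destruct (D 1 Rlt_0_1) as [d [Hd K]].
  pose proof (Rabs_pos (G 0)).
  assert (HM : 0 < Rabs (G 0) + 2) by lra.
  exists (Rmin d (eps / (Rabs (G 0) + 2))).
  split; [apply Rmin_pos; [lra | apply Rdiv_lt_0_compat; lra]|].
  intros x [Hx1 Hx2].
  pose proof (Rlt_le_trans _ _ _ Hx2 (Rmin_l _ _)) as H1.
  pose proof (Rlt_le_trans _ _ _ Hx2 (Rmin_r _ _)) as H2.
  specialize (K x). rewrite Rminus_0_r, (Rabs_pos_eq x) in K by lra. specialize (K H1).
  assert (E0 : RInt G 0 0 = 0) by apply (RInt_point (V := R_CompleteNormedModule)).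
  rewrite E0, Rminus_0_r in K.
  apply (Rmult_lt_compat_r (Rabs (G 0) + 2)) in H2; [|exact HM].
  unfold Rdiv in H2; rewrite Rmult_assoc, Rinv_l, Rmult_1_r in H2 by lra.
  replace (RInt G 0 x) with ((RInt G 0 x - x * G 0) + x * G 0) by ring.
  eapply Rle_lt_trans; [apply Rabs_triang|]. rewrite Rabs_mult, (Rabs_pos_eq x) by lra. lra.
Qed.
End primitive.

(** Handles the neighbourhood of the origin, which a bounded rectangle in the exponential chart
    cannot reach: its image lies in a square of side [2 * M * d]. *)
Lemma area_le_small_disk (f : C -> C) (a b : C) (eps : R) : fder f 0 a b -> f 0%C = 0%C ->
  0 < eps -> exists del, 0 < del /\ forall d, 0 < d < del -> area_le (image_disk f d) eps.
Proof.
  intros D E0 Heps. destruct (D 1 Rlt_0_1) as [d1 [Hd1 K]].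
  pose proof (Cmod_ge_0 a) as Pa. pose proof (Cmod_ge_0 b) as Pb.
  set (M := Cmod a + Cmod b + 1). assert (HM : 1 <= M) by (unfold M; lra).
  assert (HQ : 0 < 4 * M * M) by nra.
  assert (HM4 : 0 < eps / (4 * M * M)) by (apply Rdiv_lt_0_compat; lra).
  exists (Rmin d1 (Rmin 1 (eps / (4 * M * M)))).
  split; [repeat apply Rmin_pos; lra|].
  intros d [Hd Hd2].
  pose proof (Rlt_le_trans _ _ _ Hd2 (Rmin_l _ _)) as H1.
  pose proof (Rlt_le_trans _ _ _ Hd2 (Rmin_r _ _)) as H2.
  pose proof (Rlt_le_trans _ _ _ H2 (Rmin_l _ _)) as H3.
  pose proof (Rlt_le_trans _ _ _ H2 (Rmin_r _ _)) as H4. clear H2 Hd2.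
  assert (PMd : 0 < M * d) by (apply Rmult_lt_0_compat; lra).
  destruct (affine_box 1 0 0 0 1 0 (- (M * d)) (M * d) (- (M * d)) (M * d)) with
    (A := fun p => (- (M * d) <= 1 * fst p + 0 * snd p + 0 <= M * d) /\
                   (- (M * d) <= 0 * fst p + 1 * snd p + 0 <= M * d)) as [Q _];
    [lra|lra|lra|reflexivity|].
  eapply area_le_mono; [| |exact Q].
  - intros p [z [Hz ->]]. unfold disk in Hz.
    specialize (K z). replace (z - 0)%C with z in K by ring. specialize (K ltac:(lra)).
    rewrite E0 in K.
    assert (B : Cmod (f z) <= M * d).
    { replace (f z) with ((f z - 0 - linmap a b z) + linmap a b z)%C by ring.
      eapply Rle_trans; [apply Cmod_triangle|].
      assert (BL : Cmod (linmap a b z) <= (Cmod a + Cmod b) * Cmod z).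
      { unfold linmap. eapply Rle_trans; [apply Cmod_triangle|].
        rewrite Cmod_conj, !Cmod_mult. lra. }
      apply Rle_trans with (M * Cmod z); [unfold M; lra|]. apply Rmult_le_compat_l; lra. }
    pose proof (Rle_trans _ _ _ (re_le_Cmod (f z)) B) as R1.
    pose proof (Rle_trans _ _ _ (im_le_Cmod (f z)) B) as R2.
    apply Rabs_le_between in R1. apply Rabs_le_between in R2.
    change (fst (f z)) with (Re (f z)). change (snd (f z)) with (Im (f z)). lra.
  - replace (1 * 1 - 0 * 0) with 1 by ring. rewrite Rabs_R1, Rdiv_1_r.
    apply (Rmult_lt_compat_r (4 * M * M)) in H4; [|exact HQ].
    unfold Rdiv in H4; rewrite (Rmult_assoc eps), Rinv_l, Rmult_1_r in H4 by lra.
    replace ((M * d - - (M * d)) * (M * d - - (M * d))) with (d * (d * (4 * M * M))) by ring.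
    assert (d * (d * (4 * M * M)) <= 1 * (d * (4 * M * M))).
    { apply Rmult_le_compat_r; [|lra]. apply Rmult_le_pos; lra. }
    lra.
Qed.

Lemma Cexp_ln_polar (z : C) : z <> 0 ->
  exists t, 0 <= t <= 2 * PI /\ z = Cexp (ln (Cmod z), t).
Proof.
  intros N. apply Cmod_gt_0 in N. destruct (polar z) as [t [Ht E]].
  exists t; split; [exact Ht|]. unfold Cexp; simpl Re; simpl Im.
  rewrite exp_ln by exact N. exact E.
Qed.

Lemma Cexp_injective_strip (w w' : C) :
  0 < Im w < 2 * PI -> 0 < Im w' < 2 * PI -> Cexp w = Cexp w' -> w = w'.
Proof.
  intros Hw Hw' E.
  assert (ER : Re w = Re w').
  { apply exp_inv. rewrite <- !Cmod_Cexp, E. reflexivity. }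
  assert (E1 : Cexp (w - w')%C = 1).
  { replace (Cexp (w - w')%C) with (Cexp (w - w') * Cexp w' / Cexp w')%C
      by (field; apply Cexp_neq_0).
    rewrite <- Cexp_add. replace (w - w' + w')%C with w by ring.
    rewrite E. field. apply Cexp_neq_0. }
  set (t := Im w - Im w').
  assert (Ct : cos t = 1).
  { assert (K : Re (Cexp (w - w')%C) = 1) by (rewrite E1; reflexivity).
    unfold Cexp in K. cbn [Re fst] in K. rewrite re_minus, im_minus, ER, Rminus_diag, exp_0 in K.
    fold t in K. lra. }
  apply Ceq; [exact ER|].
  assert (S : sin (t / 2) = 0).
  { replace t with (2 * (t / 2)) in Ct by field. rewrite cos_2a_sin in Ct. nra. }
  assert (B : - PI < t / 2 < PI) by (unfold t; lra).
  destruct (Rtotal_order (t / 2) 0) as [L|[Z|L]].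
  - assert (0 < sin (- (t / 2))) by (apply sin_gt_0; lra). rewrite sin_neg in H. lra.
  - unfold t in Z. lra.
  - assert (0 < sin (t / 2)) by (apply sin_gt_0; lra). lra.
Qed.

Section harmonic_area.
Context (h g h1 g1 : C -> C).
Context (Dh : forall z, Cmod z < 1 -> cder h z (h1 z)).
Context (Dg : forall z, Cmod z < 1 -> cder g z (g1 z)).
Context (Sense : forall z, Cmod z < 1 -> Cmod (g1 z) < Cmod (h1 z)).
Context (h0 : h 0%C = 0%C) (g0 : g 0%C = 0%C).
Context (G : R -> R) (HG : forall x, -1 < x < 1 -> continuous G x).

Let f := fun z : C => (h z + Cconj (g z))%C.

Let polar_chart (x0 W : R) : x0 + W < 0 -> forall w, rect x0 (x0 + W) 0 (0 + 2 * PI) w ->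
  Cmod (Cexp w) < 1 /\
  fder (fun w => f (Cexp w)) w (h1 (Cexp w) * Cexp w)%C (g1 (Cexp w) * Cexp w)%C /\
  Cmod (g1 (Cexp w) * Cexp w)%C < Cmod (h1 (Cexp w) * Cexp w)%C.
Proof.
  intros HW w [Hw _].
  assert (B : Cmod (Cexp w) < 1).
  { rewrite Cmod_Cexp, <- exp_0. apply exp_increasing. lra. }
  split; [exact B|]. split.
  - apply (fder_harmonic (fun w => h (Cexp w)) (fun w => g (Cexp w))).
    + apply (cder_comp h Cexp); [apply cder_Cexp | apply Dh, B].
    + apply (cder_comp g Cexp); [apply cder_Cexp | apply Dg, B].
  - rewrite !Cmod_mult. apply Rmult_lt_compat_r; [|apply Sense, B].
    apply Cmod_gt_0, Cexp_neq_0.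
Qed.

(** Of the two factors [exp (Re w)], one is the polar density, absorbed in [G], and the other is the
    derivative of the radius [exp s] in the logarithmic variable. *)
Let jacobian (w : C) :
  Cmod (h1 (Cexp w) * Cexp w)%C ^ 2 - Cmod (g1 (Cexp w) * Cexp w)%C ^ 2 =
  exp (Re w) ^ 2 * (Cmod (h1 (Cexp w)) ^ 2 - Cmod (g1 (Cexp w)) ^ 2).
Proof. rewrite !Cmod_mult, Cmod_Cexp. ring. Qed.

(** The disk is covered by a disk about 0 with image area at most [eps / 2] and by the annulus that
    the closed rectangle parametrises. *)
Lemma harmonic_area_le (r : R) : 0 < r < 1 ->
  (forall x, 0 < x < 1 -> 0 <= G x) ->
  (forall z, Cmod z < 1 -> Cmod z * (Cmod (h1 z) ^ 2 - Cmod (g1 z) ^ 2) <= G (Cmod z)) ->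
  forall eps, 0 < eps -> area_le (image_disk f r) (2 * PI * RInt G 0 r + eps).
Proof.
  intros Hr PG HJ eps Heps. pose proof two_pi_pos as P2.
  assert (D0 : fder f 0 (h1 0) (g1 0)).
  { apply fder_harmonic; [apply Dh | apply Dg]; rewrite Cmod_0; lra. }
  assert (f0 : f 0%C = 0%C).
  { unfold f. rewrite h0, g0. apply Ceq; simpl; ring. }
  destruct (area_le_small_disk f (h1 0) (g1 0) (eps / 2) D0 f0 ltac:(lra)) as [d1 [Hd1 K1]].
  set (d := Rmin d1 r / 2).
  pose proof (Rmin_pos d1 r Hd1 (proj1 Hr)). pose proof (Rmin_l d1 r). pose proof (Rmin_r d1 r).
  assert (Hd : 0 < d < d1 /\ d < r) by (unfold d; lra). clearbody d.
  specialize (K1 d (proj1 Hd)).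
  set (x0 := ln d). set (W := ln r - ln d).
  assert (HW : 0 < W) by (unfold W; pose proof (ln_increasing d r (proj1 (proj1 Hd)) (proj2 Hd)); lra).
  assert (EW : x0 + W = ln r) by (unfold x0, W; ring).
  assert (Neg : x0 + W < 0) by (rewrite EW, <- ln_1; apply ln_increasing; lra).
  (* Makes the error [e * W * (2 * PI)] of the rectangle equal to [eps / 2]. *)
  set (e := eps / (2 * (W * (2 * PI)))).
  assert (HWP : 0 < W * (2 * PI)) by (apply Rmult_lt_0_compat; lra).
  assert (He : 0 < e) by (apply Rdiv_lt_0_compat; lra).
  pose proof (area_le_integral (fun w => f (Cexp w)) (fun w => h1 (Cexp w) * Cexp w)%C
    (fun w => g1 (Cexp w) * Cexp w)%C (fun s => exp s * G (exp s)) (fun s => RInt G 0 (exp s))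
    x0 0 W (2 * PI) HW P2) as K2.
  specialize (K2 ltac:(intros w Hw; apply (polar_chart x0 W Neg w Hw))).
  specialize (K2 ltac:(intros s Hs; apply is_derive_primitive_exp; [exact HG | lra]) e He).
  assert (K3 : area_le (image (fun w => f (Cexp w)) (rect x0 (x0 + W) 0 (0 + 2 * PI)))
    (2 * PI * (RInt G 0 r - RInt G 0 d) + eps / 2)).
  { replace (eps / 2) with (e * W * (2 * PI)) by (unfold e; field; pose proof PI_RGT_0; lra).
    replace (RInt G 0 r) with (RInt G 0 (exp (x0 + W))) by (rewrite EW, exp_ln by lra; reflexivity).
    replace (RInt G 0 d) with (RInt G 0 (exp x0)) by (unfold x0; rewrite exp_ln by lra; reflexivity).
    apply K2. intros w Hw. destruct (polar_chart x0 W Neg w Hw) as [B _].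
    rewrite jacobian. specialize (HJ (Cexp w) B). rewrite Cmod_Cexp in HJ.
    replace (exp (Re w) ^ 2 * (Cmod (h1 (Cexp w)) ^ 2 - Cmod (g1 (Cexp w)) ^ 2)) with
      (exp (Re w) * (exp (Re w) * (Cmod (h1 (Cexp w)) ^ 2 - Cmod (g1 (Cexp w)) ^ 2))) by ring.
    apply Rmult_le_compat_l; [apply Rlt_le, exp_pos | exact HJ]. }
  (* The rectangle only yields the integral from [d] to [r]; nonnegativity of [G] allows the rest to
     be added. *)
  assert (PI0 : 0 <= RInt G 0 d).
  { apply RInt_ge_0; [lra| |intros; apply PG; lra].
    apply (ex_RInt_continuous (V := R_CompleteNormedModule)). intros x Hx.
    rewrite Rmin_left, Rmax_right in Hx by lra. apply HG; lra. }
  assert (U : area_le (image_disk f r) (eps / 2 + (2 * PI * (RInt G 0 r - RInt G 0 d) + eps / 2))).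
  { refine (area_le_union _ _ _ _ _ _ K1 K3).
    intros p [z [Hz ->]]. unfold disk in Hz.
    destruct (Rlt_dec (Cmod z) d) as [L|L]; [left; exists z; split; [exact L|reflexivity]|].
    right. assert (Nz : 0 < Cmod z) by lra.
    destruct (Cexp_ln_polar z (proj2 (Cmod_gt_0 z) Nz)) as [t [Ht E]].
    exists (ln (Cmod z), t). split; [|rewrite <- E; reflexivity].
    split; simpl.
    - rewrite EW. split; apply ln_le; lra.
    - lra. }
  eapply area_le_mono; [| |exact U]; [auto|].
  assert (0 <= 2 * PI * RInt G 0 d) by (apply Rmult_le_pos; lra). lra.
Qed.

(** The open rectangle parametrises injectively the open annulus slit along the positive axis.
    Leaving out the disk of radius [d] costs [2 * PI] times the integral over [0, d], made at most
    [eps / 2] by [primitive_small]. *)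
Lemma harmonic_area_ge (r : R) : 0 < r < 1 ->
  (forall z, Cmod z < 1 -> G (Cmod z) <= Cmod z * (Cmod (h1 z) ^ 2 - Cmod (g1 z) ^ 2)) ->
  (forall z w, Cmod z < 1 -> Cmod w < 1 -> f z = f w -> z = w) ->
  forall eps, 0 < eps -> area_ge (image_disk f r) (2 * PI * RInt G 0 r - eps).
Proof.
  intros Hr HJ Inj eps Heps. pose proof two_pi_pos as P2.
  destruct (primitive_small G HG (eps / (2 * (2 * PI))) ltac:(apply Rdiv_lt_0_compat; lra))
    as [d1 [Hd1 K1]].
  set (d := Rmin d1 r / 2).
  pose proof (Rmin_pos d1 r Hd1 (proj1 Hr)). pose proof (Rmin_l d1 r). pose proof (Rmin_r d1 r).
  assert (Hd : 0 < d < d1 /\ d < r) by (unfold d; lra). clearbody d.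
  specialize (K1 d (proj1 Hd)).
  set (x0 := ln d). set (W := ln r - ln d).
  assert (HW : 0 < W) by (unfold W; pose proof (ln_increasing d r (proj1 (proj1 Hd)) (proj2 Hd)); lra).
  assert (EW : x0 + W = ln r) by (unfold x0, W; ring).
  assert (Neg : x0 + W < 0) by (rewrite EW, <- ln_1; apply ln_increasing; lra).
  set (e := eps / (2 * (W * (2 * PI)))).
  assert (HWP : 0 < W * (2 * PI)) by (apply Rmult_lt_0_compat; lra).
  assert (He : 0 < e) by (apply Rdiv_lt_0_compat; lra).
  pose proof (area_ge_integral (fun w => f (Cexp w)) (fun w => h1 (Cexp w) * Cexp w)%C
    (fun w => g1 (Cexp w) * Cexp w)%C (fun s => exp s * G (exp s)) (fun s => RInt G 0 (exp s))
    x0 0 W (2 * PI) HW P2) as K2.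
  specialize (K2 ltac:(intros w Hw; apply (polar_chart x0 W Neg w Hw))).
  specialize (K2 ltac:(intros s Hs; apply is_derive_primitive_exp; [exact HG | lra]) e He).
  assert (In : forall w, orect x0 (x0 + W) 0 (0 + 2 * PI) w -> Cmod (Cexp w) < 1).
  { intros w [Hw1 Hw2]. apply (polar_chart x0 W Neg w). split; lra. }
  assert (K3 : area_ge (image (fun w => f (Cexp w)) (orect x0 (x0 + W) 0 (0 + 2 * PI)))
    (2 * PI * (RInt G 0 r - RInt G 0 d) - eps / 2)).
  { replace (eps / 2) with (e * W * (2 * PI)) by (unfold e; field; pose proof PI_RGT_0; lra).
    replace (RInt G 0 r) with (RInt G 0 (exp (x0 + W))) by (rewrite EW, exp_ln by lra; reflexivity).
    replace (RInt G 0 d) with (RInt G 0 (exp x0)) by (unfold x0; rewrite exp_ln by lra; reflexivity).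
    apply K2.
    - intros w Hw. destruct (polar_chart x0 W Neg w Hw) as [B _].
      rewrite jacobian. specialize (HJ (Cexp w) B). rewrite Cmod_Cexp in HJ.
      replace (exp (Re w) ^ 2 * (Cmod (h1 (Cexp w)) ^ 2 - Cmod (g1 (Cexp w)) ^ 2)) with
        (exp (Re w) * (exp (Re w) * (Cmod (h1 (Cexp w)) ^ 2 - Cmod (g1 (Cexp w)) ^ 2))) by ring.
      apply Rmult_le_compat_l; [apply Rlt_le, exp_pos | exact HJ].
    - intros w w' Hw Hw' E.
      apply Inj in E; [|apply In, Hw | apply In, Hw'].
      apply Cexp_injective_strip; [| |exact E].
      + destruct Hw as [_ Hw]; lra.
      + destruct Hw' as [_ Hw']; lra. }
  eapply area_ge_mono; [| |exact K3].
  - intros p [w [[Hw1 Hw2] ->]]. exists (Cexp w). split; [|reflexivity].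
    unfold disk. rewrite Cmod_Cexp, <- (exp_ln r) by lra. apply exp_increasing.
    rewrite EW in Hw1. lra.
  - apply Rabs_lt_between in K1.
    assert (2 * PI * RInt G 0 d <= eps / 2).
    { replace (eps / 2) with (2 * PI * (eps / (2 * (2 * PI)))) by (field; pose proof PI_RGT_0; lra).
      apply Rmult_le_compat_l; lra. }
    lra.
Qed.
End harmonic_area.

(* h1, h2 : first and second complex derivatives of h on the unit disk;
   g1 : complex derivative of g on the unit disk; f = h + conj g. *)
Theorem theorem3p4 (alpha : R) (n : nat) (zeta : C)
  (h g h1 h2 g1 : C -> C) (r : R) :
  0 <= alpha < 1 ->
  Cmod zeta <= / (2 * INR n - 1) ->
  (forall z : C, disk 1 z -> C_has_deriv h z (h1 z)) ->
  (forall z : C, disk 1 z -> C_has_deriv h1 z (h2 z)) ->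
  (forall z : C, disk 1 z -> C_has_deriv g z (g1 z)) ->
  h 0%C = 0%C -> g 0%C = 0%C -> h1 0%C = 1%C ->
  (forall z : C, disk 1 z ->
     h1 z <> 0%C /\ alpha < Re (1 + z * h2 z / h1 z)%C) ->
  (forall z : C, disk 1 z -> g1 z = (zeta * z ^ n * h1 z)%C) ->
  0 < r < 1 ->
  let f := fun z : C => (h z + Cconj (g z))%C in
  plane_area_between
    (2 * PI * RInt (fun rho => rho * (1 - (Cmod zeta) ^ 2 * rho ^ (2 * n))
                               / Rpower (1 + rho) (4 * (1 - alpha))) 0 r)
    (image_disk f r)
    (2 * PI * RInt (fun rho => rho * (1 - (Cmod zeta) ^ 2 * rho ^ (2 * n))
                               / Rpower (1 - rho) (4 * (1 - alpha))) 0 r).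
Proof.
  intros Ha Hzeta Hh Hh1 Hg h0 g0 h10 Hc Hg1 Hr f.
  assert (Dh : forall z, Cmod z < 1 -> cder h z (h1 z)) by (intros z Hz; apply cder_of_has_deriv, Hh, Hz).
  assert (Dh1 : forall z, Cmod z < 1 -> cder h1 z (h2 z)) by (intros z Hz; apply cder_of_has_deriv, Hh1, Hz).
  assert (Dg : forall z, Cmod z < 1 -> cder g z (g1 z)) by (intros z Hz; apply cder_of_has_deriv, Hg, Hz).
  assert (HC : convex_order alpha h h1 h2).
  { assert (H : hol h h1) by (intros z Hz; split; [apply Dh, Hz | eapply cder_ccont, Dh1, Hz]).
    split; [exact H|]. split; [|split; [exact h10 | exact Hc]].
    (* The hypotheses give no continuity of [h2]; it is inherited from the regular derivative [h2'],
       with which [h2] agrees on the disk by uniqueness. *)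
    destruct (hol_regular h h1 H) as [h2' H'].
    intros z Hz. split; [apply Dh1, Hz|].
    intros eps Heps. destruct (H' z Hz) as [D Cn].
    destruct (Cn eps Heps) as [d [Hd K]].
    exists (Rmin d (1 - Cmod z)); split; [apply Rmin_pos; lra|]. intros w Hw.
    pose proof (Rlt_le_trans _ _ _ Hw (Rmin_l _ _)) as L1.
    pose proof (Rlt_le_trans _ _ _ Hw (Rmin_r _ _)) as L2.
    assert (Hw1 : Cmod w < 1) by (pose proof (Cmod_triangle_rev w z); lra).
    rewrite (cder_unique h1 w (h2 w) (h2' w)), (cder_unique h1 z (h2 z) (h2' z));
      [apply K, L1 | apply Dh1, Hz | exact D | apply Dh1, Hw1 | apply H', Hw1]. }
  (* For [n = 0] the bound on [zeta] is the negative number [/ -1], which no modulus satisfies. *)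
  assert (Hn : (1 <= n)%nat /\ Cmod zeta <= 1).
  { pose proof (Cmod_ge_0 zeta). destruct n as [|n].
    - simpl in Hzeta. replace (2 * 0 - 1) with (-1) in Hzeta by ring.
      assert (/ -1 < 0) by (apply Rinv_lt_0_compat; lra). lra.
    - split; [apply le_n_S, Nat.le_0_l|]. eapply Rle_trans; [exact Hzeta|].
      rewrite <- Rinv_1. apply Rinv_le_contravar; [lra|].
      rewrite S_INR. pose proof (pos_INR n). lra. }
  destruct Hn as [Hn Hz1]. pose proof (Cmod_ge_0 zeta) as Pz0.
  (* This is where [n >= 1] enters: with [|zeta| <= 1] it bounds the dilatation by [|z|], which
     stays away from 1 on smaller disks. *)
  assert (Pow : forall x, 0 <= x < 1 -> 0 <= x ^ n <= x).
  { intros x Hx. split; [apply pow_le; lra|]. destruct n as [|m]; [inversion Hn|].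
    simpl. rewrite <- (Rmult_1_r x) at 3. apply Rmult_le_compat_l; [lra|].
    rewrite <- (pow1 m). apply pow_incr. lra. }
  assert (Dil : forall z, Cmod z < 1 -> Cmod (g1 z) = Cmod zeta * Cmod z ^ n * Cmod (h1 z)).
  { intros z Hz. rewrite (Hg1 z Hz), !Cmod_mult, Cmod_pow. reflexivity. }
  assert (Ph1 : forall z, Cmod z < 1 -> 0 < Cmod (h1 z)).
  { intros z Hz. apply Cmod_gt_0, Hc, Hz. }
  assert (Dil2 : forall z, Cmod z < 1 -> Cmod (g1 z) <= Cmod z * Cmod (h1 z)).
  { intros z Hz. rewrite Dil by exact Hz. pose proof (Cmod_ge_0 z).
    apply Rmult_le_compat_r; [apply Cmod_ge_0|].
    destruct (Pow (Cmod z)) as [P1 P2]; [lra|].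
    rewrite <- (Rmult_1_l (Cmod z)) at 2. apply Rmult_le_compat; lra. }
  assert (Sense : forall z, Cmod z < 1 -> Cmod (g1 z) < Cmod (h1 z)).
  { intros z Hz. eapply Rle_lt_trans; [apply Dil2, Hz|].
    rewrite <- (Rmult_1_l (Cmod (h1 z))) at 2. apply Rmult_lt_compat_r; [apply Ph1, Hz | exact Hz]. }
  assert (Jac : forall z, Cmod z < 1 -> Cmod (h1 z) ^ 2 - Cmod (g1 z) ^ 2 =
    (1 - Cmod zeta ^ 2 * Cmod z ^ (2 * n)) * Cmod (h1 z) ^ 2).
  { intros z Hz. rewrite Dil by exact Hz.
    replace (Cmod z ^ (2 * n)) with ((Cmod z ^ n) ^ 2) by (rewrite <- pow_mult; f_equal; lia). ring. }
  assert (PW : forall x, 0 <= x < 1 -> 0 <= x * (1 - Cmod zeta ^ 2 * x ^ (2 * n))).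
  { intros x Hx. apply Rmult_le_pos; [lra|].
    replace (x ^ (2 * n)) with ((x ^ n) ^ 2) by (rewrite <- pow_mult; f_equal; lia).
    destruct (Pow x Hx) as [P1 P2].
    rewrite <- Rpow_mult_distr.
    assert (0 <= Cmod zeta * x ^ n <= 1) by (split; [apply Rmult_le_pos; lra|];
      rewrite <- (Rmult_1_l 1); apply Rmult_le_compat; lra).
    assert ((Cmod zeta * x ^ n) ^ 2 <= 1 ^ 2) by (apply pow_incr; lra). lra. }
  (* Serves both [1 + rho] and [1 - rho]. Positivity on all of (-1, 1) is required because [Rpower]
     is defined through [ln]. *)
  assert (Cont : forall u : R -> R, (forall x, -1 < x < 1 -> 0 < u x) ->
    (forall x, ex_derive u x) -> forall x, -1 < x < 1 ->
    continuous (fun rho => rho * (1 - Cmod zeta ^ 2 * rho ^ (2 * n)) / Rpower (u rho) (4 * (1 - alpha))) x).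
  { intros u Pu Du x Hx. apply (ex_derive_continuous (V := R_NormedModule)).
    unfold Rpower. auto_derive. repeat split; auto.
    apply Rgt_not_eq, exp_pos. }
  apply plane_area_between_eps; intros eps Heps.
  - apply (harmonic_area_ge h g h1 g1); auto.
    + apply (Cont (fun rho => 1 + rho)); intros; [lra | auto_derive; auto].
    + intros z Hz. pose proof (Cmod_ge_0 z). rewrite Jac, <- Rmult_assoc by exact Hz.
      apply Rmult_le_compat_l; [apply PW; lra|].
      apply (growth alpha h h1 h2 z Ha HC Hz).
    + intros z w Hz Hw. apply (harmonic_injective alpha h h1 h2 g g1 z w Ha HC Dg Dil2 Hz Hw).
  - apply (harmonic_area_le h g h1 g1); auto.
    + apply (Cont (fun rho => 1 - rho)); intros; [lra | auto_derive; auto].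
    + intros x Hx. apply Rmult_le_pos; [apply PW; lra|].
      apply Rlt_le, Rinv_0_lt_compat, exp_pos.
    + intros z Hz. pose proof (Cmod_ge_0 z). rewrite Jac, <- Rmult_assoc by exact Hz.
      apply Rmult_le_compat_l; [apply PW; lra|].
      apply (growth alpha h h1 h2 z Ha HC Hz).
Qed.
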